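(* Let $\mu=\mu_n\times\mu_m$, where $\mu_n,\mu_m$ are upper doubling measures on $\mathbb{R}^n,\mathbb{R}^m$ with dominating functions $\lambda_n,\lambda_m$. Let $T$ be an $L^2(\mu)$-bounded product Calderón–Zygmund operator with the vector-valued Calderón–Zygmund structure described in the context, and let $b\in L^\infty(\mu)$. Then $$\|Tb\|_{\mathrm{BMO}_{\mathrm{prod}}(\mu)}\le C\|b\|_{L^\infty(\mu)},$$ where $C$ depends only on $n,m$, the constants of $\lambda_n,\lambda_m$, the parameter $r$, $\|T\|_{L^2(\mu)\to L^2(\mu)}$ and the constants and exponents in the kernel assumptions on $T$.
   Context: **Measures.** $\mathbb{R}^n,\mathbb{R}^m$ carry the $\ell^\infty$ metric. A Borel measure $\nu$ on $\mathbb{R}^d$ is upper doubling with dominating function $\lambda\colon\mathbb{R}^d\times(0,\infty)\to(0,\infty)$ if $r\mapsto\lambda(x,r)$ is non-decreasing, $\lambda(x,2r)\le C_\lambda\lambda(x,r)$ and $\nu(B(x,r))\le\lambda(x,r)$ for all $x,r$. Put $d_\lambda=\log_2C_\lambda$. Dominating functions are also assumed to satisfy $\lambda(x,r)\le C\lambda(y,r)$ if $|x-y|\le r$. Pairings are bilinear. **Operator class.** $T$ is bounded on $L^2(\mu)$. Viewed on $L^2(\mu_n;L^2(\mu_m))$, it has a kernel $T_1(x_1,y_1)$ ($x_1\ne y_1$), whose values are $L^2(\mu_m)$-bounded Calderón–Zygmund operators, with $$\langle\Phi,T\Psi\rangle=\iint\langle\Phi(x_1),T_1(x_1,y_1)\Psi(y_1)\rangle_{L^2(\mu_m)}\,d\mu_n(x_1)\,d\mu_n(y_1)$$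 for disjointly supported $L^2(\mu_m)$-valued functions $\Phi,\Psi$, and, for some $\alpha>0$, $\|T_1(x_1,y_1)\|_{CZ(\mu_m)}\le \frac{C}{\lambda_n(x_1,|x_1-y_1|)}$ and $\|T_1(x_1,y_1)-T_1(x_1',y_1)\|_{CZ(\mu_m)}\le C\big(\frac{|x_1-x_1'|}{|x_1-y_1|}\big)^\alpha\frac1{\lambda_n(x_1,|x_1-y_1|)}$ for $|x_1-y_1|>2|x_1-x_1'|$. Here $\|U\|_{CZ(\mu_m)}$ is the sum of the $L^2(\mu_m)$ operator norm of $U$ and the best constants in the scalar kernel estimates $|k(x_2,y_2)|\le \frac{c}{\lambda_m(x_2,|x_2-y_2|)}$ and $|k(x_2,y_2)-k(x_2',y_2)|\le c\big(\frac{|x_2-x_2'|}{|x_2-y_2|}\big)^\beta\frac1{\lambda_m(x_2,|x_2-y_2|)}$ for $|x_2-y_2|>2|x_2-x_2'|$, where $k$ is the kernel of $U$ and $\beta>0$ is fixed. The analogous conditions (with $n,\alpha$ and $m,\beta$ exchanged) hold when $T$ is viewed on $L^2(\mu_m;L^2(\mu_n))$, with a kernel $T_2(x_2,y_2)$. Regularity in the second variable is not required. **Dyadic grids.** Let $\mathcal D^0_n$ be the standard dyadic grid of $\mathbb{R}^n$. A dyadic grid is a family $\{I+\sum_{i:2^{-i}<\ell(I)}2^{-i}w_i:I\in\mathcal D^0_n\}$ with $w_i\in\{0,1\}^n$, $i\in\mathbb{Z}$; only grids without quadrants are used (any strictly increasing sequence of its cubes exhausts $\mathbb{R}^n$). Similarly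 in $\mathbb{R}^m$. $\operatorname{gen}(I)=k$ if $\ell(I)=2^{-k}$, and $\operatorname{gen}(I\times J)=(\operatorname{gen}(I),\operatorname{gen}(J))$. Let $\gamma_n=\alpha/(2d_{\lambda_n}+2\alpha)$, $\gamma_m=\beta/(2d_{\lambda_m}+2\beta)$, and let $r$ be a fixed (large) positive integer. A cube $I\in\mathcal D_n$ is ($\mathcal D_n'$-)bad if there is $I'\in\mathcal D_n'$ with $\ell(I')\ge2^r\ell(I)$ and $d(I,\partial I')\le4\ell(I)^{\gamma_n}\ell(I')^{1-\gamma_n}$; otherwise good. Same in $\mathbb{R}^m$ with $\gamma_m$. $R=I\times J$ is good if $I$ is $\mathcal D_n'$-good and $J$ is $\mathcal D_m'$-good. **Haar functions.** Index the dyadic children $I_1,\dots,I_{2^n}$ of $I$ so that $\hat I_k=\bigcup_{u\ge k}I_u$ satisfies $\mu_n(\hat I_k)\ge[1-(k-1)2^{-n}]\mu_n(I)$. For $\eta=1,\dots,2^n-1$, $$h_{I,\eta}=\Big(\frac{\mu_n(I_\eta)\mu_n(\hat I_{\eta+1})}{\mu_n(\hat I_\eta)}\Big)^{1/2}\Big[\frac{\chi_{I_\eta}}{\mu_n(I_\eta)}-\frac{\chi_{\hat I_{\eta+1}}}{\mu_n(\hat I_{\eta+1})}\Big]$$ ($h_{I,\eta}=0$ if $\mu_n(I_\eta)=0$). The functions $u_{J,\kappa}$, $\kappa=1,\dots,2^m-1$, are defined in the same way on $(\mathbb{R}^m,\mu_m)$. **Product BMO.** $\|B\|_{\mathrm{BMO}_{\mathrm{prod}}(\mu)}$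 is the least $L$ such that for all grids $\mathcal D=\mathcal D_n\times\mathcal D_m$, $\mathcal D'=\mathcal D_n'\times\mathcal D_m'$, $$\Big(\sum_{\eta=1}^{2^n-1}\sum_{\kappa=1}^{2^m-1}\sum_{\substack{S\in\mathcal D'\\S\subset\Omega}}\ \sum_{\substack{R=I\times J\in\mathcal D\text{ good},\ R\subset S\\ \operatorname{gen}(R)=\operatorname{gen}(S)+(r,r)}}|\langle B,h_{I,\eta}\otimes u_{J,\kappa}\rangle|^2\Big)^{1/2}\le L\mu(\Omega)^{1/2}$$ for all $\Omega\subset\mathbb{R}^{n+m}$ with $\mu(\Omega)<\infty$ such that every $x\in\Omega$ lies in some $S\in\mathcal D'$ with $S\subset\Omega$. For $B=Tb$ the pairing is $\langle Tb,h_{I,\eta}\otimes u_{J,\kappa}\rangle=\lim_{N\to\infty}\langle T(b\chi_{[-N,N]^{n+m}}),h_{I,\eta}\otimes u_{J,\kappa}\rangle$ (the limit exists by the kernel assumptions and the vanishing integrals of the Haar functions). *)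

(* Defs.v *)
From HB Require Import structures.
From mathcomp Require Import all_boot all_order all_algebra.
From mathcomp Require Import complex.
From mathcomp Require Import all_classical all_reals all_analysis.
Import Order.TTheory GRing.Theory Num.Theory.
Import numFieldNormedType.Exports.

Set Implicit Arguments.
Unset Strict Implicit.
Unset Printing Implicit Defensive.

Local Open Scope classical_set_scope.
Local Open Scope ring_scope.
Local Open Scope complex_scope.

Notation cmod := ComplexField.Normc.normc.

(* MathComp-Analysis has no sigma-algebra on row vectors: use the Borel one. The
   norm and topology that the library puts on ['rV[R]_n] are those of l^infty. *)
HB.instance Definition _ (R : realType) (n : nat) :=
  Measurable.copy 'rV[R]_n (g_sigma_algebraType (@open 'rV[R]_n)).

Section ComplexFunctions.
Context d (T : measurableType d) (R : realType).
Variable mu : {measure set T -> \bar R}.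
Implicit Types f g : T -> R[i].

Definition Cintegrable f : Prop :=
  mu.-integrable setT (EFin \o (@complex.Re R \o f)) /\
  mu.-integrable setT (EFin \o (@complex.Im R \o f)).

Definition Cintegral f : R[i] :=
  (\int[mu]_x complex.Re (f x)) +i* (\int[mu]_x complex.Im (f x)).

Definition Cmeasurable f : Prop :=
  measurable_fun setT (@complex.Re R \o f) /\ measurable_fun setT (@complex.Im R \o f).

Definition CLnorm (p : \bar R) f : \bar R :=
  Lnorm mu p (fun x => (cmod (f x))%:E).

Definition CL (p : \bar R) f : Prop :=
  Cmeasurable f /\ (CLnorm p f < +oo)%E.

Definition pairing f g : R[i] := Cintegral (fun x => f x * g x).

(* Operators act on representatives: identities between functions hold mu-a.e. *)

Definition linear_on_L2 (U : (T -> R[i]) -> T -> R[i]) : Prop :=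
  forall (a : R[i]) f g, CL 2%:E f -> CL 2%:E g ->
    \forall x \ae mu, U (fun y => a * f y + g y) x = a * U f x + U g x.

Definition opnorm (U : (T -> R[i]) -> T -> R[i]) : \bar R :=
  ereal_inf [set M%:E | M in [set M : R | 0 <= M /\
    forall f, CL 2%:E f -> (CLnorm 2%:E (U f) <= M%:E * CLnorm 2%:E f)%E]].

Definition bounded_on_L2 (U : (T -> R[i]) -> T -> R[i]) : Prop :=
  [/\ forall f, CL 2%:E f -> CL 2%:E (U f),
      linear_on_L2 U & (opnorm U < +oo)%E].

End ComplexFunctions.

Section UpperDoubling.
Context (R : realType) (n : nat).
Implicit Types (lam : 'rV[R]_n -> R -> R).

(* [C] is the doubling constant [C_lambda], and [C'] the constant with which
   lambda(x,r) <= C' lambda(y,r) when |x-y| <= r. *)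
Definition dominating lam (C C' : R) : Prop :=
  [/\ forall x r, 0 < r -> 0 < lam x r,
      forall x r s, 0 < r -> r <= s -> lam x r <= lam x s,
      forall x r, 0 < r -> lam x (2 * r) <= C * lam x r &
      forall x y r, 0 < r -> `|x - y| <= r -> lam x r <= C' * lam y r].

Definition upper_doubling (mu : set 'rV[R]_n -> \bar R) lam (C C' : R) : Prop :=
  dominating lam C C' /\
  forall x r, 0 < r -> (mu (ball x r) <= (lam x r)%:E)%E.

Definition log2 (x : R) : R := ln x / ln 2.

Definition gam (alpha C : R) : R := alpha / (2 * log2 C + 2 * alpha).

End UpperDoubling.

Section CalderonZygmund.
Context (R : realType) (n : nat).
Variables (mu : {sigma_finite_measure set 'rV[R]_n -> \bar R}).
Variables (lam : 'rV[R]_n -> R -> R) (beta : R).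
Implicit Types (U : ('rV[R]_n -> R[i]) -> 'rV[R]_n -> R[i]).
Implicit Types (k : 'rV[R]_n -> 'rV[R]_n -> R[i]).

(* Disjointly supported: the supports are contained in disjoint compact sets,
   so that the double integral converges absolutely. *)
Definition is_kernel U k : Prop :=
  forall (F G : set 'rV[R]_n) (f g : 'rV[R]_n -> R[i]),
    compact F -> compact G -> F `&` G = set0 ->
    CL mu 2%:E f -> CL mu 2%:E g ->
    (forall x, ~ F x -> f x = 0) -> (forall y, ~ G y -> g y = 0) ->
    let K := fun p : 'rV[R]_n * 'rV[R]_n => f p.1 * (k p.1 p.2 * g p.2) in
    Cintegrable (mu \x mu)%E K /\
    pairing mu f (U g) = Cintegral (mu \x mu)%E K.

Definition size_const k : \bar R :=
  ereal_inf [set c%:E | c in [set c : R | 0 <= c /\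
    forall x y, x != y ->
      cmod (k x y) <= c / lam x `|x - y|]].

Definition regularity_const k : \bar R :=
  ereal_inf [set c%:E | c in [set c : R | 0 <= c /\
    forall x x' y, 2 * `|x - x'| < `|x - y| ->
      cmod (k x y - k x' y) <=
        c * (`|x - x'| / `|x - y|) `^ beta / lam x `|x - y|]].

(* Off the diagonal the kernel is only determined almost everywhere, whence the
   infimum over its versions; the value is +oo if there is no kernel. *)
Definition CZnorm U : \bar R :=
  ereal_inf [set (opnorm mu U + size_const k + regularity_const k)%E |
             k in is_kernel U].

Definition CZ_operator U : Prop := bounded_on_L2 mu U /\ (CZnorm U < +oo)%E.

End CalderonZygmund.

(* [T] is viewed on L^2(mu1; L^2(mu2)), the values being [fun x2 => f (x1, x2)]. *)
Section VectorValued.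
Context (R : realType) (n1 n2 : nat).
Local Notation X1 := 'rV[R]_n1.
Local Notation X2 := 'rV[R]_n2.
Variables (mu1 : {sigma_finite_measure set X1 -> \bar R}).
Variables (mu2 : {sigma_finite_measure set X2 -> \bar R}).
Variables (lam1 : X1 -> R -> R) (lam2 : X2 -> R -> R) (alpha beta : R).
Implicit Types (T : (X1 * X2 -> R[i]) -> X1 * X2 -> R[i]).
Local Notation opkernel := (X1 -> X1 -> (X2 -> R[i]) -> X2 -> R[i]).

Definition is_vector_kernel T (T1 : opkernel) : Prop :=
  forall (F G : set X1) (Phi Psi : X1 * X2 -> R[i]),
    compact F -> compact G -> F `&` G = set0 ->
    CL (mu1 \x mu2)%E 2%:E Phi -> CL (mu1 \x mu2)%E 2%:E Psi ->
    (forall x, ~ F x.1 -> Phi x = 0) -> (forall y, ~ G y.1 -> Psi y = 0) ->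
    let K := fun p : X1 * X1 =>
      pairing mu2 (fun x2 => Phi (p.1, x2))
                  (T1 p.1 p.2 (fun y2 => Psi (p.2, y2))) in
    Cintegrable (mu1 \x mu1)%E K /\
    pairing (mu1 \x mu2)%E Phi (T Psi) = Cintegral (mu1 \x mu1)%E K.

Definition vector_CZ (C : R) T (T1 : opkernel) : Prop :=
  [/\ is_vector_kernel T T1,
      forall x1 y1, x1 != y1 -> CZ_operator mu2 lam2 beta (T1 x1 y1),
      forall x1 y1, x1 != y1 ->
        (CZnorm mu2 lam2 beta (T1 x1 y1) <= (C / lam1 x1 `|x1 - y1|)%:E)%E &
      forall x1 x1' y1, 2 * `|x1 - x1'| < `|x1 - y1| ->
        (CZnorm mu2 lam2 beta (fun f x2 => (T1 x1 y1 f x2 - T1 x1' y1 f x2)%R)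
         <= (C * (`|x1 - x1'| / `|x1 - y1|) `^ alpha
               / lam1 x1 `|x1 - y1|)%:E)%E].

End VectorValued.

Definition swap_op (A X Y : Type) (T : (X * Y -> A) -> X * Y -> A) :
    (Y * X -> A) -> Y * X -> A :=
  fun f y => T (fun x => f (x.2, x.1)) (y.2, y.1).

Definition product_CZ (R : realType) (n m : nat)
    (mun : {sigma_finite_measure set 'rV[R]_n -> \bar R})
    (mum : {sigma_finite_measure set 'rV[R]_m -> \bar R})
    (lamn : 'rV[R]_n -> R -> R) (lamm : 'rV[R]_m -> R -> R) (alpha beta C : R)
    (T : ('rV[R]_n * 'rV[R]_m -> R[i]) -> 'rV[R]_n * 'rV[R]_m -> R[i]) : Prop :=
  [/\ bounded_on_L2 (mun \x mum)%E T,
      exists T1, vector_CZ mun mum lamn lamm alpha beta C T T1 &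
      exists T2, vector_CZ mum mun lamm lamn beta alpha C (swap_op T) T2].

Section Dyadic.
Context (R : realType) (n : nat).

(* The grid is given by the sequence w_j of the shifts. *)
Definition grid := int -> 'I_n -> bool.

(* [(k, z)] stands for the translate, by the shift of the grid, of the standard
   dyadic cube of generation k with lower corner 2^-k z. *)
Definition cube : Type := (int * 'rV[int]_n)%type.

Definition gen (Q : cube) : int := Q.1.

Definition side (Q : cube) : R := 2 ^ (- gen Q).

(* The sum of 2^-j w_j over the j with 2^-j < 2^-k. *)
Definition shift (w : grid) (k : int) (i : 'I_n) : R :=
  limn (fun N : nat => \sum_(0 <= l < N)
    (2 : R) ^ (- (k + l.+1%:Z)) * (w (k + l.+1%:Z) i)%:R).

Definition cset (w : grid) (Q : cube) : set 'rV[R]_n :=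
  [set x | forall i : 'I_n,
    let a := side Q * (Q.2 0 i)%:~R + shift w (gen Q) i in
    a <= x 0 i < a + side Q].

Definition no_quadrants (w : grid) : Prop :=
  forall Q : nat -> cube,
    (forall i, cset w (Q i) `<` cset w (Q i.+1)) ->
    \bigcup_i cset w (Q i) = setT.

Definition boundary (A : set 'rV[R]_n) : set 'rV[R]_n := closure A `\` A°.

Definition set_dist (A B : set 'rV[R]_n) : R :=
  inf [set `|x - y| | x in A & y in B].

Definition bad (r : nat) (gamma : R) (w w' : grid) (I : cube) : Prop :=
  exists I' : cube, 2 ^+ r * side I <= side I' /\
    set_dist (cset w I) (boundary (cset w' I')) <=
      4 * side I `^ gamma * side I' `^ (1 - gamma).

Definition child (w : grid) (I I' : cube) : Prop :=
  gen I' = gen I + 1 /\ cset w I' `<=` cset w I.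

Variable mu : set 'rV[R]_n -> \bar R.

(* The indexing I_1, ..., I_(2^n) of the children; only the values of [c] at
   1, ..., 2^n matter. *)
Definition hat (w : grid) (c : nat -> cube) (k : nat) : set 'rV[R]_n :=
  \bigcup_(u in [set u | (k <= u <= 2 ^ n)%N]) cset w (c u).

Definition haar_indexing (c : grid -> cube -> nat -> cube) : Prop :=
  forall (w : grid) (I : cube),
    set_bij [set k | (1 <= k <= 2 ^ n)%N] (child w I) (c w I) /\
    forall k, (1 <= k <= 2 ^ n)%N ->
      (1 - (k.-1)%:R / 2 ^+ n) * fine (mu (cset w I)) <=
        fine (mu (hat w (c w I) k)).

Definition haar (w : grid) (c : nat -> cube) (eta : nat) (x : 'rV[R]_n) : R :=
  let m1 := fine (mu (cset w (c eta))) in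
  let m2 := fine (mu (hat w c eta.+1)) in
  let m12 := fine (mu (hat w c eta)) in
  if m1 == 0 then 0 else
  Num.sqrt (m1 * m2 / m12) *
    (\1_(cset w (c eta)) x / m1 - \1_(hat w c eta.+1) x / m2).

End Dyadic.

Section ProductBMO.
Context (R : realType) (n m : nat).
Local Notation X := ('rV[R]_n * 'rV[R]_m)%type.
Variables (mun : {sigma_finite_measure set 'rV[R]_n -> \bar R}).
Variables (mum : {sigma_finite_measure set 'rV[R]_m -> \bar R}).

Definition rect (wn : grid n) (wm : grid m) (S : cube n * cube m) : set X :=
  cset wn S.1 `*` cset wm S.2.

Definition tensor (h : 'rV[R]_n -> R) (u : 'rV[R]_m -> R) : X -> R[i] :=
  fun x => (h x.1 * u x.2)%:C.

Definition inner_rects (r : nat) (gamman gammam : R)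
    (wn wn' : grid n) (wm wm' : grid m) (S : cube n * cube m) :
    set (cube n * cube m) :=
  [set Q | [/\ ~ bad r gamman wn wn' Q.1, ~ bad r gammam wm wm' Q.2,
               rect wn wm Q `<=` rect wn' wm' S,
               gen Q.1 = gen S.1 + r%:Z & gen Q.2 = gen S.2 + r%:Z]].

Definition rect_open (wn : grid n) (wm : grid m) (Omega : set X) : Prop :=
  forall x, Omega x ->
    exists S, rect wn wm S x /\ rect wn wm S `<=` Omega.

(* [B] enters through its pairings with the functions on R^n x R^m. *)
Definition BMOprod_norm (cn : grid n -> cube n -> nat -> cube n)
    (cm : grid m -> cube m -> nat -> cube m)
    (r : nat) (gamman gammam : R) (B : (X -> R[i]) -> R[i]) : \bar R :=
  ereal_inf [set L%:E | L in [set L : R | 0 <= L /\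
    forall (wn wn' : grid n) (wm wm' : grid m),
      no_quadrants R wn -> no_quadrants R wn' ->
      no_quadrants R wm -> no_quadrants R wm' ->
    forall Omega : set X,
      ((mun \x mum) Omega < +oo)%E -> rect_open wn' wm' Omega ->
      ((\sum_(1 <= eta < 2 ^ n) \sum_(1 <= kappa < 2 ^ m)
        \esum_(S in [set S | rect wn' wm' S `<=` Omega])
        \esum_(Q in inner_rects r gamman gammam wn wn' wm wm' S)
          (cmod
             (B (tensor (haar mun wn (cn wn Q.1) eta)
                        (haar mum wm (cm wm Q.2) kappa))) ^+ 2)%:E)
         `^ (2^-1) <= L%:E * ((mun \x mum) Omega) `^ (2^-1))%E]].

Definition box (N : nat) : set X := [set x | `|x.1| <= N%:R /\ `|x.2| <= N%:R].

Definition Tb_pairing (T : (X -> R[i]) -> X -> R[i]) (b phi : X -> R[i]) : R[i] :=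
  let a := fun N : nat =>
    pairing (mun \x mum)%E (T (fun x => b x * (\1_(box N) x)%:C)) phi in
  (limn (fun N => complex.Re (a N))) +i* (limn (fun N => complex.Im (a N))).

End ProductBMO.

(* Main.v *)
(* It suffices to bound the square sum over finitely many rectangles R in S,
   uniformly in N, for b cut off to a box.  Let Om1 be the union of the
   rectangles S = K x V.  Replace V by the maximal cube V* with K' x V* among
   the S for some K' containing K, and K by the largest ancestor K^ for which the
   slice of Om1 over K^ fills half of V*; the same construction with the factors
   exchanged, applied to the rectangles K^ x V*, gives K* containing K^ and V^
   containing V*.  All K* x V^ lie in a set Om3 of measure at most 4 mu(Om1), by
   the weak type (1,1) of one-parameter maximal functions.  The part of b on Om3
   is handled by the L^2 bound and the orthogonality of the Haar functions.  The
   rest of b lives off K^ x V^, hence is the sum of a part with x2 in V^, so x1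
   not in K^, and of a part with x2 not in V^.  For fixed K and V* the first part
   does not depend on the remaining indices; the regularity of T_1 and goodness
   of I gain a power of l(K)/l(K^), while the sum over J in V* is the
   L^oo -> BMO bound of a scalar Calderon-Zygmund operator.  Journe's counting
   argument sums the gain over K and V*.  The second part is symmetric. *)

Require Import Defs.
From mathcomp Require Import all_boot all_order all_algebra.
From mathcomp Require Import complex.
From mathcomp Require Import all_classical all_reals all_analysis.
From mathcomp Require Import measurable_realfun ess_sup_inf.
From mathcomp Require Import ring lra zify.
Import Order.TTheory GRing.Theory Num.Theory.
Import numFieldNormedType.Exports.

Set Implicit Arguments.
Unset Strict Implicit.
Unset Printing Implicit Defensive.

Local Open Scope classical_set_scope.
Local Open Scope ring_scope.

(** The kernels are regular in the first variable only. This suffices because T is always tested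
    against Haar functions, whose cancellation acts on the first variable of T_1, or of T_2 once the
    factors are exchanged. A good cube I stays at distance 4 sqrt(l(I) l(K)) from the complement of
    a much larger K containing it, so a kernel difference decays like a power of sqrt(l(I) / l(K));
    squaring the pairing restores the full power, 2^-(alpha k) with k the number of generations from
    I to K^. Since K lies between I and K^, this k is a sum: the generations from K to K^ give the
    weight in the counting argument, and those from I to K make the sum over I in K a Carleson
    packing. The sum over J must be taken before absolute values are put on the kernel. The kernel
    lemma is therefore stated for l^2-valued kernels, and the scalar BMO bound is used at fixed
    points of the first variable, on the operator T_1(x, y) - T_1(x', y). *)

(** * Real square-integrable functions and Bessel's inequality *)

Section SquareIntegrable.
Context d (T : measurableType d) (R : realType).
Variable mu : {measure set T -> \bar R}.
Implicit Types f g : T -> R.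

Definition rint f : Prop := mu.-integrable setT (EFin \o f).

Lemma rint_measurable {f} : rint f -> measurable_fun setT f.
Proof. by move=> /integrableP[/measurable_EFinP]. Qed.

Lemma rint_le g f : measurable_fun setT f -> rint g ->
  (forall x, `|f x| <= `|g x|) -> rint f.
Proof.
move=> mf ig fg; apply: (le_integrable measurableT _ _ ig).
  exact/measurable_EFinP.
by move=> x _ /=; rewrite lee_fin.
Qed.

Lemma rintD f g : rint f -> rint g -> rint (fun x => f x + g x).
Proof. by move=> fi gi; exact: (integrableD measurableT fi gi). Qed.

Lemma rintB f g : rint f -> rint g -> rint (fun x => f x - g x).
Proof. by move=> fi gi; exact: (integrableB measurableT fi gi). Qed.

Lemma rintZ c f : rint f -> rint (fun x => c * f x).
Proof. by move=> fi; exact: (integrableZl measurableT c fi). Qed.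

Lemma rint0 : rint (fun=> 0).
Proof. exact: integrable0. Qed.

Lemma rint_abs f : rint f -> rint (fun x => `|f x|).
Proof. by move=> fi; exact: (integrable_norm fi). Qed.

Lemma rint_sum (I : Type) (s : seq I) (F : I -> T -> R) :
  (forall i, rint (F i)) -> rint (fun x => \sum_(i <- s) F i x).
Proof.
move=> Fi; elim: s => [|i s IH].
  by under eq_fun do rewrite big_nil; exact: rint0.
by under eq_fun do rewrite big_cons; exact: rintD.
Qed.

Lemma rintegralD f g : rint f -> rint g ->
  \int[mu]_x (f x + g x) = \int[mu]_x f x + \int[mu]_x g x.
Proof. by move=> *; exact: RintegralD. Qed.

Lemma rintegralB f g : rint f -> rint g ->
  \int[mu]_x (f x - g x) = \int[mu]_x f x - \int[mu]_x g x.
Proof. by move=> *; exact: RintegralB. Qed.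

Lemma rintegralZ c f : rint f -> \int[mu]_x (c * f x) = c * \int[mu]_x f x.
Proof. by move=> *; exact: RintegralZl. Qed.

Lemma rintegral_sum (I : Type) (s : seq I) (F : I -> T -> R) :
  (forall i, rint (F i)) ->
  \int[mu]_x (\sum_(i <- s) F i x) = \sum_(i <- s) \int[mu]_x F i x.
Proof.
move=> Fi; elim: s => [|i s IH].
  under eq_Rintegral do rewrite big_nil.
  by rewrite big_nil Rintegral_cst// mul0r.
under eq_Rintegral do rewrite big_cons.
by rewrite big_cons rintegralD// ?IH//; exact: rint_sum.
Qed.

Lemma rintegral_le f g : rint f -> rint g -> (forall x, f x <= g x) ->
  \int[mu]_x f x <= \int[mu]_x g x.
Proof. by move=> *; exact: le_Rintegral. Qed.

Lemma rintegral_ext g f : f =1 g -> \int[mu]_x f x = \int[mu]_x g x.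
Proof. by move=> fg; apply: eq_Rintegral => x _; exact: fg. Qed.

Lemma EFin_rintegral f : rint f ->
  (\int[mu]_x (f x)%:E = (\int[mu]_x f x)%:E)%E.
Proof. by move=> fi; rewrite /Rintegral fineK//; exact: integrable_fin_num. Qed.

Lemma rint_ge0_lty f : measurable_fun setT f -> (forall x, 0 <= f x) ->
  (\int[mu]_x (f x)%:E < +oo)%E -> rint f.
Proof.
move=> mf f0 fy; apply/integrableP; split; first exact/measurable_EFinP.
by under eq_integral do rewrite /= ger0_norm//.
Qed.

Definition sqi f : Prop := measurable_fun setT f /\ rint (fun x => f x ^+ 2).

Lemma abs_mul_le (a b : R) : `|a * b| <= (a ^+ 2 + b ^+ 2) / 2.
Proof.
have := sqr_ge0 (a + b); have := sqr_ge0 (a - b).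
by rewrite ler_norml !expr2 => ? ?; apply/andP; split; nra.
Qed.

Lemma sqi_mul f g : sqi f -> sqi g -> rint (fun x => f x * g x).
Proof.
move=> [mf fi] [mg gi]; apply: (@rint_le (fun x => 2^-1 * (f x ^+ 2 + g x ^+ 2))).
- exact: measurable_funM.
- exact/rintZ/rintD.
- move=> x; apply: (le_trans (abs_mul_le _ _)).
  by rewrite mulrC ler_norm.
Qed.

Lemma sqiD f g : sqi f -> sqi g -> sqi (fun x => f x + g x).
Proof.
move=> hf hg; have fg := sqi_mul hf hg; case: hf hg => [mf fi] [mg gi].
split; first exact: measurable_funD.
under eq_fun do rewrite sqrrD.
apply: rintD => //; apply: rintD => //.
by under eq_fun do rewrite -mulr_natl; exact: rintZ.
Qed.

Lemma sqiZ c f : sqi f -> sqi (fun x => c * f x).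
Proof.
move=> [mf fi]; split; first by apply: measurable_funM.
by under eq_fun do rewrite exprMn; exact: rintZ.
Qed.

Lemma sqiB f g : sqi f -> sqi g -> sqi (fun x => f x - g x).
Proof.
move=> hf /(sqiZ (-1)) hg; have := sqiD hf hg.
by under eq_fun do rewrite mulN1r.
Qed.

Lemma sqi0 : sqi (fun=> 0).
Proof.
split; first exact: measurable_cst.
by under eq_fun do rewrite expr0n /=; exact: rint0.
Qed.

Lemma sqi_sum (I : Type) (s : seq I) (F : I -> T -> R) :
  (forall i, sqi (F i)) -> sqi (fun x => \sum_(i <- s) F i x).
Proof.
move=> Fi; elim: s => [|i s IH].
  by under eq_fun do rewrite big_nil; exact: sqi0.
by under eq_fun do rewrite big_cons; exact: sqiD.
Qed.

(** Expand the integral of (F - G)^2, where G is the sum of a_i phi_i. The norms are only assumed to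
    be at most 1, since degenerate Haar functions vanish; the integral of G^2 is still at most the
    sum of the a_i^2. *)
Lemma bessel (I : eqType) (s : seq I) (phi : I -> T -> R) F :
  uniq s -> sqi F -> (forall i, sqi (phi i)) ->
  (forall i, \int[mu]_x (phi i x) ^+ 2 <= 1) ->
  {in s &, forall i j, i != j -> \int[mu]_x (phi i x * phi j x) = 0} ->
  \sum_(i <- s) (\int[mu]_x (F x * phi i x)) ^+ 2 <= \int[mu]_x (F x ^+ 2).
Proof.
move=> us hF hphi n1 orth.
pose a i := \int[mu]_x (F x * phi i x).
pose G x := \sum_(i <- s) a i * phi i x.
have hG : sqi G by apply: sqi_sum => i; exact: sqiZ.
have FG : \int[mu]_x (F x * G x) = \sum_(i <- s) a i ^+ 2.
  under eq_Rintegral do rewrite /G mulr_sumr.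
  rewrite rintegral_sum; last by move=> i; apply: sqi_mul => //; exact: sqiZ.
  apply: eq_bigr => i _; under eq_Rintegral do rewrite mulrCA.
  by rewrite rintegralZ ?expr2//; exact: sqi_mul.
have Gphi i : i \in s ->
    \int[mu]_x (G x * phi i x) = a i * \int[mu]_x (phi i x) ^+ 2.
  move=> si; under eq_Rintegral do rewrite /G mulr_suml.
  rewrite rintegral_sum; last by move=> j; apply: sqi_mul => //; exact: sqiZ.
  rewrite (bigD1_seq i)//= [X in _ + X]big1_seq ?addr0; last first.
    move=> j /andP[ji js]; under eq_Rintegral do rewrite -mulrA.
    by rewrite rintegralZ ?orth ?mulr0//; exact: sqi_mul.
  under eq_Rintegral do rewrite -mulrA.
  by rewrite rintegralZ//; exact: sqi_mul.
have GG : \int[mu]_x (G x ^+ 2) <= \sum_(i <- s) a i ^+ 2.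
  have -> : \int[mu]_x (G x ^+ 2) = \int[mu]_x (\sum_(i <- s) a i * (G x * phi i x)).
    apply: eq_Rintegral => x _; rewrite expr2 {2}/G mulr_sumr.
    by apply: eq_bigr => i _; rewrite mulrCA.
  rewrite rintegral_sum; last by move=> i; exact/rintZ/sqi_mul.
  rewrite !big_seq; apply: ler_sum => i si.
  rewrite rintegralZ//; last exact: sqi_mul.
  rewrite Gphi// mulrA -expr2 -[leRHS]mulr1; apply: ler_wpM2l; last exact: n1.
  exact: sqr_ge0.
have : 0 <= \int[mu]_x (F x - G x) ^+ 2 by apply: Rintegral_ge0 => x _; exact: sqr_ge0.
have -> : \int[mu]_x (F x - G x) ^+ 2
    = \int[mu]_x (F x ^+ 2 - 2 * (F x * G x) + G x ^+ 2).
  by apply: eq_Rintegral => x _; rewrite sqrrB mulr_natl.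
have iFG : rint (fun x => 2 * (F x * G x)) by exact/rintZ/sqi_mul.
rewrite rintegralD//; [|by apply: rintB => //; case: hF|by case: hG].
rewrite rintegralB//; last by case: hF.
rewrite rintegralZ//; last exact: sqi_mul.
rewrite FG; move: GG; rewrite -/a; set S := \sum_(i <- s) _; lra.
Qed.

End SquareIntegrable.

(** * Geometry of shifted dyadic grids and of good cubes *)

Section Dyadic.
Context {R : realType} {n : nat}.
Implicit Types (w : grid n) (P Q : cube n) (x y : 'rV[R]_n).

Lemma sideE Q : side R Q = 2 ^ (- gen Q). Proof. by []. Qed.

Lemma side_gt0 Q : 0 < side R Q.
Proof. by rewrite exprz_gt0. Qed.

Let term w (k : int) i (l : nat) : R := 2 ^ (- (k + l.+1%:Z)) * (w (k + l.+1%:Z) i)%:R.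

Lemma shift_cvg w k i : cvgn (series (term w k i)).
Proof.
apply: (@series_le_cvg _ _ (geometric (2 ^ (- k)) (2^-1))).
- by move=> l; rewrite mulr_ge0// exprz_ge0.
- by move=> l; rewrite /= mulr_ge0// ?exprz_ge0// exprn_ge0.
- move=> l; rewrite /term /= opprD expfzDr// -mulrA ler_pM2l ?exprz_gt0//.
  apply: (@le_trans _ _ (2 ^ (- l.+1%:Z))).
    by rewrite ler_piMr ?exprz_ge0// lern1 leq_b1.
  rewrite -exprnN exprVn lef_pV2 ?posrE ?exprn_gt0// ler_eXn2l ?ltr1n//.
- by apply: is_cvg_geometric_series; rewrite ger0_norm// invf_lt1// ltr1n.
Qed.

Lemma shiftE w k i : Defs.shift R w k i = limn (series (term w k i)).
Proof. by []. Qed.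

Lemma shiftS w k i : Defs.shift R w k i =
  Defs.shift R w (k + 1) i + 2 ^ (- (k + 1)) * (w (k + 1) i)%:R.
Proof.
rewrite !shiftE; apply/cvg_lim => //; rewrite -cvg_shiftS.
have -> : (fun N => series (term w k i) N.+1) =
   (fun N => series (term w (k + 1) i) N + 2 ^ (- (k + 1)) * (w (k + 1) i)%:R).
  apply/funext => N; rewrite /series/= big_nat_recl// addrC; congr (_ + _).
  by apply: eq_bigr => l _; rewrite /term -addrA -PoszD add1n.
by apply: cvgD; [exact: shift_cvg|exact: cvg_cst].
Qed.

(** The shifts of generations k and k + d differ by terms that are multiples of 2^-(k+d); this
    integrality is what keeps the shifted cubes nested. *)
Lemma shift_nat w k i (d : nat) : exists z : int,
  Defs.shift R w k i = Defs.shift R w (k + d%:Z) i + 2 ^ (- (k + d%:Z)) * z%:~R.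
Proof.
elim: d => [|d [z ->]]; first by exists 0; rewrite addr0 mulr0 addr0.
exists ((nat_of_bool (w (k + d.+1%:Z) i))%:Z + 2 * z).
have -> : k + d.+1%:Z = k + d%:Z + 1 by lia.
rewrite shiftS -[LHS]addrA; congr (_ + _).
have -> : (2 : R) ^ (- (k + d%:Z)) = 2 ^ (- (k + d%:Z + 1)) * 2.
  rewrite -[X in _ * X]expr1z -expfzDr//; congr (_ ^ _); lia.
by rewrite intrD intrM [RHS]mulrDr mulrA.
Qed.

Definition dcoord (w : grid n) (k : int) (i : 'I_n) (x : 'rV[R]_n) : R :=
  (x 0 i - Defs.shift R w k i) / 2 ^ (- k).

Lemma csetE w Q x : cset w Q x <->
  forall i, (Q.2 0 i)%:~R <= dcoord w (gen Q) i x < (Q.2 0 i)%:~R + 1.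
Proof.
rewrite /cset /= /dcoord; have s0 := side_gt0 Q.
have E i : ((Q.2 0 i)%:~R <= (x 0 i - Defs.shift R w (gen Q) i) / 2 ^ (- gen Q) < (Q.2 0 i)%:~R + 1)
   = (side R Q * (Q.2 0 i)%:~R + Defs.shift R w (gen Q) i <= x 0 i <
      side R Q * (Q.2 0 i)%:~R + Defs.shift R w (gen Q) i + side R Q).
  rewrite -sideE ler_pdivlMr// ltr_pdivrMr// lerBrDr ltrBlDr.
  by rewrite mulrDl mul1r (mulrC (side R Q)) [in LHS]addrAC.
by split => h i; [rewrite E | rewrite -E]; exact: h.
Qed.

Definition cube_at w (k : int) (x : 'rV[R]_n) : cube n :=
  (k, \row_i Num.floor (dcoord w k i x)).

Lemma cset_cube_at w k x : cset w (cube_at w k x) x.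
Proof.
apply/csetE => i; rewrite mxE /=.
by rewrite floor_le_tmp /= -[1]/(1%:~R) -intrD floorD1_gt ?num_real.
Qed.

Lemma cube_at_eq w Q x : cset w Q x -> Q = cube_at w (gen Q) x.
Proof.
case: Q => k z /csetE h; congr pair; apply/rowP => i; rewrite mxE.
by apply/esym/floor_def; have := h i; rewrite -[1]/(1%:~R) -intrD.
Qed.

(** Measured in units of the side, the coordinates of the two generations are related by t -> 2^d t
    + z with z an integer, so an interval [q, q+1) with integer q that meets the image of [p, p+1)
    lies inside it. *)
Lemma dyadic_nested w P Q x : gen P <= gen Q -> cset w P x -> cset w Q x ->
  cset w Q `<=` (cset w P : set 'rV[R]_n).
Proof.
move=> PQ /csetE hP /csetE hQ y /csetE hy; apply/csetE => i.
have [d dE] : exists d : nat, gen Q = gen P + d%:Z.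
  by exists `|gen Q - gen P|%N; lia.
have [z zE] := shift_nat w (gen P) i d.
have E u : dcoord w (gen Q) i u = 2 ^+ d * dcoord w (gen P) i u + z%:~R.
  rewrite /dcoord zE dE.
  have -> : (2 : R) ^ (- gen P) = 2 ^+ d * 2 ^ (- (gen P + d%:Z)).
    rewrite [_ ^+ d](_ : _ = 2 ^ d%:Z)// -expfzDr//; congr (_ ^ _); lia.
  have : (2 : R) ^ (- (gen P + d%:Z)) != 0 by rewrite expfz_neq0.
  have : (2 : R) ^+ d != 0 by rewrite expf_neq0.
  by move=> ? ?; field; apply/andP.
move: (hP i) (hQ i) (hy i); rewrite !E => /andP[P1 P2] /andP[Q1 Q2] /andP[Y1 Y2].
have D0 : (0 : R) < 2 ^+ d by rewrite exprn_gt0.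
set p := P.2 0 i in P1 P2 *; set q := Q.2 0 i in Q1 Q2 Y1 Y2.
have D1 : (2 : R) ^+ d = ((2 ^ d)%N%:Z)%:~R by rewrite -natrX.
have lo : (2 ^ d)%N%:Z * p + z <= q.
  rewrite -ltzD1 -(ltr_int R) !intrD intrM -D1; apply: le_lt_trans Q2.
  by rewrite lerD2r ler_wpM2l// ltW.
have hi : q < (2 ^ d)%N%:Z * (p + 1) + z.
  rewrite -(ltr_int R) !intrD intrM -D1 intrD; apply: le_lt_trans Q1 _.
  by rewrite ltrD2r ltr_pM2l.
move: lo; rewrite -(ler_int R) !intrD intrM -D1 => lo.
move: hi; rewrite -lezD1 -(ler_int R) !intrD intrM -D1 intrD => hi.
by apply/andP; split; rewrite -(ler_pM2l D0, ltr_pM2l D0); lra.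
Qed.

Definition corner w Q : 'rV[R]_n :=
  \row_i (side R Q * (Q.2 0 i)%:~R + Defs.shift R w (gen Q) i).

Lemma cset_corner w Q : cset w Q (corner w Q).
Proof. by move=> i /=; rewrite mxE lexx ltrDl side_gt0. Qed.

(** Inclusion of dyadic cubes as a boolean, tested at one corner, so that lists of cubes can be
    filtered by it. *)
Definition dsub w P Q := (gen Q <= gen P) && (Q == cube_at w (gen Q) (corner w P)).

Lemma dsub_subset w P Q : dsub w P Q -> cset w P `<=` (cset w Q : set 'rV[R]_n).
Proof.
move=> /andP[le /eqP E]; apply: (@dyadic_nested w Q P (corner w P)) => //.
  by rewrite E; exact: cset_cube_at.
exact: cset_corner.
Qed.

Lemma dsub_gen w P Q : dsub w P Q -> gen Q <= gen P.
Proof. by case/andP. Qed.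

Lemma dsubP w P Q x : gen Q <= gen P -> cset w P x -> cset w Q x -> dsub w P Q.
Proof.
move=> le hP hQ; rewrite /dsub le /=; apply/eqP/cube_at_eq.
exact: (dyadic_nested le hQ hP (cset_corner w P)).
Qed.

Lemma dsub_refl w P : dsub w P P.
Proof. by apply: (@dsubP w P P (corner w P)) => //; exact: cset_corner. Qed.

Lemma dsub_trans w P Q S : dsub w P Q -> dsub w Q S -> dsub w P S.
Proof.
move=> PQ QS; apply: (@dsubP w P S (corner w P)).
- exact: le_trans (dsub_gen QS) (dsub_gen PQ).
- exact: cset_corner.
- exact/(dsub_subset QS)/(dsub_subset PQ)/cset_corner.
Qed.

Lemma cset_eq w P Q x : gen P = gen Q -> cset w P x -> cset w Q x -> P = Q.
Proof. by move=> g /cube_at_eq -> /cube_at_eq ->; rewrite g. Qed.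

Definition anc w (i : nat) Q : cube n := cube_at w (gen Q - i%:Z) (corner w Q).

Lemma gen_anc w i Q : gen (anc w i Q) = gen Q - i%:Z.
Proof. by []. Qed.

Lemma dsub_anc w i Q : dsub w Q (anc w i Q).
Proof. by rewrite /dsub gen_anc eqxx gerBl. Qed.

Lemma anc_dsub w Q P i : dsub w Q P -> gen Q - i%:Z <= gen P ->
  dsub w P (anc w i Q).
Proof.
move=> QP le; apply: (@dsubP w _ _ (corner w Q)) => //.
  exact/(dsub_subset QP)/cset_corner.
exact/(dsub_subset (dsub_anc w i Q))/cset_corner.
Qed.

Lemma anc0 w Q : anc w 0 Q = Q.
Proof. by rewrite /anc subr0; apply/esym/cube_at_eq/cset_corner. Qed.

Lemma normrV_le x (e : R) : 0 <= e -> (`|x| <= e) = [forall i, `|x 0 i| <= e].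
Proof.
move=> e0; apply/idP/forallP => [h i|h].
  by rewrite (le_trans _ h)// [leRHS]mx_normrE; apply: (le_bigmax _ _ (0, i)).
rewrite [leLHS]mx_normrE; apply/bigmax_leP; split => // -[a b] _ /=.
by rewrite (ord1 a).
Qed.

Lemma coord_le_norm x i : `|x 0 i| <= `|x|.
Proof. by have := lexx `|x|; rewrite normrV_le// => /forallP. Qed.

Lemma cset_dist w Q x y : cset w Q x -> cset w Q y -> `|x - y| <= side R Q.
Proof.
move=> hx hy; rewrite normrV_le ?ltW ?side_gt0//; apply/forallP => i.
rewrite !mxE ler_norml; have /andP[? ?] := hx i; have /andP[? ?] := hy i.
by apply/andP; split; lra.
Qed.

Lemma boundary_crossing w Q x y : cset w Q x -> ~ cset w Q y ->
  exists2 z, boundary (cset w Q) z & `|x - z| <= `|x - y|.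
Proof.
move=> hx hy.
have [i hi] : exists i, ~~ (side R Q * (Q.2 0 i)%:~R + Defs.shift R w (gen Q) i
    <= y 0 i < side R Q * (Q.2 0 i)%:~R + Defs.shift R w (gen Q) i + side R Q).
  apply: contrapT => h; apply: hy => i /=.
  by apply: contrapT => h'; apply: h; exists i; apply/negP.
set a := _ + _ in hi; have s0 := side_gt0 Q.
have /andP[ax xa] : a <= x 0 i < a + side R Q := hx i.
pose up (t : R) : 'rV[R]_n := \row_j (if j == i then t else x 0 j).
have up_in t : a <= t < a + side R Q -> cset w Q (up t).
  by move=> ht j /=; rewrite mxE; case: eqVneq => [->//|_]; exact: hx.
have up_out t : ~~ (a <= t < a + side R Q) -> ~ cset w Q (up t).
  by move=> /negP ht /(_ i) /=; rewrite mxE eqxx.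
have up_ball t t' e : `|t - t'| < e -> 0 < e -> ball (up t) e (up t').
  move=> tt e0; rewrite -ball_normE /ball_ /=.
  apply: (@le_lt_trans _ _ `|t - t'|) => //; rewrite normrV_le//; apply/forallP => j.
  by rewrite !mxE; case: eqVneq => // _; rewrite subrr normr0.
have up_dist t : (t <= x 0 i -> y 0 i <= t) -> (x 0 i < t -> t <= y 0 i) ->
    `|x - up t| <= `|x - y|.
  move=> h1 h2; apply: le_trans (coord_le_norm (x - y) i).
  rewrite normrV_le//; apply/forallP => j; rewrite !mxE.
  case: eqVneq => [->|_]; last by rewrite subrr normr0.
  case: (leP t (x 0 i)) => ht.
    by have := h1 ht => yt; rewrite !ger0_norm; lra.
  by have := h2 ht => ty; rewrite !ler0_norm; lra.
have bd t : a <= t <= a + side R Q ->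
   (forall e, 0 < e -> exists2 t', `|t - t'| < e & a <= t' < a + side R Q) ->
   (forall e, 0 < e -> exists2 t', `|t - t'| < e & ~~ (a <= t' < a + side R Q)) ->
   boundary (cset w Q) (up t).
  move=> _ hin hout; split.
    move=> B /nbhs_ballP[e /= e0 eB]; have [t' tt' ht'] := hin e e0.
    by exists (up t'); split; [exact: up_in|apply/eB/up_ball].
  move=> /nbhs_ballP[e /= e0 eB]; have [t' tt' ht'] := hout e e0.
  by apply: (up_out t' ht'); apply/eB/up_ball.
case: (ltP (y 0 i) a) => ya.
  exists (up a); last by apply: up_dist => ?; lra.
  apply: bd => [|e e0|e e0]; first by rewrite lexx lerDl ltW.
  - by exists a; rewrite ?subrr ?normr0// lexx ltrDl.
  - exists (a - e / 2); first by rewrite opprB addrC subrK ger0_norm; lra.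
    by rewrite negb_and -ltNge; apply/orP; left; lra.
move: hi; rewrite ya /= -leNgt => ya'.
exists (up (a + side R Q)); last by apply: up_dist => ?; lra.
apply: bd => [|e e0|e e0]; first by rewrite lexx lerDl ltW.
(* The upper face does not belong to the half-open cube, so points just below it are used; the
   minimum with the side keeps them above the lower face. *)
- exists (a + side R Q - Num.min (e / 2) (side R Q)).
    rewrite opprB addrC subrK ger0_norm; last by rewrite le_min; apply/andP; split; lra.
    by rewrite gt_min; apply/orP; left; lra.
  have : Num.min (e / 2) (side R Q) <= side R Q by rewrite ge_min lexx orbT.
  have : 0 < Num.min (e / 2) (side R Q) by rewrite lt_min s0 andbT; lra.
  by move=> ? ?; apply/andP; split; lra.
- by exists (a + side R Q); rewrite ?subrr ?normr0// ltxx andbF.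
Qed.

Lemma set_dist_le (A B : set 'rV[R]_n) x y : A x -> B y -> set_dist A B <= `|x - y|.
Proof.
move=> Ax By; apply: ge_inf; first by exists 0 => _ [? _ [? _ <-]].
by exists x => //; exists y.
Qed.

(* What goodness of [I] provides, the exponent of [bad] being at most 1/2. *)
Definition sep w w' I K := [/\ (gen K <= gen I), cset w I `<=` (cset w' K : set 'rV[R]_n) &
  forall x y, cset w I x -> ~ cset w' K y ->
    4 * Num.sqrt (side R I * side R K) <= `|x - y|].

(** A point outside K closer to I than 4 sqrt(l(I) l(K)) would bring the boundary of K equally
    close. As gamma is at most 1/2 and l(I) is at most l(K), sqrt(l(I) l(K)) is at most l(I)^gamma
    l(K)^(1 - gamma), and I would be bad. *)
Lemma good_sep (r : nat) (g : R) w w' I K : 0 <= g <= 2^-1 -> ~ bad r g w w' I ->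
  gen K + r%:Z <= gen I -> cset w I `<=` (cset w' K : set 'rV[R]_n) -> sep w w' I K.
Proof.
move=> /andP[g0 g1] gd le IK; split => // [|x y hx hy]; first by move: le; lia.
have [z bz xz] := boundary_crossing (IK _ hx) hy.
apply: le_trans xz; apply: le_trans (set_dist_le hx bz); apply/ltW.
rewrite ltNge; apply/negP => h; apply: gd; exists K; split.
  rewrite !sideE -[2 ^+ r]/(2 ^ r%:Z) -expfzDr// ler_eXz2l ?ltr1n//; move: le; lia.
apply: (le_trans h); rewrite -mulrA ler_pM2l//.
have sI := side_gt0 I; have sK := side_gt0 K.
have IK' : side R I <= side R K.
  by rewrite !sideE ler_eXz2l ?ltr1n//; move: le; lia.
have [sI' sK'] := (ltW sI, ltW sK).
rewrite -powR12_sqrt ?mulr_ge0// powRM//.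
have pD (s u v : R) : 0 < s -> s `^ (u + v) = s `^ u * s `^ v.
  by move=> s0; rewrite powRD// (gt_eqF s0) implybT.
rewrite [X in side R I `^ X](_ : _ = g + (2^-1 - g)); last by lra.
rewrite [X in _ <= _ * side R K `^ X](_ : _ = (2^-1 - g) + 2^-1); last by lra.
have : 0 <= 2^-1 - g by rewrite subr_ge0.
move: (2^-1 - g) => e e0; rewrite !pD//.
rewrite -mulrA ler_pM2l ?powR_gt0// ler_pM2r ?powR_gt0//.
by apply: ge0_ler_powR; rewrite ?nnegrE.
Qed.

End Dyadic.
Arguments sep R {n} w w' I K.
Arguments dsub R {n} w P Q.
Arguments anc R {n} w i Q.

(** * Borel measurability of cubes and balls *)

Section Borel.
Context {R : realType} {n : nat}.
Implicit Types (A : set 'rV[R]_n).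

Lemma open_meas A : open A -> measurable A.
Proof. by move=> oA; exact: sub_sigma_algebra. Qed.

Lemma closed_meas A : closed A -> measurable A.
Proof. by move=> /closed_openC/open_meas/measurableC; rewrite setCK. Qed.

Lemma meas_coord_lt i (a : R) : measurable [set x : 'rV[R]_n | x 0 i < a].
Proof.
apply: open_meas; apply: (@open_comp _ _ (fun x : 'rV[R]_n => x 0 i) [set t | t < a]).
  by move=> x _; exact: coord_continuous.
exact: open_lt.
Qed.

Lemma cset_meas (w : grid n) Q : measurable (cset w Q : set 'rV[R]_n).
Proof.
pose a i := side R Q * (Q.2 0 i)%:~R + Defs.shift R w (gen Q) i.
have -> : cset w Q = \bigcap_(i in setT)
    ([set x : 'rV[R]_n | x 0 i < a i + side R Q] `\` [set x | x 0 i < a i]).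
  rewrite eqEsubset; split => x /= h.
    by move=> i _; have /andP[h1 h2] := h i; split => //=; apply/negP; rewrite -leNgt.
  by move=> i; have [/= h1 /negP] := h i I; rewrite -leNgt /= -/(a i) => ->.
apply: fin_bigcap_measurable; first exact: finite_finset.
by move=> i _; apply: measurableD; exact: meas_coord_lt.
Qed.

Lemma dist_continuous (x : 'rV[R]_n) : continuous (fun y => `|x - y|).
Proof.
move=> y; apply: (@cvg_norm _ _ _ (nbhs y) _ (fun z => x - z) (x - y)).
by apply: (@cvgB _ _ _ (nbhs y) _ (fun=> x) id); [exact: cvg_cst|exact: cvg_id].
Qed.

Lemma closed_ball_closed (x : 'rV[R]_n) (e : R) : closed [set y | `|x - y| <= e].
Proof.
apply: (@closed_comp _ _ (fun y : 'rV[R]_n => `|x - y|) [set t | t <= e]).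
  by move=> y _; exact: dist_continuous.
exact: closed_le.
Qed.

Lemma ball_norm (x : 'rV[R]_n) (e : R) : ball x e = [set y | `|x - y| < e].
Proof. by rewrite -ball_normE. Qed.

Lemma ball_meas (x : 'rV[R]_n) (e : R) : measurable [set y | `|x - y| < e].
Proof.
apply: open_meas.
apply: (@open_comp _ _ (fun y : 'rV[R]_n => `|x - y|) [set t | t < e]).
  by move=> y _; exact: dist_continuous.
exact: open_lt.
Qed.

End Borel.

(** * Finiteness of upper doubling measures on bounded sets *)

Section UpperDoublingFacts.
Context {R : realType} {n : nat}.
Variables (mu : {sigma_finite_measure set 'rV[R]_n -> \bar R}).
Variables (lam : 'rV[R]_n -> R -> R) (C C' : R).
Hypothesis ud : upper_doubling mu lam C C'.

Lemma lam_gt0 x r : 0 < r -> 0 < lam x r.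
Proof. by case: ud => -[+ _ _ _] _; apply. Qed.

Lemma doubling_ge1 : 1 <= C /\ 1 <= C'.
Proof.
have [[l0 lmono ldbl lcmp] _] := ud.
have p1 := l0 0 1 ltr01; split.
  rewrite -(ler_pM2r p1) mul1r; apply: le_trans (ldbl 0 1 ltr01).
  by apply: lmono => //; rewrite mulr1 ler1n.
rewrite -(ler_pM2r p1) mul1r; apply: lcmp => //.
by rewrite subrr normr0.
Qed.

Lemma gam_bounds (alpha : R) : 0 < alpha -> 0 <= gam alpha C <= 2^-1.
Proof.
move=> a0; have [C1 _] := doubling_ge1.
have l0 : 0 <= log2 C by rewrite /log2 divr_ge0// ?ln_ge0// ler1n.
have D : 0 < 2 * log2 C + 2 * alpha by lra.
rewrite /gam; apply/andP; split; first by apply: divr_ge0; lra.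
by rewrite ler_pdivrMr//; lra.
Qed.

Lemma bounded_lty (A : set 'rV[R]_n) x (e : R) : measurable A ->
  (forall y, A y -> `|x - y| < e) -> (mu A < +oo)%E.
Proof.
move=> mA Ae; have [_ mb] := ud.
pose e' := Num.max e 1; have e0 : 0 < e' by rewrite lt_max ltr01 orbT.
apply: (@le_lt_trans _ _ (lam x e')%:E); last exact: ltry.
apply: le_trans (mb x e' e0); apply: le_measure; rewrite ?inE//.
  by rewrite ball_norm; exact: ball_meas.
move=> y /Ae h; rewrite ball_norm /=; apply: lt_le_trans h _.
by rewrite le_max lexx.
Qed.

Lemma cset_lty w Q : (mu (cset w Q) < +oo)%E.
Proof.
apply: (@bounded_lty _ (corner w Q) (side R Q + 1)); first exact: cset_meas.
move=> y hy; apply: (@le_lt_trans _ _ (side R Q)); last by rewrite ltrDl.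
exact: (cset_dist (cset_corner w Q)).
Qed.

End UpperDoublingFacts.

(** * Indicators and the Cauchy-Schwarz inequality on sets of finite measure *)

Section Indicators.
Context d (T : measurableType d) (R : realType) (mu : {measure set T -> \bar R}).

Lemma indic01 (A : set T) x : 0 <= (\1_A x : R) <= 1.
Proof. by rewrite indicE; case: (_ \in _); rewrite ?lexx ?ler01. Qed.

Lemma indicP (A : set T) x : (A x /\ \1_A x = 1 :> R) \/ (~ A x /\ \1_A x = 0 :> R).
Proof.
by case: (pselect (A x)) => h; [left|right]; split => //;
  rewrite indicE ?(mem_set h)//; rewrite memNset.
Qed.

Lemma rint_indic (A : set T) : measurable A -> (mu A < +oo)%E -> rint mu (\1_A).
Proof.
move=> mA Ay; apply: rint_ge0_lty; first exact: measurable_indic.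
  by move=> x; case/andP: (indic01 A x).
by rewrite integral_indic// setIT.
Qed.

Lemma rintegral_indic (A : set T) : measurable A -> \int[mu]_x (\1_A x : R) = fine (mu A).
Proof. by move=> mA; rewrite /Rintegral integral_indic// setIT. Qed.

Lemma indic_sqr (A : set T) : (fun x => (\1_A x : R) ^+ 2) = \1_A.
Proof.
by apply/funext => x; case: (indicP A x) => -[_ ->]; rewrite ?expr1n ?expr0n.
Qed.

Lemma sqi_indic (A : set T) : measurable A -> (mu A < +oo)%E -> sqi mu (\1_A).
Proof.
move=> mA Ay; split; first exact: measurable_indic.
by rewrite indic_sqr; exact: rint_indic.
Qed.

Lemma sqi_supp (A : set T) (h : T -> R) : measurable A -> (mu A < +oo)%E ->
  sqi mu h -> (forall x, ~ A x -> h x = 0) -> rint mu h.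
Proof.
move=> mA Ay hh h0; have := sqi_mul hh (sqi_indic mA Ay).
congr (rint _ _); apply/funext => x.
by case: (indicP A x) => -[Ax ->]; rewrite ?mulr1// h0 ?mul0r.
Qed.

(** Cauchy-Schwarz against the indicator of A, from the nonnegativity of the integral of (|h| - t
    1_A)^2 for every t. The optimal t is H / m; if m = 0, the choice t = 1 / H shows that H = 0. *)
Lemma l1_le (A : set T) (h : T -> R) : measurable A -> (mu A < +oo)%E ->
  sqi mu h -> (forall x, ~ A x -> h x = 0) -> \int[mu]_x (h x) ^+ 2 <= 1 ->
  (\int[mu]_x `|h x|) ^+ 2 <= fine (mu A).
Proof.
move=> mA Ay hh h0 h1; have ih := rint_abs (sqi_supp mA Ay hh h0).
set H := \int[mu]_x _; set m := fine _.
have key t : 0 <= 1 - 2 * t * H + t ^+ 2 * m.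
  have : 0 <= \int[mu]_x (`|h x| - t * \1_A x) ^+ 2.
    by apply: Rintegral_ge0 => x _; exact: sqr_ge0.
  have -> : \int[mu]_x (`|h x| - t * \1_A x) ^+ 2
     = \int[mu]_x ((h x) ^+ 2 - 2 * t * `|h x| + t ^+ 2 * \1_A x).
    apply: eq_Rintegral => x _; rewrite sqrrB real_normK ?num_real//.
    case: (indicP A x) => -[Ax ->]; first by rewrite !mulr1; ring.
    by rewrite h0// normr0; ring.
  have ii := rint_indic mA Ay; case: hh => _ h2.
  rewrite rintegralD; [|by apply: rintB => //; exact: rintZ|exact: rintZ].
  rewrite rintegralB//; last exact: rintZ.
  rewrite !rintegralZ// rintegral_indic// -/H -/m; lra.
have m0 : 0 <= m by apply: fine_ge0.
have H0 : 0 <= H by apply: Rintegral_ge0.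
have [mE|mN] := eqVneq m 0.
  have [->|HN] := eqVneq H 0; first by rewrite mE expr0n.
  by have := key H^-1; rewrite mE mulr0 addr0 -mulrA mulVf//; lra.
have mp : 0 < m by rewrite lt_neqAle eq_sym mN.
have := key (H / m).
have -> : 1 - 2 * (H / m) * H + (H / m) ^+ 2 * m = 1 - H ^+ 2 / m by field.
by rewrite subr_ge0 ler_pdivrMr// mul1r.
Qed.

End Indicators.

(** * The Haar functions as an orthogonal system *)

Section HaarSystem.
Context {R : realType} {n : nat}.
Variables (mu : {sigma_finite_measure set 'rV[R]_n -> \bar R}).
Implicit Types (w : grid n) (h : cube n -> 'rV[R]_n -> R).

(** All that the estimates use of the Haar functions. [hs_norm] is an inequality because a Haar
    function vanishes when one of its two pieces is null. *)
Record haar_system w h : Prop := HaarSystem {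
  hs_sqi : forall I, sqi mu (h I);
  hs_supp : forall I x, ~ cset w I x -> h I x = 0;
  hs_int0 : forall I, \int[mu]_x h I x = 0;
  hs_norm : forall I, \int[mu]_x (h I x) ^+ 2 <= 1;
  hs_orth : forall I I', I != I' -> \int[mu]_x (h I x * h I' x) = 0 }.

Variables (lam : 'rV[R]_n -> R -> R) (C C' : R).
Hypothesis ud : upper_doubling mu lam C C'.

Lemma hs_l1 w h I : haar_system w h ->
  (\int[mu]_x `|h I x|) ^+ 2 <= fine (mu (cset w I)).
Proof.
move=> hs; apply: l1_le; [exact: cset_meas|exact: cset_lty ud _ _|
  exact: hs_sqi hs I|exact: hs_supp hs I|exact: hs_norm hs I].
Qed.

Section Haar.
Variables (c : grid n -> cube n -> nat -> cube n) (w : grid n) (eta : nat).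
Hypothesis hc : haar_indexing mu c.
Hypothesis eta_range : (1 <= eta < 2 ^ n)%N.

Let A I : set 'rV[R]_n := cset w (c w I eta).
Let B I : set 'rV[R]_n := hat w (c w I) eta.+1.

Let c_child I k : (1 <= k <= 2 ^ n)%N -> child R w I (c w I k).
Proof. by move=> hk; have [[+ _ _] _] := hc w I; apply. Qed.

Let c_eta I : child R w I (c w I eta).
Proof. by apply: c_child; move: eta_range => /andP[-> /ltnW ->]. Qed.

Let hat_child I k (x : 'rV[R]_n) : (1 <= k)%N -> hat w (c w I) k x ->
  exists2 u, (k <= u <= 2 ^ n)%N & cset w (c w I u) x.
Proof. by move=> k1 [u /= hu hx]; exists u. Qed.

Let AI I (x : 'rV[R]_n) : A I x -> cset w I x. Proof. by case: (c_eta I) => _; apply. Qed.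

Let BI I (x : 'rV[R]_n) : B I x -> cset w I x.
Proof.
move=> /(hat_child (ltn0Sn _))[u /andP[u1 u2]].
have [|_] := @c_child I u; last by apply.
by rewrite u2 andbT (leq_trans _ u1).
Qed.

Let AB I (x : 'rV[R]_n) : A I x -> ~ B I x.
Proof.
move=> Ax /(hat_child (ltn0Sn _))[u /andP[u1 u2] xu].
have u0 : (1 <= u <= 2 ^ n)%N by rewrite u2 andbT (leq_trans _ u1).
have E : c w I eta = c w I u.
  have [g1 _] := c_eta I; have [g2 _] := @c_child I u u0.
  by apply: cset_eq Ax xu; rewrite g1 g2.
have [[_ inj _] _] := hc w I.
have eta0 : (1 <= eta <= 2 ^ n)%N by move: eta_range => /andP[-> /ltnW ->].
have := inj eta u; rewrite !inE => /(_ eta0 u0 E) etau.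
by move: u1; rewrite etau ltnn.
Qed.

Let mA I : measurable (A I). Proof. exact: cset_meas. Qed.

Let hat_meas I k : measurable (hat w (c w I) k : set 'rV[R]_n).
Proof.
by apply: bigcup_measurable => u _; exact: cset_meas.
Qed.

Let mB I : measurable (B I). Proof. exact: hat_meas. Qed.

Let Ay I : (mu (A I) < +oo)%E. Proof. exact: cset_lty ud _ _. Qed.

Let By I : (mu (B I) < +oo)%E.
Proof.
apply: le_lt_trans (cset_lty ud w I); apply: le_measure; rewrite ?inE//.
  exact: cset_meas.
by move=> x; exact: BI.
Qed.

Let hatE I : hat w (c w I) eta = A I `|` B I.
Proof.
rewrite eqEsubset; split => x.
  move=> [u /= /andP[u1 u2] xu]; move: u1; rewrite leq_eqVlt => /predU1P[E|u1].
    by left; rewrite /A E.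
  by right; exists u => //=; rewrite u1.
move: eta_range => /andP[e1 e2].
move=> [Ax|[u /= /andP[u1 u2] xu]]; first by exists eta => //=; rewrite leqnn ltnW.
by exists u => //=; rewrite u2 ltnW.
Qed.

(** One formula covers all cases: A is the child I_eta, B the union of the later children, and a = b
    = 0 when either is null. *)
Let haar_form I : exists a b : R,
  [/\ haar mu w (c w I) eta = (fun x => a * \1_(A I) x - b * \1_(B I) x),
      a * fine (mu (A I)) = b * fine (mu (B I)) &
      a ^+ 2 * fine (mu (A I)) + b ^+ 2 * fine (mu (B I)) <= 1].
Proof.
rewrite /haar -/(A I) -/(B I) hatE measureU//; last first.
  by rewrite -subset0 => x [/AB].
rewrite fineD; [|by rewrite ge0_fin_numE ?Ay|by rewrite ge0_fin_numE ?By].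
set m1 := fine (mu (A I)); set m2 := fine (mu (B I)).
have m1_ge0 : 0 <= m1 by exact: fine_ge0.
have m2_ge0 : 0 <= m2 by exact: fine_ge0.
have zero : exists a b : R, [/\ (fun=> 0) = (fun x => a * \1_(A I) x - b * \1_(B I) x),
    a * m1 = b * m2 & a ^+ 2 * m1 + b ^+ 2 * m2 <= 1].
  exists 0, 0; rewrite !mul0r expr0n /= !mul0r addr0 ler01; split => //.
  by apply/funext => x; rewrite !mul0r subrr.
have [m1E|m1N] := eqVneq m1 0; first exact: zero.
(* If B is null, the coefficient sqrt(m1 m2 / m12) is 0, so the quotient by m2 = 0 is harmless. *)
have [m2E|m2N] := eqVneq m2 0.
  rewrite [X in exists _ _, [/\ X = _, _ & _]](_ : _ = fun=> 0); first exact: zero.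
  by apply/funext => x; rewrite m2E mulr0 mul0r sqrtr0 mul0r.
set s := Num.sqrt _.
have m1p : 0 < m1 by rewrite lt_neqAle eq_sym m1N.
have m2p : 0 < m2 by rewrite lt_neqAle eq_sym m2N.
have s2 : s ^+ 2 = m1 * m2 / (m1 + m2).
  by rewrite sqr_sqrtr// divr_ge0 ?mulr_ge0 ?addr_ge0.
exists (s / m1), (s / m2); split.
- by apply/funext => x; rewrite mulrBr !mulrA; congr (_ - _); rewrite mulrAC.
- by rewrite !divfK.
- rewrite !exprMn s2 le_eqVlt; apply/orP; left; apply/eqP.
  have m12N : m1 + m2 != 0 by rewrite gt_eqF// addr_gt0.
  by field; rewrite ?m1N ?m2N ?m12N.
Qed.

Let haar_int I (a b : R) :
  \int[mu]_x (a * \1_(A I) x - b * \1_(B I) x) = a * fine (mu (A I)) - b * fine (mu (B I)).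
Proof.
have iA := rint_indic (mA I) (Ay I); have iB := rint_indic (mB I) (By I).
rewrite rintegralB; [|exact: rintZ|exact: rintZ].
by rewrite !rintegralZ// !rintegral_indic.
Qed.

Let haar_sqi I : sqi mu (haar mu w (c w I) eta).
Proof.
have [a [b [-> _ _]]] := haar_form I.
by apply: sqiB; apply: sqiZ;
  [exact: (sqi_indic (mA I) (Ay I))|exact: (sqi_indic (mB I) (By I))].
Qed.

Let haar_supp I (x : 'rV[R]_n) : ~ cset w I x -> haar mu w (c w I) eta x = 0.
Proof.
have [a [b [-> _ _]]] := haar_form I => nI.
case: (indicP R (A I) x) => -[Ax ->]; first by case: nI; exact: AI.
case: (indicP R (B I) x) => -[Bx ->]; first by case: nI; exact: BI.
by rewrite !mulr0 subr0.
Qed.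

Let haar_int0 I : \int[mu]_x haar mu w (c w I) eta x = 0.
Proof. by have [a [b [-> E _]]] := haar_form I; rewrite haar_int E subrr. Qed.

(* The generation of a child exceeds that of its parent by one, so each
   indicator in [h_I] is constant on every cube of later generation. *)
Let haar_const I J : gen I < gen J ->
  exists a, forall x : 'rV[R]_n, cset w J x -> haar mu w (c w I) eta x = a.
Proof.
move=> gIJ; have [a [b [-> _ _]]] := haar_form I.
exists (a * \1_(A I) (corner w J) - b * \1_(B I) (corner w J)) => x Jx.
have cc u : (1 <= u <= 2 ^ n)%N -> forall y z : 'rV[R]_n, cset w J y -> cset w J z ->
    cset w (c w I u) y -> cset w (c w I u) z.
  move=> hu y z Jy Jz uy; apply: (dyadic_nested _ uy Jy) Jz.
  have [-> _] := @c_child I u hu; by rewrite lezD1.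
have Jc : cset w J (corner w J) := cset_corner w J.
have eqA : forall y z : 'rV[R]_n, cset w J y -> cset w J z -> A I y -> A I z.
  by move=> y z; apply: cc; move: eta_range => /andP[-> /ltnW ->].
have eqB : forall y z : 'rV[R]_n, cset w J y -> cset w J z -> B I y -> B I z.
  move=> y z Jy Jz /(hat_child (ltn0Sn _))[u hu yu]; exists u => //.
  apply: cc Jy Jz yu; move/andP : hu => [u1 ->].
  by rewrite andbT (leq_trans _ u1).
have eqi (D : set 'rV[R]_n) : (forall y z : 'rV[R]_n, cset w J y -> cset w J z -> D y -> D z) ->
    \1_D x = \1_D (corner w J) :> R.
  move=> e; case: (indicP R D x) => -[Dx ->];
    case: (indicP R D (corner w J)) => -[Dc ->] //.
    by case: Dc; exact: e Dx.
  by case: Dx; exact: e Dc.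
by rewrite (eqi _ eqA) (eqi _ eqB).
Qed.

(** For orthogonality, distinct cubes of equal generation are disjoint; otherwise the function of
    the coarser cube is constant on the finer one, whose function has mean zero. *)
Lemma haar_is_system : haar_system w (fun I => haar mu w (c w I) eta).
Proof.
split => //.
- move=> I; have [a [b [-> _ le1]]] := haar_form I; apply: le_trans le1.
  rewrite le_eqVlt; apply/orP; left; apply/eqP.
  rewrite -[RHS]subr0 -(subr0 (_ + _)) -[in RHS](mulr0 0).
  have -> : (fun x => (a * \1_(A I) x - b * \1_(B I) x) ^+ 2) =
            (fun x => a ^+ 2 * \1_(A I) x - (- b ^+ 2) * \1_(B I) x).
    apply/funext => x; case: (indicP R (A I) x) => -[Ax ->];
      case: (indicP R (B I) x) => -[Bx ->]; last by ring.
    - by case: (AB Ax).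
    - by ring.
    - by ring.
  by rewrite haar_int mulr0 !subr0 mulNr opprK.
- move=> I J IJ.
  wlog gIJ : I J IJ / gen I <= gen J.
    move=> W; have [|/ltW] := leP (gen I) (gen J); first exact: W.
    move=> /W; rewrite eq_sym => /(_ IJ) <-.
    by apply: eq_Rintegral => x _; rewrite mulrC.
  move: gIJ; rewrite le_eqVlt => /predU1P[gIJ|gIJ].
    rewrite (@rintegral_ext _ _ _ mu (fun=> 0)) ?Rintegral_cst ?mul0r// => x.
    case: (pselect (cset w I x)) => Ix; last by rewrite haar_supp ?mul0r.
    case: (pselect (cset w J x)) => Jx; last by rewrite [X in _ * X]haar_supp ?mulr0.
    by move: IJ; rewrite (cset_eq gIJ Ix Jx) eqxx.
  have [a ha] := haar_const gIJ.
  rewrite (@rintegral_ext _ _ _ mu (fun x => a * haar mu w (c w J) eta x)); last first.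
    move=> x; case: (pselect (cset w J x)) => Jx; first by rewrite ha.
    by rewrite (haar_supp Jx) !mulr0.
  rewrite rintegralZ ?haar_int0 ?mulr0//.
  apply: (sqi_supp (cset_meas w J)); first exact: cset_lty ud _ _.
    exact: haar_sqi.
  exact: haar_supp.
Qed.

End Haar.
End HaarSystem.

(** * Finite sums and dyadic scales *)

Section RealSums.
Context {R : realType}.

Lemma sum_cauchy_schwarz (J : finType) (a b : J -> R) :
  (\sum_j a j * b j) ^+ 2 <= (\sum_j a j ^+ 2) * (\sum_j b j ^+ 2).
Proof.
set P := \sum_j a j * b j; set X := \sum_j a j ^+ 2; set Y := \sum_j b j ^+ 2.
have key (s t : R) : 0 <= s ^+ 2 * X - 2 * s * t * P + t ^+ 2 * Y.
  have -> : s ^+ 2 * X - 2 * s * t * P + t ^+ 2 * Y = \sum_j (s * a j - t * b j) ^+ 2.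
    rewrite /X /P /Y !mulr_sumr -sumrB -big_split /=.
    by apply: eq_bigr => j _; ring.
  by apply: sumr_ge0 => j _; exact: sqr_ge0.
have X0 : 0 <= X by apply: sumr_ge0 => j _; exact: sqr_ge0.
have [XE|XN] := eqVneq X 0.
  have [->|PN] := eqVneq P 0; first by rewrite expr0n XE mul0r.
  (* For X = 0 and P nonzero, this choice gives the quadratic form the value -1. *)
  have := key ((Y + 1) / (2 * P)) 1; rewrite XE mulr0 mulr1 expr1n mul1r add0r.
  by rewrite (_ : 2 * _ * P = Y + 1); [lra|field].
have Xp : 0 < X by rewrite lt_neqAle eq_sym XN.
have := key P X.
have -> : P ^+ 2 * X - 2 * P * X * P + X ^+ 2 * Y = X * (X * Y - P ^+ 2) by ring.
by rewrite pmulr_rge0// subr_ge0.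
Qed.

Lemma geometric_le (rho : R) (K : nat) : 0 <= rho < 1 ->
  \sum_(k < K) rho ^+ k <= (1 - rho)^-1.
Proof.
move=> /andP[r0 r1].
have d : 0 < 1 - rho by rewrite subr_gt0.
rewrite -[leRHS]mul1r ler_pdivlMr// -opprB mulrN mulrC -subrX1 opprB.
by rewrite lerBlDr lerDl exprn_ge0.
Qed.

Lemma dyadic_scale (K : nat) (delta t : R) : delta <= t < 2 ^+ K * delta ->
  exists2 k : 'I_K, 2 ^+ k * delta <= t & t < 2 ^+ k.+1 * delta.
Proof.
elim: K => [|K IH] /andP[t1 t2].
  by move: t2; rewrite expr0 mul1r ltNge t1.
have [h|h] := ltP t (2 ^+ K * delta).
  have [|k k1 k2] := IH; first by rewrite t1.
  by exists (widen_ord (leqnSn K) k).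
by exists ord_max.
Qed.

End RealSums.

(** * Fubini's theorem for real integrands *)

Section ProductIntegrals.
Context d1 d2 (T1 : measurableType d1) (T2 : measurableType d2) (R : realType).
Variables (m1 : {sigma_finite_measure set T1 -> \bar R}).
Variables (m2 : {sigma_finite_measure set T2 -> \bar R}).

Lemma rint_prod (f : T1 -> R) (g : T2 -> R) : rint m1 f -> rint m2 g ->
  rint (m1 \x m2)%E (fun p => f p.1 * g p.2).
Proof.
move=> fi gi.
have mf := rint_measurable fi; have mg := rint_measurable gi.
have mfg : measurable_fun setT (fun p : T1 * T2 => f p.1 * g p.2).
  by apply: measurable_funM; exact: measurableT_comp.
apply/integrable12ltyP; first exact/measurable_EFinP.
have ig := rint_abs gi; have iff := rint_abs fi.
under eq_integral => x _.
  under eq_integral => y _.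
    rewrite /= normrM EFinM; over.
  rewrite ge0_integralZl//; last exact/measurable_EFinP/(rint_measurable ig).
  rewrite EFin_rintegral// -EFinM mulrC; over.
by rewrite EFin_rintegral ?ltry//; exact: rintZ.
Qed.

Lemma rintegral_fubini (F : T1 * T2 -> R) : rint (m1 \x m2)%E F ->
  \int[(m1 \x m2)%E]_p F p = \int[m1]_x \int[m2]_y F (x, y).
Proof.
move=> Fi; rewrite /Rintegral -(integral12_prod_meas1 Fi); congr fine.
have i1 := ae_integrable1 Fi.
apply: ae_eq_integral => //=.
- exact: measurable_fubini_F Fi.
- apply/measurable_EFinP; apply: measurableT_comp => //.
  exact: measurable_fubini_F Fi.
- apply: filterS i1 => x /= ix _; rewrite fineK//.
  exact: (integrable_fin_num _ ix).
Qed.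

Lemma rintegral_fubini2 (F : T1 * T2 -> R) : rint (m1 \x m2)%E F ->
  \int[(m1 \x m2)%E]_p F p = \int[m2]_y \int[m1]_x F (x, y).
Proof.
move=> Fi; rewrite /Rintegral -(integral21_prod_meas1 Fi); congr fine.
have i2 := ae_integrable2 Fi.
apply: ae_eq_integral => //=.
- exact: measurable_fubini_G Fi.
- apply/measurable_EFinP; apply: measurableT_comp => //.
  exact: measurable_fubini_G Fi.
- apply: filterS i2 => x /= ix _; rewrite fineK//.
  exact: (integrable_fin_num _ ix).
Qed.

Lemma rintegral_prod (f : T1 -> R) (g : T2 -> R) : rint m1 f -> rint m2 g ->
  \int[(m1 \x m2)%E]_p (f p.1 * g p.2) = (\int[m1]_x f x) * (\int[m2]_y g y).
Proof.
move=> fi gi; rewrite rintegral_fubini; last exact: rint_prod.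
rewrite (@rintegral_ext _ _ _ _ (fun x => (\int[m2]_y g y) * f x)).
  by rewrite rintegralZ// mulrC.
by move=> x /=; rewrite rintegralZ// mulrC.
Qed.

Lemma sqi_prod (f : T1 -> R) (g : T2 -> R) : sqi m1 f -> sqi m2 g ->
  sqi (m1 \x m2)%E (fun p => f p.1 * g p.2).
Proof.
move=> [mf fi] [mg gi]; split.
  by apply: measurable_funM; exact: measurableT_comp.
by under eq_fun do rewrite exprMn; exact: rint_prod fi gi.
Qed.

End ProductIntegrals.

(** * The kernel bound summed over dyadic annuli *)

Section KernelEstimate.
Context {R : realType} {n : nat}.
Variables (mu : {sigma_finite_measure set 'rV[R]_n -> \bar R}).
Variables (lam : 'rV[R]_n -> R -> R) (C C' alpha : R).
Hypothesis ud : upper_doubling mu lam C C'.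
Hypothesis alpha_gt0 : 0 < alpha.

Definition decay (a : R) : R := 2^-1 `^ a.

Lemma decay_bounds a : 0 < a -> 0 < decay a < 1.
Proof.
move=> a0; rewrite /decay powR_gt0 ?invr_gt0//=.
have := @gt0_ltr_powR R a a0 2^-1 1; rewrite powR1; apply.
- by rewrite nnegrE invr_ge0.
- by rewrite nnegrE.
- by rewrite invf_lt1// ltr1n.
Qed.

Lemma decay_pow a (k : nat) : (2^-1 ^+ k) `^ a = decay a ^+ k.
Proof.
have h0 : (0 : R) <= 2^-1 by rewrite invr_ge0.
by rewrite -(powR_mulrn k h0) powRAC powR_mulrn// powR_ge0.
Qed.

(** One C bounds the measure of the ball of radius 2 r_k by lambda(x', r_k); C C' compares
    lambda(x', r_k) with lambda(x, |x - y|); 2^alpha comes from |x - y| being at least r_k / 2; the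
    quotient sums the series over the annuli. *)
Definition kernel_const : R := C ^+ 2 * C' * 2 `^ alpha / (1 - decay alpha).

(* [lam] need not be measurable, so the kernel bound is dominated by a step
   function of [y] alone, centred at the fixed base point [x']. *)
Lemma annular_weight (x' : 'rV[R]_n) (l delta : R) (K : nat) :
  0 <= l -> 0 < delta -> 4 * l <= delta ->
  exists W : 'rV[R]_n -> R,
    [/\ rint mu W, forall y, 0 <= W y,
     \int[mu]_y W y <= kernel_const * (l / delta) `^ alpha &
     forall x y, `|x - x'| <= l -> delta <= `|x' - y| < 2 ^+ K * delta ->
       (`|x - x'| / `|x - y|) `^ alpha / lam x `|x - y| <= W y].
Proof.
move=> l0 d0 ld.
have [C1 C'1] := doubling_ge1 ud; have [[_ lmono ldbl lcmp] lmu] := ud.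
have [Cp C'p] : 0 < C /\ 0 < C' by split; lra.
pose rr k := 2 ^+ k * delta.
have rr0 k : 0 < rr k by rewrite mulr_gt0// exprn_gt0.
have rrS k : rr k.+1 = 2 * rr k by rewrite /rr exprS mulrA.
have lrr k : 0 < lam x' (rr k) by exact: (lam_gt0 ud).
(* A bound valid on the annulus r_k <= |x' - y| < r_(k+1); [W] spreads it over the whole ball of
   radius r_(k+1). *)
pose c k := C * C' * (2 * l / rr k) `^ alpha / lam x' (rr k).
have c0 k : 0 <= c k.
  apply: divr_ge0; last exact/ltW.
  by rewrite mulr_ge0 ?powR_ge0// mulr_ge0// ltW.
pose B k : set 'rV[R]_n := [set y | `|x' - y| < rr k].
have mB k : measurable (B k) by exact: ball_meas.
have By k : (mu (B k) < +oo)%E by exact: (bounded_lty ud (mB k) (fun y (h : B k y) => h)).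
pose W y := \sum_(k < K) c k * \1_(B k.+1) y.
have iB k : rint mu (\1_(B k)) by exact: (rint_indic (mB k) (By k)).
exists W; split.
- by apply: rint_sum => k; exact/rintZ.
- by move=> y; apply: sumr_ge0 => k _; apply: mulr_ge0.
- rewrite rintegral_sum; last by move=> k; exact/rintZ.
  pose e := (l / delta) `^ alpha.
  have term k : \int[mu]_y (c k * \1_(B k.+1) y) <=
      C ^+ 2 * C' * 2 `^ alpha * e * decay alpha ^+ k.
    rewrite rintegralZ// rintegral_indic//.
    have bk : fine (mu (B k.+1)) <= C * lam x' (rr k).
      rewrite -lee_fin fineK ?ge0_fin_numE//.
      have := lmu x' (rr k.+1) (rr0 _); rewrite ball_norm => h.
      by apply: le_trans h _; rewrite lee_fin rrS; exact: ldbl.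
    apply: le_trans (ler_wpM2l (c0 k) bk) _.
    rewrite /c -decay_pow /e le_eqVlt; apply/orP; left; apply/eqP.
    have -> : 2 * l / rr k = 2 * (l / delta) * 2^-1 ^+ k.
      have : delta != 0 by rewrite gt_eqF.
      have : (2 : R) ^+ k != 0 by rewrite expf_neq0.
      by move=> ? ?; rewrite /rr exprVn; field; apply/andP.
    have ld0 : 0 <= l / delta by rewrite divr_ge0// ltW.
    move: (l / delta) ld0 => q q0.
    have lr0 : lam x' (rr k) != 0 by rewrite gt_eqF.
    rewrite !powRM ?exprn_ge0 ?mulr_ge0 ?invr_ge0//.
    by field.
  have [r0 r1] := andP (decay_bounds alpha_gt0).
  apply: (@le_trans _ _ (\sum_(k < K) (C ^+ 2 * C' * 2 `^ alpha * e * decay alpha ^+ k))).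
    by apply: ler_sum => k _; exact: term.
  rewrite -mulr_sumr; apply: (@le_trans _ _ (C ^+ 2 * C' * 2 `^ alpha * e * (1 - decay alpha)^-1)).
    apply: ler_wpM2l; last by apply: geometric_le; rewrite r1 ltW.
    by rewrite !mulr_ge0 ?powR_ge0 ?exprn_ge0 ?(ltW Cp) ?(ltW C'p).
  by rewrite /kernel_const mulrAC.
- move=> x y xx' xy.
  have [k k1 k2] := dyadic_scale xy.
  have tri : `|x' - y| <= `|x - x'| + `|x - y|.
    have -> : x' - y = (x - y) - (x - x') by rewrite opprB [RHS]addrC addrA subrK.
    by rewrite [leRHS]addrC; exact: ler_normB.
  (* |x - x'| is at most delta / 4, hence at most r_k / 4, so y is almost as far from x as from
     x'. *)
  have rk : rr k <= 2 * `|x - y|.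
    have dr : delta <= rr k by rewrite /rr ler_peMl ?(ltW d0)// exprn_ege1// ler1n.
    move: k1; rewrite -/(rr k); lra.
  have xy0 : 0 < `|x - y| by have := rr0 k; lra.
  apply: (@le_trans _ _ (c k)).
    rewrite /c.
    have lc : lam x' (rr k) <= C * C' * lam x `|x - y|.
      have dr : delta <= rr k by rewrite /rr ler_peMl ?(ltW d0)// exprn_ege1// ler1n.
      apply: (@le_trans _ _ (C' * lam x (rr k))).
        by apply: lcmp => //; rewrite distrC; lra.
      rewrite (mulrC C) -mulrA ler_pM2l//; apply: le_trans (ldbl x _ xy0).
      exact: lmono.
    have lx := lam_gt0 ud x xy0.
    rewrite ler_pdivrMr// mulrAC ler_pdivlMr//.
    rewrite mulrC [leRHS]mulrAC; apply: ler_pM; rewrite ?powR_ge0// ?(ltW (lrr k))//.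
    apply: ge0_ler_powR; rewrite ?nnegrE ?(ltW alpha_gt0)//.
    + by rewrite divr_ge0 ?mulr_ge0// ltW.
    + rewrite ler_pdivrMr// mulrAC ler_pdivlMr//.
      have : `|x - x'| * rr k <= l * (2 * `|x - y|) by apply: ler_pM => //; exact: ltW.
      lra.
  rewrite /W (bigD1 k)//= -[leLHS]addr0 lerD//.
    by rewrite indicE mem_set ?mulr1// /B /= /rr.
  by apply: sumr_ge0 => j _; apply: mulr_ge0.
Qed.

End KernelEstimate.

(** * Kernels with values in a finite-dimensional l^2, tested against a function of mean zero *)

Section KernelLemma.
Context {R : realType} {n : nat}.
Variables (mu : {sigma_finite_measure set 'rV[R]_n -> \bar R}).
Variables (lam : 'rV[R]_n -> R -> R) (C C' alpha : R).
Hypothesis ud : upper_doubling mu lam C C'.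
Hypothesis alpha_gt0 : 0 < alpha.
Local Notation X := 'rV[R]_n.
Local Notation mm := (mu \x mu)%E.

Variables (J : finType) (kap : J -> X * X -> R).
Variables (A G : set X) (h : X -> R) (l delta E : R) (K : nat).
Hypotheses (mA : measurable A) (Ay : (mu A < +oo)%E).
Hypotheses (hh : sqi mu h) (h0 : forall x, ~ A x -> h x = 0)
  (hint : \int[mu]_x h x = 0).
Hypothesis hk : forall j, rint mm (fun p => h p.1 * kap j p).
Hypothesis Ak : forall j, rint mm (fun p => \1_A p.1 * kap j p).
Hypotheses (l0 : 0 <= l) (d0 : 0 < delta) (ld : 4 * l <= delta) (E0 : 0 <= E).
Hypothesis diam : forall x x', A x -> A x' -> `|x - x'| <= l.
Hypothesis far : forall x y, A x -> G y -> delta <= `|x - y| < 2 ^+ K * delta.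
Hypothesis off : forall j x y, A x -> ~ G y -> kap j (x, y) = 0.
Hypothesis est : forall x x' y, A x -> A x' -> G y ->
  \sum_j (kap j (x, y) - kap j (x', y)) ^+ 2 <=
  (E * ((`|x - x'| / `|x - y|) `^ alpha / lam x `|x - y|)) ^+ 2.

(** The indicator of A replaces h here: where h vanishes inside A, the integrability of h times the
    kernel says nothing about the section. *)
Let good x := forall j, rint mu (fun y => \1_A x * kap j (x, y)).

Let good_ae : {ae mu, forall x, good x}.
Proof.
apply: filter_forall => j; have := ae_integrable1 (Ak j).
by apply: filterS.
Qed.

(* The mean value of [h] being zero, [kap j (x, y)] may be replaced by
   [kap j (x, y) - kap j (x0, y)], where Fubini provides a base point [x0] with
   integrable sections; the l^2 norm over [j] is then taken inside by duality. *)
Lemma kernel_estimate :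
  \sum_j (\int[mm]_p (h p.1 * kap j p)) ^+ 2 <=
  (kernel_const C C' alpha * E * (l / delta) `^ alpha * \int[mu]_x `|h x|) ^+ 2.
Proof.
have ih := sqi_supp mA Ay hh h0.
have [[x0 Ax0 gx0]|none] := pselect (exists2 x, A x & good x); last first.
  (* Almost every point is good, so if A contains no good point then A is null and every coefficient
     is 0. *)
  rewrite big1 ?sqr_ge0// => j _; rewrite rintegral_fubini//.
  rewrite (_ : \int[mu]_x _ = 0) ?expr0n//.
  rewrite [RHS](_ : 0 = fine (\int[mu]_x (0 : R)%:E)); last by rewrite integral0.
  congr fine; apply: ae_eq_integral => //=.
    apply/measurable_EFinP.
    have mf := measurable_fubini_F (hk j).
    by apply: (measurableT_comp _ mf) => //.
  apply: filterS good_ae => x gx _; rewrite /= /Rintegral.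
  have nA : ~ A x by move=> Ax; apply: none; exists x.
  by under eq_integral do rewrite h0// mul0r; rewrite integral0.
have ik j : rint mu (fun y => kap j (x0, y)).
  have := gx0 j; congr (rint _ _); apply/funext => y.
  by rewrite indicE mem_set// mul1r.
pose a j := \int[mm]_p (h p.1 * kap j p).
pose D j (p : X * X) := kap j p - kap j (x0, p.2).
have i0 j : rint mm (fun p => h p.1 * kap j (x0, p.2)) by exact: rint_prod ih (ik j).
have iD j : rint mm (fun p => h p.1 * D j p).
  by under eq_fun do rewrite /D mulrBr; exact: rintB.
have aE j : a j = \int[mm]_p (h p.1 * D j p).
  rewrite (@rintegral_ext _ _ _ _ (fun p => h p.1 * kap j p - h p.1 * kap j (x0, p.2)));
    last by move=> p; rewrite mulrBr.
  by rewrite rintegralB// (rintegral_prod ih (ik j)) hint mul0r subr0.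
have [W [iW W0 intW leW]] := annular_weight ud alpha_gt0 x0 K l0 d0 ld.
set S2 := \sum_j _; pose S := Num.sqrt S2.
have S20 : 0 <= S2 by apply: sumr_ge0 => j _; exact: sqr_ge0.
have SS : S ^+ 2 = S2 by rewrite sqr_sqrtr.
have S0 : 0 <= S by exact: sqrtr_ge0.
have iha := rint_abs ih.
have H0 : 0 <= \int[mu]_x `|h x| by exact: Rintegral_ge0.
have key : S2 <= S * (E * (\int[mu]_x `|h x| * \int[mu]_y W y)).
  have -> : S2 = \int[mm]_p (\sum_j a j * (h p.1 * D j p)).
    rewrite rintegral_sum; last by move=> j; exact: rintZ.
    by apply: eq_bigr => j _; rewrite rintegralZ// -aE expr2.
  rewrite -(rintegral_prod iha iW) mulrA -rintegralZ; last exact: (rint_prod iha iW).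
  apply: rintegral_le.
  - by apply: rint_sum => j; exact: rintZ.
  - exact/rintZ/(rint_prod iha iW).
  move=> [x y] /=.
  have -> : \sum_j a j * (h x * D j (x, y)) = h x * \sum_j a j * D j (x, y).
    by rewrite mulr_sumr; apply: eq_bigr => j _; rewrite mulrCA.
  case: (pselect (A x)) => Ax; last by rewrite h0// mul0r normr0 mul0r mulr0.
  rewrite mulrCA; apply: (@le_trans _ _ (`|h x| * `|\sum_j a j * D j (x, y)|)).
    by rewrite -normrM ler_norm.
  apply: ler_wpM2l => //.
  case: (pselect (G y)) => Gy; last first.
    rewrite big1 ?normr0 ?mulr_ge0// => j _.
    by rewrite /D /= !off// subrr mulr0.
  have SEW : 0 <= S * E * W y by rewrite !mulr_ge0.
  rewrite -(ger0_norm SEW) -ler_sqr ?nnegrE// !real_normK ?num_real//.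
  apply: le_trans (sum_cauchy_schwarz _ _) _.
  rewrite -mulrA exprMn SS; apply: ler_wpM2l => //.
  apply: le_trans (est Ax Ax0 Gy) _.
  have q0 : 0 <= (`|x - x0| / `|x - y|) `^ alpha / lam x `|x - y|.
    apply: divr_ge0; first exact: powR_ge0.
    apply/ltW/(lam_gt0 ud); apply: lt_le_trans d0 _.
    by case/andP: (far Ax Gy).
  rewrite ler_sqr ?nnegrE ?(mulr_ge0 E0 q0) ?(mulr_ge0 E0 (W0 y))//.
  apply: ler_wpM2l => //.
  by apply: leW; [exact: diam|exact: far].
have W'0 : 0 <= \int[mu]_y W y by exact: Rintegral_ge0.
have {}key : S <= E * (\int[mu]_x `|h x| * \int[mu]_y W y).
  have [->|SN] := eqVneq S 0; first by rewrite !mulr_ge0.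
  by move: key; rewrite -SS expr2 ler_pM2l// lt_neqAle eq_sym SN.
set P := kernel_const _ _ _ * _ * _ * _.
have SP : S <= P.
  apply: (le_trans key).
  have -> : P = E * (\int[mu]_x `|h x| * (kernel_const C C' alpha * (l / delta) `^ alpha)).
    by rewrite /P; ring.
  by apply: ler_wpM2l => //; apply: ler_wpM2l.
by rewrite -SS ler_sqr ?nnegrE// (le_trans S0 SP).
Qed.

End KernelLemma.

(** * Geometric weights and packing *)

Section DepthSums.
Context {R : realType}.
Variables (I : eqType) (s : seq I) (rho : R) (dep : I -> nat).
Hypothesis us : uniq s.
Hypothesis rho01 : 0 <= rho < 1.

Lemma sum_depth_le : {in s &, injective dep} ->
  \sum_(i <- s) rho ^+ dep i <= (1 - rho)^-1.
Proof.
move=> inj; have [r0 _] := andP rho01.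
rewrite -(big_map dep xpredT (fun k => rho ^+ k)).
have ud : uniq (map dep s) by rewrite map_inj_in_uniq.
pose K := (\max_(k <- map dep s) k).+1.
have pe : perm_eq (map dep s) [seq k <- iota 0 K | k \in map dep s].
  apply: uniq_perm => //; first by rewrite filter_uniq// iota_uniq.
  move=> k; rewrite mem_filter mem_iota /= add0n.
  case: (boolP (k \in map dep s)) => //= km; symmetry.
  by rewrite ltnS; exact: leq_bigmax_seq.
rewrite (perm_big _ pe) big_filter /=; apply: le_trans (geometric_le K rho01).
rewrite -(big_mkord xpredT (fun k => rho ^+ k)) /index_iota subn0 big_mkcond /=.
by apply: ler_sum => k _; case: ifP => // _; rewrite exprn_ge0.
Qed.

End DepthSums.

(** The sets that contain a given point have distinct depths, so at each point the sum is part of a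
    single geometric series. *)
Lemma sum_depth_indic_le {R : realType} (I : eqType) (s : seq I) (rho : R)
    (dep : I -> nat) (T : Type) (A : I -> set T) x :
  uniq s -> 0 <= rho < 1 ->
  {in s &, forall i j, A i x -> A j x -> dep i = dep j -> i = j} ->
  \sum_(i <- s) rho ^+ dep i * \1_(A i) x <= (1 - rho)^-1.
Proof.
move=> us rho01 inj.
rewrite (eq_bigr (fun i => if x \in A i then rho ^+ dep i else 0)); last first.
  by move=> i _; rewrite indicE; case: ifP; rewrite ?mulr1 ?mulr0.
rewrite -big_mkcond -big_filter; apply: sum_depth_le => //.
  exact: filter_uniq.
move=> i j; rewrite !mem_filter => /andP[/set_mem Ai si] /andP[/set_mem Aj sj].
exact: inj.
Qed.

Section Weighted.
Context d (T : measurableType d) (R : realType) (mu : {measure set T -> \bar R}).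

Lemma weighted_measure_le (I : Type) (s : seq I) (c : I -> R) (A : I -> set T)
    (M : R) (Om : set T) :
  (forall i, measurable (A i)) -> (forall i, (mu (A i) < +oo)%E) ->
  measurable Om -> (mu Om < +oo)%E ->
  (forall x, \sum_(i <- s) c i * \1_(A i) x <= M * \1_Om x) ->
  \sum_(i <- s) c i * fine (mu (A i)) <= M * fine (mu Om).
Proof.
move=> mA Ay mO Oy le.
have iA i : rint mu (\1_(A i)) by exact: (rint_indic (mA i) (Ay i)).
have iO : rint mu (\1_Om) by exact: (rint_indic mO Oy).
rewrite -(rintegral_indic mu mO) -rintegralZ//.
rewrite (eq_bigr (fun i => \int[mu]_x (c i * \1_(A i) x))); last first.
  by move=> i _; rewrite rintegralZ// rintegral_indic.
rewrite -rintegral_sum; last by move=> i; exact: rintZ.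
by apply: rintegral_le => //; [apply: rint_sum => i; exact: rintZ|exact: rintZ].
Qed.

End Weighted.

(** * Complex-valued L^2 functions and the operators on them *)

Section ComplexL2.
Context d (T : measurableType d) (R : realType) (mu : {measure set T -> \bar R}).
Implicit Types (f g : T -> R[i]) (phi : T -> R).
Local Notation Re := (@complex.Re R).
Local Notation Im := (@complex.Im R).

Lemma cmod_sqr (z : R[i]) : cmod z ^+ 2 = Re z ^+ 2 + Im z ^+ 2.
Proof. by case: z => a b /=; rewrite sqr_sqrtr// addr_ge0 ?sqr_ge0. Qed.

Lemma cmod_ge0 (z : R[i]) : 0 <= cmod z.
Proof. by case: z => a b /=; exact: sqrtr_ge0. Qed.

Lemma ReM_real (z : R[i]) (c : R) : Re (z * c%:C%C) = Re z * c.
Proof. by case: z => a b /=; rewrite mulr0 subr0. Qed.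

Lemma ImM_real (z : R[i]) (c : R) : Im (z * c%:C%C) = Im z * c.
Proof. by case: z => a b /=; rewrite mulr0 add0r. Qed.

Definition csqi f := sqi mu (Re \o f) /\ sqi mu (Im \o f).

Definition sqn f : R := \int[mu]_x (Re (f x)) ^+ 2 + \int[mu]_x (Im (f x)) ^+ 2.

Lemma sqn_ge0 f : 0 <= sqn f.
Proof. by apply: addr_ge0; apply: Rintegral_ge0 => x _; exact: sqr_ge0. Qed.

Lemma cmod_measurable f : Cmeasurable f -> measurable_fun setT (fun x => cmod (f x)).
Proof.
move=> [mr mi].
have -> : (fun x => cmod (f x)) = (fun x => Num.sqrt (Re (f x) ^+ 2 + Im (f x) ^+ 2)).
  by apply/funext => x; case: (f x).
apply: (@measurableT_comp _ _ _ _ _ _ (@Num.sqrt R)) => //.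
  by apply: continuous_measurable_fun; exact: sqrt_continuous.
by apply: measurable_funD; apply: measurable_funX.
Qed.

Lemma CLnorm2E f :
  (CLnorm mu 2%:E f = (\int[mu]_x (cmod (f x) ^+ 2)%:E) `^ (2^-1))%E.
Proof.
rewrite /CLnorm unlock /=; congr (_ `^ _)%E; apply: eq_integral => x _.
congr EFin; rewrite ger0_norm ?cmod_ge0//.
by rewrite -powR_mulrn ?cmod_ge0.
Qed.

Lemma CL2P f : CL mu 2%:E f <-> csqi f.
Proof.
rewrite /CL CLnorm2E; split.
- move=> [mf]; have [mr mi] := mf => h.
  have fy : (\int[mu]_x (cmod (f x) ^+ 2)%:E < +oo)%E.
    by apply: lty_poweRy h; rewrite invr_neq0.
  have mc : measurable_fun setT (fun x => cmod (f x) ^+ 2).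
    by apply: measurable_funX; exact: cmod_measurable.
  have ic : rint mu (fun x => cmod (f x) ^+ 2).
    by apply: rint_ge0_lty => // x; exact: sqr_ge0.
  split; split => //; apply: (rint_le _ ic); try exact: measurable_funX.
    by move=> x; rewrite !ger0_norm ?sqr_ge0// cmod_sqr /= lerDl sqr_ge0.
  by move=> x; rewrite !ger0_norm ?sqr_ge0// cmod_sqr /= lerDr sqr_ge0.
- move=> [[mr ir] [mi ii]]; split => //.
  under eq_integral do rewrite cmod_sqr.
  by rewrite EFin_rintegral ?poweR_EFin ?ltry//; exact: rintD.
Qed.

Lemma CLnorm2_csqi f : csqi f -> CLnorm mu 2%:E f = (Num.sqrt (sqn f))%:E.
Proof.
move=> [[mr ir] [mi ii]]; rewrite CLnorm2E.
under eq_integral do rewrite cmod_sqr.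
rewrite EFin_rintegral; last exact: rintD.
rewrite poweR_EFin; congr EFin; rewrite powR12_sqrt; last first.
  by apply: Rintegral_ge0 => x _; rewrite addr_ge0// sqr_ge0.
by rewrite rintegralD.
Qed.

(** The infimum defining [opnorm] need not be attained; the strict inequality yields an admissible
    bound below A. *)
Lemma opnorm_sqn (U : (T -> R[i]) -> T -> R[i]) (A : R) f :
  (opnorm mu U < A%:E)%E -> csqi f -> csqi (U f) -> sqn (U f) <= A ^+ 2 * sqn f.
Proof.
move=> /ereal_inf_lt[_ [M [M0 hM] <-]]; rewrite lte_fin => MA hf hUf.
have := hM f ((CL2P f).2 hf); rewrite !CLnorm2_csqi// -EFinM lee_fin => le.
have A0 : 0 <= A by exact: le_trans M0 (ltW MA).
have le' : Num.sqrt (sqn (U f)) <= A * Num.sqrt (sqn f).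
  by apply: (le_trans le); apply: ler_wpM2r; [exact: sqrtr_ge0|exact: ltW].
have := le'; rewrite -ler_sqr ?nnegrE ?mulr_ge0 ?sqrtr_ge0//.
by rewrite exprMn !sqr_sqrtr ?sqn_ge0.
Qed.

Definition bessel_re F phi : R := \int[mu]_x (Re (F x) * phi x).
Definition bessel_im F phi : R := \int[mu]_x (Im (F x) * phi x).

Lemma pairing_real F phi :
  pairing mu F (fun x => (phi x)%:C%C) = (bessel_re F phi +i* bessel_im F phi)%C.
Proof.
rewrite /pairing /Cintegral; congr (_ +i* _)%C.
  by apply: eq_Rintegral => x _; rewrite ReM_real.
by apply: eq_Rintegral => x _; rewrite ImM_real.
Qed.

Lemma pairingC f g : pairing mu f g = pairing mu g f.
Proof. by rewrite /pairing; congr Cintegral; apply/funext => x; rewrite mulrC. Qed.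

Lemma bounded_csqi (S : set T) f (B : R) : measurable S -> (mu S < +oo)%E ->
  Cmeasurable f -> (forall x, cmod (f x) <= B) -> (forall x, ~ S x -> f x = 0) ->
  csqi f /\ sqn f <= B ^+ 2 * fine (mu S).
Proof.
move=> mS Sy mf fB f0; have [mr mi] := mf.
have iS := rint_indic mS Sy; have iBS := rintZ (B ^+ 2) iS.
have mc : measurable_fun setT (fun x => cmod (f x) ^+ 2).
  by apply: measurable_funX; exact: cmod_measurable.
have le x : cmod (f x) ^+ 2 <= B ^+ 2 * \1_S x.
  case: (indicP R S x) => -[Sx ->].
    by rewrite mulr1 ler_sqr ?nnegrE ?cmod_ge0// (le_trans (cmod_ge0 (f x))).
  by rewrite f0//= expr0n /= addr0 sqrtr0 expr0n mulr0.
have ic : rint mu (fun x => cmod (f x) ^+ 2).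
  apply: (rint_le mc iBS) => x.
  by rewrite ger0_norm ?sqr_ge0// (le_trans (le x))// ler_norm.
have ir : rint mu (fun x => Re (f x) ^+ 2).
  apply: (rint_le _ ic); first exact: measurable_funX.
  by move=> x; rewrite !ger0_norm ?sqr_ge0// cmod_sqr /= lerDl sqr_ge0.
have ii : rint mu (fun x => Im (f x) ^+ 2).
  apply: (rint_le _ ic); first exact: measurable_funX.
  by move=> x; rewrite !ger0_norm ?sqr_ge0// cmod_sqr /= lerDr sqr_ge0.
split; first by split; split.
rewrite /sqn -rintegralD// -(rintegral_indic mu mS) -rintegralZ//.
by apply: rintegral_le => //; [exact: rintD|move=> x; rewrite -cmod_sqr].
Qed.

Lemma complex_bessel (I : eqType) (s : seq I) (phi : I -> T -> R) F :
  uniq s -> csqi F -> (forall i, sqi mu (phi i)) ->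
  (forall i, \int[mu]_x (phi i x) ^+ 2 <= 1) ->
  {in s &, forall i j, i != j -> \int[mu]_x (phi i x * phi j x) = 0} ->
  \sum_(i <- s) (bessel_re F (phi i) ^+ 2 + bessel_im F (phi i) ^+ 2) <= sqn F.
Proof.
move=> us [hr hi] hphi n1 orth; rewrite big_split /=.
by apply: lerD; [exact: (bessel us hr)|exact: (bessel us hi)].
Qed.

End ComplexL2.

Section LinearOnL2.
Context d (T : measurableType d) (R : realType) (mu : {measure set T -> \bar R}).
Variable U : (T -> R[i]) -> T -> R[i].
Hypothesis U2 : forall f, CL mu 2%:E f -> CL mu 2%:E (U f).
Hypothesis Ulin : linear_on_L2 mu U.
Implicit Types (f g : T -> R[i]) (phi : T -> R).
Local Notation Re := (@complex.Re R).
Local Notation Im := (@complex.Im R).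

Lemma U_csqi f : csqi mu f -> csqi mu (U f).
Proof. by move=> /CL2P/U2/CL2P. Qed.

Lemma rintegral_ae (f g : T -> R) : measurable_fun setT f -> measurable_fun setT g ->
  (\forall x \ae mu, f x = g x) -> \int[mu]_x f x = \int[mu]_x g x.
Proof.
move=> mf mg fg; congr fine; apply: ae_eq_integral => //.
- exact/measurable_EFinP.
- exact/measurable_EFinP.
- by apply: filterS fg => x fgx _; rewrite /= fgx.
Qed.

Lemma csqi_rint f phi : csqi mu f -> sqi mu phi ->
  rint mu (fun x => Re (f x) * phi x) /\ rint mu (fun x => Im (f x) * phi x).
Proof. by move=> [hr hi] hphi; split; exact: sqi_mul. Qed.

Lemma bessel_add f g phi : csqi mu f -> csqi mu g -> sqi mu phi ->
  bessel_re mu (U (fun x => f x + g x)) phi =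
    bessel_re mu (U f) phi + bessel_re mu (U g) phi /\
  bessel_im mu (U (fun x => f x + g x)) phi =
    bessel_im mu (U f) phi + bessel_im mu (U g) phi.
Proof.
move=> hf hg hphi.
have hfg : csqi mu (fun x => f x + g x).
  case: hf hg => [fr fi] [gr gi]; split.
    have := sqiD fr gr; congr (sqi _ _); apply/funext => x /=.
    by case: (f x) (g x) => ? ? [].
  have := sqiD fi gi; congr (sqi _ _); apply/funext => x /=.
  by case: (f x) (g x) => ? ? [].
have [r0 i0] := csqi_rint (U_csqi hfg) hphi.
have [r1 i1] := csqi_rint (U_csqi hf) hphi.
have [r2 i2] := csqi_rint (U_csqi hg) hphi.
have E : \forall x \ae mu, U (fun x => f x + g x) x = U f x + U g x.
  have := Ulin 1 ((CL2P mu f).2 hf) ((CL2P mu g).2 hg).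
  apply: filterS => x.
  by rewrite mul1r; under [X in U X]eq_fun do rewrite mul1r.
split; rewrite /bessel_re /bessel_im.
- rewrite -rintegralD//; apply: rintegral_ae.
  + exact: rint_measurable r0.
  + by apply: measurable_funD; [exact: rint_measurable r1|exact: rint_measurable r2].
  + apply: filterS E => x ->; rewrite -mulrDl.
    by case: (U f x) (U g x) => ? ? [].
- rewrite -rintegralD//; apply: rintegral_ae.
  + exact: rint_measurable i0.
  + by apply: measurable_funD; [exact: rint_measurable i1|exact: rint_measurable i2].
  + apply: filterS E => x ->; rewrite -mulrDl.
    by case: (U f x) (U g x) => ? ? [].
Qed.

(** Operators act on representatives, so U 0 is null only almost everywhere. Additivity at 0 + 0
    forces its pairings to vanish. *)
Lemma bessel0 phi : sqi mu phi -> bessel_re mu (U (fun=> 0)) phi = 0 /\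
  bessel_im mu (U (fun=> 0)) phi = 0.
Proof.
move=> hphi; have h0 : csqi mu (fun=> 0 : R[i]) by split; exact: sqi0.
have [] := bessel_add h0 h0 hphi.
rewrite (_ : (fun x => 0 + 0) = (fun=> 0 : R[i])); last by apply/funext => x; rewrite addr0.
by move=> h1 h2; split; lra.
Qed.

End LinearOnL2.

(** * Separation of a good cube from the complement of a larger one *)

Section SepGeometry.
Context {R : realType} {n : nat}.
Implicit Types (w : grid n) (I K : cube n).

Definition gap I K : nat := `|gen I - gen K|%N.

Lemma side_gap I K : gen K <= gen I -> side R I / side R K = 2^-1 ^+ gap I K.
Proof.
move=> le; rewrite !sideE exprVn exprnN invr_expz -expfzDr//.
by congr (_ ^ _); rewrite /gap; lia.
Qed.

Lemma gap_anc w I K i : gen K <= gen I -> gap I (anc R w i K) = (i + gap I K)%N.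
Proof. by rewrite /gap gen_anc; move: (gen I) (gen K) => a b; lia. Qed.

Definition sepdist I K : R := 4 * Num.sqrt (side R I * side R K).

Lemma sepdist_gt0 I K : 0 < sepdist I K.
Proof. by rewrite mulr_gt0// sqrtr_gt0 mulr_gt0 ?side_gt0. Qed.

Lemma side_le I K : gen K <= gen I -> side R I <= side R K.
Proof. by move=> le; rewrite !sideE ler_eXz2l ?ltr1n//; lia. Qed.

Lemma sepdist_ge I K : gen K <= gen I -> 4 * side R I <= sepdist I K.
Proof.
move=> le; rewrite ler_pM2l//; have sI' := ltW (side_gt0 (R := R) I).
have {1}-> : side R I = Num.sqrt (side R I * side R I).
  by rewrite -expr2 sqrtr_sqr ger0_norm.
by apply: ler_wsqrtr; rewrite ler_wpM2l// side_le.
Qed.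

(** With d = 4 sqrt(l(I) l(K)), the ratio l(I) / d has square l(I) / (16 l(K)), that is 2^-gap / 16.
    The full decay in the gap thus appears for squared pairings. *)
Lemma sep_decay (a : R) I K : 0 < a -> gen K <= gen I ->
  ((side R I / sepdist I K) `^ a) ^+ 2 <= decay a ^+ gap I K.
Proof.
move=> a0 le; have [sI sK] := (side_gt0 (R := R) I, side_gt0 (R := R) K).
have q0 : 0 <= side R I / sepdist I K by rewrite divr_ge0 ?ltW// sepdist_gt0.
have [sI' sK'] := (ltW sI, ltW sK).
rewrite expr2 -powRM// -expr2 -decay_pow.
apply: ge0_ler_powR; rewrite ?nnegrE ?sqr_ge0 ?exprn_ge0 ?(ltW a0)//.
rewrite -side_gap// exprMn exprVn /sepdist exprMn sqr_sqrtr ?mulr_ge0//.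
have -> : side R I ^+ 2 / (4 ^+ 2 * (side R I * side R K)) = 16^-1 * (side R I / side R K).
  by field; rewrite !gt_eqF.
by apply: ler_piMl; [rewrite divr_ge0|rewrite invf_le1// ler1n].
Qed.

Lemma exp2_unbounded (t s : R) : 0 < s -> exists K : nat, t < 2 ^+ K * s.
Proof.
move=> s0; exists (Num.bound `|t / s|).
rewrite -ltr_pdivrMr//; apply: (@lt_le_trans _ _ (Num.bound `|t / s|)%:R).
  by apply: le_lt_trans (archi_boundP _); [exact: ler_norm|exact: normr_ge0].
by rewrite -natrX ler_nat ltnW// ltn_expl.
Qed.

(** M depends on the cubes and on N. It only makes the number of annuli finite; the bounds obtained
    do not involve it. *)
Lemma sep_far w (v : grid n) I K (N : R) : sep R w v I K ->
  exists M : nat, forall x y, cset w I x -> ~ cset v K y -> `|y| <= N ->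
    sepdist I K <= `|x - y| < 2 ^+ M * sepdist I K.
Proof.
move=> [le IK far].
have [M hM] := exp2_unbounded (side R I + `|corner (R := R) w I| + N) (sepdist_gt0 I K).
exists M => x y Ix Ky yN; rewrite far//=; apply: le_lt_trans hM.
have -> : x - y = (x - corner w I) + corner w I - y by rewrite subrK.
apply: le_trans (ler_normB _ _) _; apply: lerD => //.
apply: le_trans (ler_normD _ _) _; apply: lerD => //.
exact: (cset_dist Ix (cset_corner w I)).
Qed.

(** [is_kernel] asks for disjoint compact supports, while dyadic cubes are half open. They are
    provided by a closed ball about the corner of I and by a bounded region outside a larger ball
    with the same centre. *)
Definition near_ball w I : set 'rV[R]_n := [set x | `|corner w I - x| <= side R I].
Definition far_box w I K (N : R) : set 'rV[R]_n :=
  [set y | `|0 - y| <= N] `\` [set y | `|corner w I - y| < sepdist I K].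

Lemma near_ball_compact w I : compact (near_ball w I).
Proof.
apply: bounded_closed_compact; last exact: closed_ball_closed.
exists (`|corner (R := R) w I| + side R I); split; first exact: num_real.
move=> t ht y /= hy; apply: le_trans (ltW ht).
have -> : y = corner w I - (corner w I - y) by rewrite opprB addrC subrK.
by apply: le_trans (ler_normB _ _) _; apply: lerD.
Qed.

Lemma far_box_compact w I K N : compact (far_box w I K N).
Proof.
apply: bounded_closed_compact.
  exists N; split; first exact: num_real.
  by move=> t ht y /= [/= + _]; rewrite sub0r normrN => /le_trans; apply; exact: ltW.
rewrite /far_box setDE; apply: closedI; first exact: closed_ball_closed.
apply: open_closedC.
apply: (@open_comp _ _ (fun y : 'rV[R]_n => `|corner w I - y|) [set t | t < sepdist I K]).
  by move=> y _; exact: dist_continuous.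
exact: open_lt.
Qed.

Lemma near_far_disj w I K N : gen K <= gen I -> near_ball w I `&` far_box w I K N = set0.
Proof.
move=> le; rewrite -subset0 => y [/= h [_ /=]]; apply.
apply: le_lt_trans h _; have := sepdist_ge le; have := side_gt0 (R := R) I; lra.
Qed.

Lemma sub_near_ball w I : cset w I `<=` near_ball w I.
Proof. by move=> x Ix /=; exact: (cset_dist (cset_corner w I) Ix). Qed.

Lemma sub_far_box w (v : grid n) I K N y : sep R w v I K -> ~ cset v K y -> `|y| <= N ->
  far_box w I K N y.
Proof.
move=> [_ _ far] Ky yN; split; rewrite /= ?sub0r ?normrN//.
by apply/negP; rewrite -leNgt; apply: far => //; exact: cset_corner.
Qed.

End SepGeometry.

(** Cubes of one generation inside K are disjoint, so each value of the gap contributes at most its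
    weight times the measure of K. *)
Lemma carleson_depth {R : realType} {n : nat} (mu : {sigma_finite_measure set 'rV[R]_n -> \bar R})
    (lam : 'rV[R]_n -> R -> R) (C C' rho : R) (w v : grid n) (s : seq (cube n)) (K : cube n) :
  upper_doubling mu lam C C' -> uniq s -> 0 <= rho < 1 ->
  (forall I, I \in s -> gen K <= gen I /\ cset w I `<=` (cset v K : set 'rV[R]_n)) ->
  \sum_(I <- s) rho ^+ gap I K * fine (mu (cset w I)) <= (1 - rho)^-1 * fine (mu (cset v K)).
Proof.
move=> ud us rho01 hs; apply: weighted_measure_le.
- by move=> I; exact: cset_meas.
- by move=> I; exact: cset_lty ud _ _.
- exact: cset_meas.
- exact: cset_lty ud _ _.
move=> x; case: (indicP R (cset v K) x) => -[Kx ->].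
  rewrite mulr1; apply: sum_depth_indic_le => // I J Is Js Ix Jx gIJ.
  apply: cset_eq Ix Jx; have [? _] := hs I Is; have [? _] := hs J Js.
  by move: gIJ; rewrite /gap; lia.
rewrite mulr0 big1_seq// => I /andP[_ Is].
rewrite indicE memNset ?mulr0// => Ix; apply: Kx.
by have [_] := hs I Is; apply.
Qed.

(** * Real and imaginary components, and restrictions *)

Section Parts.
Context {R : realType}.

(** Components are indexed by a boolean so that they can join the finite index set of
    [kernel_estimate]. *)
Definition part (c : bool) (z : R[i]) : R := if c then complex.Im z else complex.Re z.

Lemma part_realM c (t : R) (z : R[i]) : part c (t%:C%C * z) = t * part c z.
Proof. by rewrite mulrC /part; case: c; rewrite ?ReM_real ?ImM_real mulrC. Qed.

Lemma partB c (z z' : R[i]) : part c (z - z') = part c z - part c z'.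
Proof. by case: z z' c => ? ? [? ?] []. Qed.

Lemma part0 c : part c 0 = 0.
Proof. by case: c. Qed.

Lemma sum_part_sqr (z : R[i]) : \sum_c part c z ^+ 2 = cmod z ^+ 2.
Proof. by rewrite big_bool cmod_sqr addrC. Qed.

Lemma cmodM (z z' : R[i]) : cmod (z * z') = cmod z * cmod z'.
Proof. exact: ComplexField.Normc.normcM. Qed.

Lemma Cintegrable_part d (T : measurableType d) (mu : {measure set T -> \bar R}) f c :
  Cintegrable mu f -> rint mu (fun x => part c (f x)).
Proof. by case: c => -[]. Qed.

Lemma Cintegral_part d (T : measurableType d) (mu : {measure set T -> \bar R}) f c :
  part c (Cintegral mu f) = \int[mu]_x part c (f x).
Proof. by case: c. Qed.

Lemma pairing_part d (T : measurableType d) (mu : {measure set T -> \bar R}) F phi c :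
  part c (pairing mu F (fun x => (phi x)%:C%C)) = \int[mu]_x (part c (F x) * phi x).
Proof. by rewrite pairing_real; case: c. Qed.

(** This is the squared modulus of the pairing of F with the real function phi. *)
Definition dev d (T : measurableType d) (mu : {measure set T -> \bar R})
  (F : T -> R[i]) (phi : T -> R) : R := bessel_re mu F phi ^+ 2 + bessel_im mu F phi ^+ 2.

Lemma dev_pairing d (T : measurableType d) (mu : {measure set T -> \bar R}) F phi :
  dev mu F phi = \sum_c part c (pairing mu F (fun x => (phi x)%:C%C)) ^+ 2.
Proof. by rewrite pairing_real big_bool /dev /= addrC. Qed.

Lemma real_csqi d (T : measurableType d) (mu : {measure set T -> \bar R}) (phi : T -> R) :
  sqi mu phi -> csqi mu (fun x => (phi x)%:C%C).
Proof. by move=> h; split => //; exact: sqi0. Qed.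

End Parts.

Section Restriction.
Context d (T : measurableType d) (R : realType).
Implicit Types (f : T -> R[i]) (S : set T).

Definition cres f S : T -> R[i] := fun x => f x * (\1_S x)%:C%C.

Lemma cres_in f S x : S x -> cres f S x = f x.
Proof. by move=> Sx; rewrite /cres indicE mem_set//= mulr1. Qed.

Lemma cres_out f S x : ~ S x -> cres f S x = 0.
Proof. by move=> Sx; rewrite /cres indicE memNset//= mulr0. Qed.

Lemma cres_measurable f S : measurable S -> Cmeasurable f -> Cmeasurable (cres f S).
Proof.
move=> mS [mr mi]; have m1 : measurable_fun setT (\1_S : T -> R) by exact: measurable_indic.
split.
  have := measurable_funM mr m1; congr measurable_fun; apply/funext => x /=.
  by rewrite ReM_real.
have := measurable_funM mi m1; congr measurable_fun; apply/funext => x /=.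
by rewrite ImM_real.
Qed.

Lemma cres_bound f S (B : R) : (forall x, cmod (f x) <= B) -> forall x, cmod (cres f S x) <= B.
Proof.
move=> fB x; case: (pselect (S x)) => Sx; first by rewrite cres_in.
rewrite cres_out//= expr0n /= addr0 sqrtr0.
exact: le_trans (cmod_ge0 (f x)) (fB x).
Qed.

Lemma cres_split f S : (fun x => cres f S x + cres f (~` S) x) = f.
Proof.
apply/funext => x; case: (pselect (S x)) => Sx.
  by rewrite cres_in// cres_out ?addr0// => /(_ Sx).
by rewrite cres_out// cres_in ?add0r.
Qed.

Variable mu : {measure set T -> \bar R}.

Lemma dev_add (U : (T -> R[i]) -> T -> R[i]) f g phi :
  (forall f, CL mu 2%:E f -> CL mu 2%:E (U f)) -> linear_on_L2 mu U ->
  csqi mu f -> csqi mu g -> sqi mu phi ->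
  dev mu (U (fun x => f x + g x)) phi <= 2 * dev mu (U f) phi + 2 * dev mu (U g) phi.
Proof.
move=> U2 Ul hf hg hphi; have [r i] := bessel_add U2 Ul hf hg hphi.
rewrite /dev r i; set a := bessel_re _ _ _; set b := bessel_re _ _ _.
set a' := bessel_im _ _ _; set b' := bessel_im _ _ _.
have := sqr_ge0 (a - b); have := sqr_ge0 (a' - b'); rewrite !expr2; nra.
Qed.

End Restriction.

(** * The L^oo to BMO bound for a scalar operator *)

Section ScalarBMO.
Context {R : realType} {n : nat}.
Variables (mu : {sigma_finite_measure set 'rV[R]_n -> \bar R}).
Variables (lam : 'rV[R]_n -> R -> R) (C C' beta : R).
Hypothesis ud : upper_doubling mu lam C C'.
Hypothesis beta_gt0 : 0 < beta.
Local Notation X := 'rV[R]_n.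
Variables (w v : grid n) (u : cube n -> X -> R).
Hypothesis hu : haar_system mu w u.
Variables (U : (X -> R[i]) -> X -> R[i]) (A : R).
Hypothesis U2 : forall f, CL mu 2%:E f -> CL mu 2%:E (U f).
Hypothesis Ulin : linear_on_L2 mu U.
Hypothesis UA : (CZnorm mu lam beta U < A%:E)%E.

(** The three terms of [CZnorm] are nonnegative, so a nearly optimal version of the kernel has
    regularity constant at most A, and the operator norm is below A. *)
Let CZ_data : (opnorm mu U < A%:E)%E /\ exists k c, [/\ is_kernel mu U k, 0 <= c <= A &
  forall x x' y, 2 * `|x - x'| < `|x - y| ->
      cmod (k x y - k x' y) <=
        c * (`|x - x'| / `|x - y|) `^ beta / lam x `|x - y|].
Proof.
have [_ [k kk <-]] := ereal_inf_lt UA.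
set a := opnorm mu U; set s := size_const lam k; set g := regularity_const lam beta k.
have a0 : (0 <= a)%E by apply/ereal_infP => _ [M [M0 _] <-]; rewrite lee_fin.
have s0 : (0 <= s)%E by apply/ereal_infP => _ [M [M0 _] <-]; rewrite lee_fin.
have g0 : (0 <= g)%E by apply/ereal_infP => _ [M [M0 _] <-]; rewrite lee_fin.
move=> lt; split.
  by apply: le_lt_trans lt; rewrite -addeA leeDl// adde_ge0.
have : (g < A%:E)%E by apply: le_lt_trans lt; rewrite leeDr// adde_ge0.
move=> /ereal_inf_lt[_ [c [c0 hc] <-]]; rewrite lte_fin => cA.
by exists k, c; rewrite c0 ltW.
Qed.

Let A0 : 0 <= A.
Proof. by have [_ [k [c [_ /andP[c0 cA] _]]]] := CZ_data; exact: le_trans cA. Qed.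

(** [kernel_estimate] for k(x, y) g(y), indexed by the two components. Separation turns the power of
    l(I) over the distance into decay in the gap, and the L^1 norm of u_I gives the measure of I. *)
Lemma far_part_estimate (g : X -> R[i]) (B N : R) (I V : cube n) :
  Cmeasurable g -> (forall y, cmod (g y) <= B) -> (forall y, N < `|y| -> g y = 0) ->
  sep R w v I V -> (forall y, cset v V y -> g y = 0) ->
  dev mu (U g) (u I) <=
    (kernel_const C C' beta * (A * B)) ^+ 2 * (decay beta ^+ gap I V * fine (mu (cset w I))).
Proof.
move=> mg gB gN sp gV; have [le IV far] := sp.
have [_ [k [c [kk /andP[c0 cA] reg]]]] := CZ_data.
have B0 : 0 <= B by exact: le_trans (cmod_ge0 (g 0)) (gB 0).
pose G : set X := [set y | ~ cset v V y /\ `|y| <= N].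
have gG y : ~ G y -> g y = 0.
  move=> nG; case: (pselect (cset v V y)) => Vy; first exact: gV.
  by apply: gN; rewrite ltNge; apply/negP => h; apply: nG.
have g2 : CL mu 2%:E g.
  apply/CL2P; pose S : set X := [set y | `|0 - y| < N + 1].
  have mS : measurable S by exact: ball_meas.
  have Sy := bounded_lty ud mS (fun y (h : S y) => h).
  apply: (bounded_csqi mS Sy mg gB _).1 => y /= /negP; rewrite -leNgt sub0r normrN => h.
  by apply: gN; lra.
have kern (h : X -> R) : sqi mu h -> (forall x, ~ cset w I x -> h x = 0) ->
    let Kf := fun p : X * X => (h p.1)%:C%C * (k p.1 p.2 * g p.2) in
    Cintegrable (mu \x mu)%E Kf /\
    pairing mu (fun x => (h x)%:C%C) (U g) = Cintegral (mu \x mu)%E Kf.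
  move=> hh h0; apply: (kk (near_ball w I) (far_box w I V N)).
  - exact: near_ball_compact.
  - exact: far_box_compact.
  - exact: near_far_disj.
  - by apply/CL2P; exact: real_csqi.
  - exact: g2.
  - by move=> x nx; rewrite h0// => Ix; apply: nx; exact: sub_near_ball.
  - move=> y ny; apply: gG => -[Vy yN]; apply: ny; exact: (sub_far_box sp).
have [ci pe] := kern (u I) (hs_sqi hu I) (@hs_supp _ _ _ _ _ hu I).
have i0 (x : X) : ~ cset w I x -> (\1_(cset w I) x : R) = 0.
  by move=> nx; rewrite indicE memNset.
(* The same representation with the indicator of I in place of u_I supplies the integrable sections
   among which the base point is chosen. *)
have [ci1 _] := kern _ (sqi_indic (cset_meas w I) (cset_lty ud w I)) i0.
pose kap (c : bool) (p : X * X) := part c (k p.1 p.2 * g p.2).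
have [M hM] := sep_far N sp.
have l0 := ltW (side_gt0 (R := R) I).
have d0 := sepdist_gt0 (R := R) I V.
have ld := sepdist_ge (R := R) le.
have -> : dev mu (U g) (u I) =
    \sum_c (\int[(mu \x mu)%E]_p (u I p.1 * kap c p)) ^+ 2.
  rewrite dev_pairing; apply: eq_bigr => i _; rewrite pairingC pe Cintegral_part.
  by congr (_ ^+ 2); apply: rintegral_ext => p; rewrite part_realM.
have est : forall x x' y, cset w I x -> cset w I x' -> G y ->
  \sum_j (kap j (x, y) - kap j (x', y)) ^+ 2 <=
  (A * B * ((`|x - x'| / `|x - y|) `^ beta / lam x `|x - y|)) ^+ 2.
  move=> x x' y Ix Ix' [Vy yN].
  rewrite (eq_bigr (fun j => part j ((k x y - k x' y) * g y) ^+ 2)); last first.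
    by move=> j _; rewrite /kap /= mulrBl partB.
  have xy := far x y Ix Vy; have xx := cset_dist Ix Ix'.
  have xy0 : 0 < `|x - y| by exact: lt_le_trans d0 xy.
  have lx := lam_gt0 ud x xy0.
  rewrite sum_part_sqr cmodM ler_sqr ?nnegrE ?mulr_ge0 ?cmod_ge0 ?powR_ge0 ?invr_ge0 ?(ltW lx)//.
  have q0 : 0 <= (`|x - x'| / `|x - y|) `^ beta / lam x `|x - y|.
    by rewrite divr_ge0 ?powR_ge0 ?(ltW lx).
  rewrite mulrAC; apply: ler_pM; rewrite ?cmod_ge0//.
  apply: (@le_trans _ _ (c * ((`|x - x'| / `|x - y|) `^ beta / lam x `|x - y|))).
    by rewrite mulrA; apply: reg; have := side_gt0 (R := R) I; rewrite -/(sepdist _ _) in xy; lra.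
  exact: ler_wpM2r.
have := @kernel_estimate _ _ mu lam C C' beta ud beta_gt0 _ kap (cset w I) G (u I)
  (side R I) (sepdist I V) (A * B) M (cset_meas w I) (cset_lty ud w I)
  (hs_sqi hu I) (@hs_supp _ _ _ _ _ hu I) (hs_int0 hu I) _ _ l0 d0 ld (mulr_ge0 A0 B0)
  (fun x x' Ix Ix' => cset_dist Ix Ix') _ _ est.
move=> /(_ _ _ _ _)/le_trans; apply.
- move=> j; have := Cintegrable_part j ci; congr (rint _ _).
  by apply/funext => p; rewrite part_realM.
- move=> j; have := Cintegrable_part j ci1; congr (rint _ _).
  by apply/funext => p; rewrite part_realM.
- by move=> x y Ix [Vy yN]; exact: hM.
- by move=> j x y Ix nG; rewrite /kap /= gG// mulr0 part0.
rewrite -mulrA exprMn ler_wpM2l ?sqr_ge0// exprMn; apply: ler_pM; rewrite ?sqr_ge0//.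
  exact: sep_decay.
exact: (hs_l1 ud I hu).
Qed.

Definition bmo_const : R := 2 + 2 * (kernel_const C C' beta ^+ 2 * (1 - decay beta)^-1).

(** On V the L^2 bound and Bessel's inequality apply; off V each cube gains its gap to V, and
    [carleson_depth] sums the gains. The factors 2 in [bmo_const] come from (a + b)^2 <= 2 a^2 + 2
    b^2. *)
Lemma scalar_bmo (g : X -> R[i]) (B N : R) (s : seq (cube n)) (V : cube n) :
  Cmeasurable g -> (forall y, cmod (g y) <= B) -> (forall y, N < `|y| -> g y = 0) ->
  uniq s -> (forall J, J \in s -> sep R w v J V) ->
  \sum_(J <- s) dev mu (U g) (u J) <= bmo_const * (A * B) ^+ 2 * fine (mu (cset v V)).
Proof.
move=> mg gB gN us hs.
have mV : measurable (cset v V : set X) := cset_meas v V.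
have Vy := cset_lty ud v V.
pose g1 := cres g (cset v V); pose g2 := cres g (~` cset v V).
have [h1 n1] : csqi mu g1 /\ sqn mu g1 <= B ^+ 2 * fine (mu (cset v V)).
  apply: bounded_csqi => //.
  - exact: cres_measurable.
  - exact: cres_bound.
  - by move=> x nx; exact: cres_out.
have mg2 : Cmeasurable g2 by apply: cres_measurable => //; exact: measurableC.
have g2N y : N < `|y| -> g2 y = 0 by move=> yN; rewrite /g2 /cres gN// mul0r.
have h2 : csqi mu g2.
  pose S : set X := [set y | `|0 - y| < N + 1].
  have mS : measurable S by exact: ball_meas.
  have Sy := bounded_lty ud mS (fun y (h : S y) => h).
  apply: (bounded_csqi mS Sy mg2 (cres_bound _ gB) _).1 => y /= /negP.
  by rewrite -leNgt sub0r normrN => h; apply: g2N; lra.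
have term J : dev mu (U g) (u J) <= 2 * dev mu (U g1) (u J) + 2 * dev mu (U g2) (u J).
  rewrite -[in leLHS](cres_split g (cset v V)).
  by apply: dev_add => //; exact: hs_sqi hu J.
apply: (le_trans (ler_sum _ (fun J _ => term J))).
rewrite big_split /= -!mulr_sumr.
have [op _] := CZ_data.
have b1 : \sum_(J <- s) dev mu (U g1) (u J) <= (A * B) ^+ 2 * fine (mu (cset v V)).
  apply: (@le_trans _ _ (sqn mu (U g1))).
    apply: complex_bessel => //; first exact: U_csqi.
    - by move=> J; exact: hs_sqi hu J.
    - by move=> J; exact: hs_norm hu J.
    - by move=> I J _ _; exact: hs_orth hu I J.
  apply: le_trans (opnorm_sqn op h1 (U_csqi U2 h1)) _.
  by rewrite exprMn -[leRHS]mulrA; apply: ler_wpM2l => //; exact: sqr_ge0.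
have b2 : \sum_(J <- s) dev mu (U g2) (u J) <= (kernel_const C C' beta * (A * B)) ^+ 2 *
    ((1 - decay beta)^-1 * fine (mu (cset v V))).
  apply: (@le_trans _ _ (\sum_(J <- s) (kernel_const C C' beta * (A * B)) ^+ 2 *
      (decay beta ^+ gap J V * fine (mu (cset w J))))).
    rewrite !big_seq; apply: ler_sum => J Js; apply: (far_part_estimate mg2 _ g2N).
    - exact: cres_bound.
    - exact: hs.
    - by move=> y yV; apply: cres_out => /(_ yV).
  rewrite -mulr_sumr ler_wpM2l ?sqr_ge0//; apply: (carleson_depth ud us).
    by have /andP[/ltW -> ->] := decay_bounds beta_gt0.
  by move=> J /hs[].
apply: (le_trans (lerD (ler_wpM2l (ler0n _ 2) b1) (ler_wpM2l (ler0n _ 2) b2))).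
rewrite /bmo_const; move: (_^-1) (fine _) (kernel_const _ _ _) => q m k.
rewrite le_eqVlt; apply/orP; left; apply/eqP; ring.
Qed.

End ScalarBMO.

(** * The operator-valued kernel tested on a single cube I *)

Section VectorEstimate.
Context {R : realType} {n1 n2 : nat}.
Local Notation X1 := 'rV[R]_n1.
Local Notation X2 := 'rV[R]_n2.
Variables (mu1 : {sigma_finite_measure set X1 -> \bar R}).
Variables (mu2 : {sigma_finite_measure set X2 -> \bar R}).
Variables (lam1 : X1 -> R -> R) (lam2 : X2 -> R -> R) (C1 C1' C2 C2' alpha beta CK : R).
Hypothesis ud1 : upper_doubling mu1 lam1 C1 C1'.
Hypothesis ud2 : upper_doubling mu2 lam2 C2 C2'.
Hypotheses (alpha_gt0 : 0 < alpha) (beta_gt0 : 0 < beta).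
Local Notation mm := (mu1 \x mu2)%E.
Variables (T : (X1 * X2 -> R[i]) -> X1 * X2 -> R[i]).
Variable T1 : X1 -> X1 -> (X2 -> R[i]) -> X2 -> R[i].
Hypothesis Tzero : forall phi c, sqi mm phi ->
  part c (pairing mm (T (fun=> 0)) (fun x => (phi x)%:C%C)) = 0.
Hypothesis vcz : vector_CZ mu1 mu2 lam1 lam2 alpha beta CK T T1.
Variables (w1 v1 : grid n1) (w2 v2 : grid n2).
Variables (h : cube n1 -> X1 -> R) (u : cube n2 -> X2 -> R).
Hypothesis hh : haar_system mu1 w1 h.
Hypothesis hu : haar_system mu2 w2 u.

(** [scalar_bmo] asks for a strict bound on [CZnorm]; this one is also positive whatever the sign of
    CK. *)
Definition CKp : R := `|CK| + 1.

Definition vector_const : R :=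
  kernel_const C1 C1' alpha ^+ 2 * (bmo_const C2 C2' beta * CKp ^+ 2).

Let CKp_gt0 : 0 < CKp. Proof. by rewrite ltr_pwDr. Qed.

Let CK_lt : CK < CKp. Proof. by rewrite (le_lt_trans (ler_norm CK))// ltrDl. Qed.

Lemma bmo_const_ge0 : 0 <= bmo_const C2 C2' beta.
Proof.
have /andP[_ d1] := decay_bounds beta_gt0.
by rewrite addr_ge0// mulr_ge0// mulr_ge0 ?sqr_ge0// invr_ge0 subr_ge0 ltW.
Qed.

Lemma vector_const_ge0 : 0 <= vector_const.
Proof. by rewrite mulr_ge0 ?sqr_ge0// mulr_ge0 ?sqr_ge0// bmo_const_ge0. Qed.

Definition bounded_box (f : X1 * X2 -> R[i]) (B N : R) : Prop :=
  [/\ Cmeasurable f, forall x, cmod (f x) <= B &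
      forall x, N < `|x.1| \/ N < `|x.2| -> f x = 0].

Lemma bounded_box_csqi f B N : bounded_box f B N -> csqi mm f.
Proof.
move=> [mf fB fN].
pose S1 : set X1 := [set y | `|0 - y| < N + 1].
pose S2 : set X2 := [set y | `|0 - y| < N + 1].
have mS1 : measurable S1 by exact: ball_meas.
have mS2 : measurable S2 by exact: ball_meas.
have S1y := bounded_lty ud1 mS1 (fun y (h : S1 y) => h).
have S2y := bounded_lty ud2 mS2 (fun y (h : S2 y) => h).
have Sy : (mm (S1 `*` S2) < +oo)%E.
  by rewrite product_measure1E// lte_mul_pinfty// ge0_fin_numE.
apply: (bounded_csqi (measurableX mS1 mS2) Sy mf fB _).1 => -[x y] nS.
apply: fN => /=; case: (leP `|x| N) => hx; last by left.
right; rewrite ltNge; apply/negP => hy; apply: nS.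
by split; rewrite /S1 /S2 /= sub0r normrN; lra.
Qed.

Lemma section_measurable (f : X1 * X2 -> R[i]) x : Cmeasurable f ->
  Cmeasurable (fun y => f (x, y)).
Proof.
by move=> [mr mi]; split;
  [exact: (measurableT_comp mr (measurable_pair1 x))|
   exact: (measurableT_comp mi (measurable_pair1 x))].
Qed.

Let real_linear (t : R) (phi F : _ -> R) : rint mu2 (fun x => F x * phi x) ->
  \int[mu2]_x (F x * (t * phi x)) = t * \int[mu2]_x (F x * phi x).
Proof.
by move=> iF; rewrite -rintegralZ//; apply: rintegral_ext => x; rewrite mulrCA.
Qed.

Variables (f : X1 * X2 -> R[i]) (B N : R).
Hypothesis fbox : bounded_box f B N.

Let sec y : X2 -> R[i] := fun z => f (y, z).

Let sec_csqi y : csqi mu2 (sec y).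
Proof.
have [mf fB fN] := fbox.
pose S2 : set X2 := [set y | `|0 - y| < N + 1].
have mS2 : measurable S2 by exact: ball_meas.
have S2y := bounded_lty ud2 mS2 (fun y (h : S2 y) => h).
have ms : Cmeasurable (sec y) by exact: section_measurable.
apply: (bounded_csqi mS2 S2y ms _ _).1; first by move=> x; exact: fB.
move=> z /negP; rewrite -leNgt sub0r normrN => hz.
by apply: fN; right => /=; lra.
Qed.

Variables (I K : cube n1) (V : cube n2) (s : seq (cube n2)).
Hypothesis fK : forall x, cset v1 K x.1 -> f x = 0.
Hypothesis sI : sep R w1 v1 I K.
Hypothesis us : uniq s.
Hypothesis sJ : forall J, J \in s -> sep R w2 v2 J V.

Let inner c J (p : X1 * X1) (g : X2 -> R[i]) : R :=
  \int[mu2]_x (part c (T1 p.1 p.2 g x) * u J x).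

(* [T1 x x] is arbitrary and the diagonal may have positive measure: subtracting
   the contribution of the zero function removes it. *)
Let kap (j : 'I_(size s) * bool) (p : X1 * X1) : R :=
  inner j.2 (nth V s j.1) p (sec p.2) - inner j.2 (nth V s j.1) p (fun=> 0).

Let sum_ord_bool (F : cube n2 -> bool -> R) :
  \sum_(j : 'I_(size s) * bool) F (nth V s j.1) j.2 = \sum_(J <- s) \sum_c F J c.
Proof. by rewrite (big_nth V) big_mkord pair_bigA. Qed.

(** Used for phi = h_I and for the indicator of I. The correction term integrates to a pairing with
    T 0, hence to 0. Where the two first coordinates coincide inside I, the two terms of k agree
    because f vanishes over K, which contains I. *)
Let phi_box (phi : X1 -> R) J c : sqi mu1 phi -> (forall x, ~ cset w1 I x -> phi x = 0) ->
  let k p := inner c J p (sec p.2) - inner c J p (fun=> 0) in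
  rint (mu1 \x mu1)%E (fun p => phi p.1 * k p) /\
  part c (pairing mm (T f) (fun x => (phi x.1 * u J x.2)%:C%C)) =
    \int[(mu1 \x mu1)%E]_p (phi p.1 * k p).
Proof.
move=> hphi phi0 k; have [vk czT _ _] := vcz; have [le IK far] := sI.
have [mf fB fN] := fbox.
pose Phi (x : X1 * X2) : R[i] := (phi x.1 * u J x.2)%:C%C.
have sPhi : sqi mm (fun x => phi x.1 * u J x.2) by exact: (sqi_prod hphi (hs_sqi hu J)).
have zero : csqi mm (fun=> 0 : R[i]) by split; exact: sqi0.
have hPhi : CL mm 2%:E Phi by apply/CL2P; exact: real_csqi.
have ker (Psi : X1 * X2 -> R[i]) : csqi mm Psi ->
    (forall y, ~ far_box w1 I K N y.1 -> Psi y = 0) ->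
    rint (mu1 \x mu1)%E (fun p => \int[mu2]_x
      (part c (T1 p.1 p.2 (fun y => Psi (p.2, y)) x) * (phi p.1 * u J x))) /\
    part c (pairing mm (T Psi) Phi) = \int[(mu1 \x mu1)%E]_p \int[mu2]_x
      (part c (T1 p.1 p.2 (fun y => Psi (p.2, y)) x) * (phi p.1 * u J x)).
  move=> /CL2P hPsi Psi0.
  have [|||||ci pe] := vk (near_ball w1 I) (far_box w1 I K N) Phi Psi _ _ _ hPhi hPsi.
  - exact: near_ball_compact.
  - exact: far_box_compact.
  - exact: near_far_disj.
  - move=> x nx; rewrite /Phi phi0 ?mul0r// => Ix; apply: nx; exact: sub_near_ball.
  - exact: Psi0.
  rewrite pairingC pe Cintegral_part; split.
    have := Cintegrable_part c ci; congr (rint _ _); apply/funext => p.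
    by rewrite pairingC pairing_part.
  by apply: rintegral_ext => p; rewrite pairingC pairing_part.
have [|i1 e1] := ker f (bounded_box_csqi fbox).
  move=> -[y z] /= ny; case: (pselect (cset v1 K y)) => Ky; first exact: fK.
  apply: fN; left; rewrite /= ltNge; apply/negP => yN; apply: ny.
  exact: (sub_far_box sI).
have [i2 e2] := ker _ zero (fun _ _ => erefl).
have pt p : phi p.1 * k p =
    \int[mu2]_x (part c (T1 p.1 p.2 (fun y => f (p.2, y)) x) * (phi p.1 * u J x)) -
    \int[mu2]_x (part c (T1 p.1 p.2 (fun=> 0) x) * (phi p.1 * u J x)).
  case: (pselect (cset w1 I p.1)) => Ip; last first.
    rewrite phi0// mul0r [X in _ = X - _](@rintegral_ext _ _ _ _ (fun=> 0)); last first.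
      by move=> x; rewrite mul0r mulr0.
    rewrite [X in _ = _ - X](@rintegral_ext _ _ _ _ (fun=> 0)); last first.
      by move=> x; rewrite mul0r mulr0.
    by rewrite subrr.
  have [pp|npp] := eqVneq p.1 p.2.
    have -> : (fun y => f (p.2, y)) = (fun=> 0).
      by apply/funext => z; apply: fK => /=; rewrite -pp; exact: IK.
    rewrite subrr /k /inner.
    have -> : sec p.2 = (fun=> 0).
      by apply/funext => z; apply: fK => /=; rewrite -pp; exact: IK.
    by rewrite subrr mulr0.
  have [[U2 _ _] _] := czT _ _ npp.
  have pi c' g : csqi mu2 g -> rint mu2 (fun x => part c' (T1 p.1 p.2 g x) * u J x).
    move=> /(U_csqi U2) hg; have [] := csqi_rint hg (hs_sqi hu J).
    by case: c'.
  have z2 : csqi mu2 (fun=> 0 : R[i]) by split; exact: sqi0.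
  rewrite !real_linear ?mulrBr//; [exact: pi|exact: pi (sec_csqi _)].
split.
  by under eq_fun do rewrite pt; exact: rintB.
under rintegral_ext do rewrite pt.
rewrite rintegralB// -e1 -e2.
by rewrite [X in _ - X](_ : _ = 0) ?subr0//; exact: Tzero.
Qed.

(** The difference of T_1(x, y) and T_1(x', y) is a scalar operator whose [CZnorm] is below CKp q,
    where q is the last factor of the bound. [scalar_bmo], applied to it and to the section f(y, .),
    sums over all J in V at once. *)
Let est x x' y : cset w1 I x -> cset w1 I x' -> ~ cset v1 K y -> `|y| <= N ->
  \sum_j (kap j (x, y) - kap j (x', y)) ^+ 2 <=
   (CKp * B * Num.sqrt (bmo_const C2 C2' beta * fine (mu2 (cset v2 V))) *
     ((`|x - x'| / `|x - y|) `^ alpha / lam1 x `|x - y|)) ^+ 2.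
Proof.
move=> Ix Ix' Ky yN; have [vk czT _ reg] := vcz; have [le IK far] := sI.
have [mf fB fN] := fbox.
(* For x = x' the factor q is 0, and no strict bound by CKp q can hold. *)
have [->|xx'] := eqVneq x x'.
  by rewrite big1 ?sqr_ge0// => j _; rewrite subrr expr0n.
have xy : x != y by apply/eqP => E; apply: Ky; rewrite -E; exact: IK.
have x'y : x' != y by apply/eqP => E; apply: Ky; rewrite -E; exact: IK.
have [[U2 Ul _] _] := czT _ _ xy; have [[U2' Ul' _] _] := czT _ _ x'y.
pose D g z := T1 x y g z - T1 x' y g z.
have D2 g : CL mu2 2%:E g -> CL mu2 2%:E (D g).
  move=> hg; have /CL2P[a1 a2] := U2 _ hg; have /CL2P[b1 b2] := U2' _ hg.
  apply/CL2P; split.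
    have := sqiB a1 b1; congr (sqi _ _); apply/funext => z /=; exact/esym/(partB false).
  have := sqiB a2 b2; congr (sqi _ _); apply/funext => z /=; exact/esym/(partB true).
have Dl : linear_on_L2 mu2 D.
  move=> a g g' hg hg'; have E1 := Ul a g g' hg hg'; have E2 := Ul' a g g' hg hg'.
  by apply: filterS2 E1 E2 => z e1 e2; rewrite /D e1 e2; ring.
have d0 : 0 < `|x - y| by rewrite normr_gt0 subr_eq0.
have lx := lam_gt0 ud1 x d0.
pose q := (`|x - x'| / `|x - y|) `^ alpha / lam1 x `|x - y|.
have q0 : 0 < q.
  by rewrite divr_gt0// powR_gt0// divr_gt0// normr_gt0 subr_eq0.
have DA : (CZnorm mu2 lam2 beta D < (CKp * q)%:E)%E.
  apply: le_lt_trans (reg x x' y _) _.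
    have := far x y Ix Ky; have := cset_dist Ix Ix'; have := side_gt0 (R := R) I.
    have := sepdist_ge (R := R) le; rewrite /sepdist; lra.
  by rewrite lte_fin -mulrA ltr_pM2r.
have kapE j : kap j (x, y) - kap j (x', y) =
    \int[mu2]_z (part j.2 (D (sec y) z) * u (nth V s j.1) z).
  have ext c J x0 : (forall g, CL mu2 2%:E g -> CL mu2 2%:E (T1 x0 y g)) ->
     linear_on_L2 mu2 (T1 x0 y) ->
     inner c J (x0, y) (fun=> 0) = 0 /\
     rint mu2 (fun z => part c (T1 x0 y (sec y) z) * u J z).
    move=> W2 Wl; have [z1 z2] := bessel0 W2 Wl (hs_sqi hu J).
    have [r1 r2] := csqi_rint (U_csqi W2 (sec_csqi y)) (hs_sqi hu J).
    by case: c.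
  have [z1 r1] := ext j.2 (nth V s j.1) x U2 Ul.
  have [z2 r2] := ext j.2 (nth V s j.1) x' U2' Ul'.
  rewrite /kap z1 z2 !subr0 /inner -rintegralB//.
  by apply: rintegral_ext => z; rewrite /D partB mulrBl.
rewrite (eq_bigr (fun j : 'I_(size s) * bool => (\int[mu2]_z (part j.2 (D (sec y) z) * u (nth V s j.1) z)) ^+ 2));
  last by move=> j _; rewrite kapE.
rewrite (sum_ord_bool (fun J c => (\int[mu2]_z (part c (D (sec y) z) * u J z)) ^+ 2)).
have b0 := bmo_const_ge0.
rewrite -/q mulrAC exprMn sqr_sqrtr; last by rewrite mulr_ge0// fine_ge0.
have := scalar_bmo ud2 beta_gt0 hu D2 Dl DA (section_measurable y mf)
  (fun z => fB (y, z)) (fun z zN => fN (y, z) (or_intror zN)) us sJ.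
move=> le2; apply: (le_trans _ (le_trans le2 _)).
  rewrite le_eqVlt; apply/orP; left; apply/eqP; apply: eq_bigr => J _.
  by rewrite /dev /bessel_re /bessel_im big_bool addrC.
rewrite le_eqVlt; apply/orP; left; apply/eqP.
by move: (bmo_const _ _ _) (fine _) => b m; ring.
Qed.

(** [kernel_estimate] with the cubes J and the two components as indices; the BMO bound over V
    enters through its constant E. *)
Lemma vector_estimate :
  \sum_(J <- s) dev mm (T f) (fun x => h I x.1 * u J x.2) <=
  vector_const * B ^+ 2 * (decay alpha ^+ gap I K * fine (mu1 (cset w1 I))) *
    fine (mu2 (cset v2 V)).
Proof.
have [le IK far] := sI; have [mf fB fN] := fbox.
have B0 : 0 <= B by exact: le_trans (cmod_ge0 (f 0)) (fB 0).
have [M hM] := sep_far N sI.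
have l0 := ltW (side_gt0 (R := R) I).
have d0 := sepdist_gt0 (R := R) I K.
have ld := sepdist_ge (R := R) le.
pose G : set X1 := [set y | ~ cset v1 K y /\ `|y| <= N].
set S := Num.sqrt (bmo_const C2 C2' beta * fine (mu2 (cset v2 V))).
have E0 : 0 <= CKp * B * S by rewrite !mulr_ge0 ?sqrtr_ge0// ltW.
have i0 (x : X1) : ~ cset w1 I x -> (\1_(cset w1 I) x : R) = 0.
  by move=> nx; rewrite indicE memNset.
have pb J c := phi_box J c (hs_sqi hh I) (@hs_supp _ _ _ _ _ hh I).
have pb1 J c := phi_box J c (sqi_indic (cset_meas w1 I) (cset_lty ud1 w1 I)) i0.
have -> : \sum_(J <- s) dev mm (T f) (fun x => h I x.1 * u J x.2) =
    \sum_j (\int[(mu1 \x mu1)%E]_p (h I p.1 * kap j p)) ^+ 2.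
  rewrite (sum_ord_bool (fun J c => (\int[(mu1 \x mu1)%E]_p
    (h I p.1 * (inner c J p (sec p.2) - inner c J p (fun=> 0)))) ^+ 2)).
  apply: eq_bigr => J _; rewrite dev_pairing; apply: eq_bigr => c _.
  by have [_ ->] := pb J c.
have := @kernel_estimate _ _ mu1 lam1 C1 C1' alpha ud1 alpha_gt0 _ kap (cset w1 I) G (h I)
  (side R I) (sepdist I K) (CKp * B * S) M (cset_meas w1 I) (cset_lty ud1 w1 I)
  (hs_sqi hh I) (@hs_supp _ _ _ _ _ hh I) (hs_int0 hh I) _ _ l0 d0 ld E0
  (fun x x' Ix Ix' => cset_dist Ix Ix') _ _ _.
move=> /(_ _ _ _ _ _)/le_trans; apply.
- by move=> j; have [] := pb (nth V s j.1) j.2.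
- by move=> j; have [] := pb1 (nth V s j.1) j.2.
- by move=> x y Ix [Ky yN]; exact: hM.
- move=> j x y Ix nG; rewrite /kap /=.
  have -> : sec y = (fun=> 0).
    apply/funext => z; case: (pselect (cset v1 K y)) => Ky; first exact: fK.
    apply: fN; left; rewrite /= ltNge; apply/negP => yN; exact: nG.
  by rewrite subrr.
- by move=> x x' y Ix Ix' [Ky yN]; exact: est.
rewrite /vector_const.
have hl1 := hs_l1 ud1 I hh; have sd := sep_decay (R := R) alpha_gt0 le.
have S2 : S ^+ 2 = bmo_const C2 C2' beta * fine (mu2 (cset v2 V)).
  by rewrite sqr_sqrtr// mulr_ge0 ?bmo_const_ge0// fine_ge0.
set k := kernel_const _ _ _; set D := (_ / _) `^ alpha; set H := \int[mu1]_x _.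
have -> : (k * (CKp * B * S) * D * H) ^+ 2 =
   (k ^+ 2 * (bmo_const C2 C2' beta * CKp ^+ 2) * B ^+ 2 * fine (mu2 (cset v2 V))) *
     (D ^+ 2 * H ^+ 2).
  rewrite !exprMn S2; ring.
rewrite [leRHS]mulrAC; apply: ler_wpM2l.
  have b0 := bmo_const_ge0; have m0 : 0 <= fine (mu2 (cset v2 V)) by exact: fine_ge0.
  by rewrite mulr_ge0// mulr_ge0 ?sqr_ge0// mulr_ge0 ?sqr_ge0// mulr_ge0 ?sqr_ge0.
by apply: ler_pM; rewrite ?sqr_ge0.
Qed.

End VectorEstimate.

Lemma seq_argmin (T : eqType) (f : T -> int) (s : seq T) x0 : x0 \in s ->
  exists2 m, m \in s & forall y, y \in s -> f m <= f y.
Proof.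
elim: s x0 => // q s IH x0 _; case: s IH => [_|q' s IH].
  by exists q; [exact: mem_head|move=> y; rewrite inE => /eqP ->].
have [m ms hm] := IH q' (mem_head q' s).
have [le|/ltW le] := leP (f q) (f m).
  exists q; first exact: mem_head.
  by move=> y; rewrite inE => /predU1P[->//|/hm]; exact: le_trans.
exists m; first by rewrite inE ms orbT.
by move=> y; rewrite inE => /predU1P[->//|/hm].
Qed.

(** * Maximal cubes and the one-parameter weak type bound *)

Section CubeFamilies.
Context {R : realType} {n : nat}.
Variables (mu : {sigma_finite_measure set 'rV[R]_n -> \bar R}).
Variables (lam : 'rV[R]_n -> R -> R) (C C' : R).
Hypothesis ud : upper_doubling mu lam C C'.
Variable w : grid n.
Implicit Types (s : seq (cube n)) (V W : cube n).

Definition cubesU s : set 'rV[R]_n := [set x | exists2 V, V \in s & cset w V x].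

Lemma cubesU_meas s : measurable (cubesU s).
Proof.
have -> : cubesU s = \bigcup_(V in [set` s]) cset w V.
  by rewrite eqEsubset; split => x [V Vs Vx]; exists V.
by apply: fin_bigcup_measurable => // V _; exact: cset_meas.
Qed.

Lemma cubesU_lty s : (mu (cubesU s) < +oo)%E.
Proof.
elim: s => [|V s IH].
  rewrite (_ : cubesU [::] = set0) ?measure0// -subset0.
  by move=> x [].
rewrite (_ : cubesU (V :: s) = cset w V `|` cubesU s).
  apply: le_lt_trans (measureU2 mu (cset_meas w V) (cubesU_meas s)) _.
  by rewrite lte_add_pinfty//; exact: cset_lty ud _ _.
rewrite eqEsubset; split => x.
  by move=> [W]; rewrite inE => /predU1P[->|Ws] Wx; [left|right; exists W].
by move=> [Vx|[W Ws Wx]]; [exists V; rewrite ?mem_head|exists W; rewrite ?inE ?Ws ?orbT].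
Qed.

Definition topmost s V : cube n :=
  foldr (fun W acc => if (gen W < gen acc)%R && dsub R w V W then W else acc) V s.

Lemma topmost_dsub s V : dsub R w V (topmost s V).
Proof.
elim: s => [|W s IH] /=; first exact: dsub_refl.
by case: ifP => // /andP[].
Qed.

Lemma topmost_in s V : V \in s -> topmost s V \in s.
Proof.
have aux t : topmost t V = V \/ topmost t V \in t.
  elim: t => [|W t IH] /=; first by left.
  case: ifP => _; first by right; rewrite mem_head.
  by case: IH => [->|IH]; [left|right; rewrite inE IH orbT].
by case: (aux s) => [->|].
Qed.

Lemma topmost_min s V W : W \in s -> dsub R w V W -> gen (topmost s V) <= gen W.
Proof.
elim: s => // U s IH; rewrite inE => /predU1P[->|Ws] VW /=.
  case: ifP => // /negbT; rewrite VW andbT -leNgt //.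
case: ifP => [/andP[lt _]|_]; last exact: IH.
exact: le_trans (ltW lt) (IH Ws VW).
Qed.

(** Two maximal cubes that meet are nested. The larger one then contains the starting cube of the
    other, and minimality of the generation makes them equal. *)
Lemma topmost_eq s V V' x : V \in s -> V' \in s ->
  cset w (topmost s V) (x : 'rV[R]_n) -> cset w (topmost s V') x -> topmost s V = topmost s V'.
Proof.
wlog le : V V' / gen (topmost s V') <= gen (topmost s V).
  move=> W Vs Vs' h h'; have [le|/ltW le] := leP (gen (topmost s V')) (gen (topmost s V)).
    exact: W.
  by apply/esym; exact: W.
move=> Vs Vs' h h'; have VV' := dsubP le h h'.
apply: (cset_eq _ h h'); apply: le_anti; rewrite le andbT.
by apply: topmost_min; [exact: topmost_in|exact: dsub_trans (topmost_dsub s V) VV'].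
Qed.

(** The maximal cubes of s are pairwise disjoint, cover the union, and are each at least half filled
    by E. *)
Lemma weak_type s (E : set 'rV[R]_n) : measurable E -> (mu E < +oo)%E ->
  (forall W, W \in s -> fine (mu (cset w W)) <= 2 * fine (mu (cset w W `&` E))) ->
  fine (mu (cubesU s)) <= 2 * fine (mu E).
Proof.
move=> mE Ey hs; pose t := undup [seq topmost s W | W <- s].
have ts W : W \in t -> exists2 V, V \in s & W = topmost s V.
  by rewrite mem_undup => /mapP[V Vs ->]; exists V.
have mc W : measurable (cset w W : set 'rV[R]_n) := cset_meas w W.
have cy W := cset_lty ud w W.
have mI W : measurable (cset w W `&` E) by exact: measurableI.
have Iy W : (mu (cset w W `&` E) < +oo)%E.
  by apply: le_lt_trans Ey; apply: le_measure; rewrite ?inE//; exact: subIsetr.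
have iU := rint_indic (cubesU_meas s) (cubesU_lty s).
have step1 : fine (mu (cubesU s)) <= \sum_(W <- t) fine (mu (cset w W)).
  rewrite -(rintegral_indic mu (cubesU_meas s)).
  rewrite (eq_bigr (fun W => \int[mu]_x (\1_(cset w W) x : R))); last first.
    by move=> W _; rewrite rintegral_indic.
  rewrite -rintegral_sum; last by move=> W; exact: (rint_indic (mc W) (cy W)).
  apply: rintegral_le => //.
    by apply: rint_sum => W; exact: (rint_indic (mc W) (cy W)).
  move=> x; case: (indicP R (cubesU s) x) => -[Ux ->]; last by apply: sumr_ge0.
  have [V Vs Vx] := Ux.
  have Wt : topmost s V \in t by rewrite mem_undup; apply: map_f.
  rewrite (bigD1_seq (topmost s V)) ?undup_uniq//= indicE mem_set; last first.
    exact: (dsub_subset (topmost_dsub s V)).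
  by rewrite lerDl; apply: sumr_ge0.
have step2 : \sum_(W <- t) 2 * fine (mu (cset w W `&` E)) <= 2 * fine (mu E).
  apply: weighted_measure_le => // x.
  have [Ex|nEx] := pselect (E x); last first.
    rewrite big1 ?mulr_ge0// => W _; rewrite indicE memNset ?mulr0//.
    by move=> [_ /nEx].
  rewrite [X in _ <= _ * X]indicE mem_set// -mulr_sumr ler_pM2l//.
  have [[W Wt Wx]|none] := pselect (exists2 W, W \in t & cset w W x); last first.
    rewrite big1_seq// => W /andP[_ Wt]; rewrite indicE memNset// => -[Wx _].
    by apply: none; exists W.
  rewrite (bigD1_seq W) ?undup_uniq//= big1_seq ?addr0 => [|W' /andP[W'W W't]].
    by have /andP[] := indic01 R (cset w W `&` E) x.
  rewrite indicE memNset// => -[W'x _].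
  have [V Vs WE] := ts _ Wt; have [V' Vs' WE'] := ts _ W't.
  by case/negP: W'W; rewrite WE WE'; apply/eqP; apply: topmost_eq => //; rewrite -?WE -?WE'.
apply: (le_trans step1); apply: le_trans step2; rewrite !big_seq.
apply: ler_sum => W /ts[V Vs ->]; apply: hs; exact: topmost_in.
Qed.

End CubeFamilies.
Arguments topmost R {n} w s V.

(** * Unions of rectangles and Journe's lemma *)

Section Rectangles.
Context {R : realType} {n1 n2 : nat}.
Local Notation X1 := 'rV[R]_n1.
Local Notation X2 := 'rV[R]_n2.
Variables (mu1 : {sigma_finite_measure set X1 -> \bar R}).
Variables (mu2 : {sigma_finite_measure set X2 -> \bar R}).
Variables (lam1 : X1 -> R -> R) (lam2 : X2 -> R -> R) (C1 C1' C2 C2' : R).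
Hypothesis ud1 : upper_doubling mu1 lam1 C1 C1'.
Hypothesis ud2 : upper_doubling mu2 lam2 C2 C2'.
Variables (v1 : grid n1) (v2 : grid n2).
Local Notation mm := (mu1 \x mu2)%E.
Local Notation pairs := (seq (cube n1 * cube n2)).
Implicit Types (S : pairs) (K : cube n1) (V W : cube n2).

Definition rectsU S : set (X1 * X2) := [set x | exists2 p, p \in S & rect v1 v2 p x].

Lemma rect_meas p : measurable (rect v1 v2 p : set (X1 * X2)).
Proof. by apply: measurableX; exact: cset_meas. Qed.

Lemma rect_measure p : mm (rect v1 v2 p) = (mu1 (cset v1 p.1) * mu2 (cset v2 p.2))%E.
Proof. by apply: product_measure1E; exact: cset_meas. Qed.

Lemma rect_lty p : (mm (rect v1 v2 p) < +oo)%E.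
Proof.
have ly1 := cset_lty ud1 v1 p.1; have ly2 := cset_lty ud2 v2 p.2.
by rewrite rect_measure lte_mul_pinfty// ge0_fin_numE.
Qed.

Lemma rectsU_meas S : measurable (rectsU S).
Proof.
have -> : rectsU S = \bigcup_(p in [set` S]) rect v1 v2 p.
  by rewrite eqEsubset; split => x [p pS px]; exists p.
by apply: fin_bigcup_measurable => // p _; exact: rect_meas.
Qed.

Lemma rectsU_lty S : (mm (rectsU S) < +oo)%E.
Proof.
elim: S => [|p S IH].
  rewrite (_ : rectsU [::] = set0) ?measure0// -subset0.
  by move=> x [].
rewrite (_ : rectsU (p :: S) = rect v1 v2 p `|` rectsU S).
  apply: le_lt_trans (measureU2 mm (rect_meas p) (rectsU_meas S)) _.
  by rewrite lte_add_pinfty//; exact: rect_lty.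
rewrite eqEsubset; split => x.
  by move=> [q]; rewrite inE => /predU1P[->|qS] qx; [left|right; exists q].
by move=> [px|[q qS qx]]; [exists p; rewrite ?mem_head|exists q; rewrite ?inE ?qS ?orbT].
Qed.

Definition above S K : seq (cube n2) := [seq p.2 | p <- S & dsub R v1 K p.1].

Lemma aboveP S K V : reflect (exists2 K', (K', V) \in S & dsub R v1 K K') (V \in above S K).
Proof.
apply: (iffP mapP) => [[[K' V']]|[K' KS KK']].
  by rewrite mem_filter /= => /andP[KK' KS] ->; exists K'.
by exists (K', V) => //; rewrite mem_filter KK'.
Qed.

(** The slice over K of the overview: the y for which a single rectangle of S covers K x {y}. *)
Definition shadow S K : set X2 := cubesU v2 (above S K).

Lemma shadow_section S K (x : X1) (y : X2) : cset v1 K x -> shadow S K y -> rectsU S (x, y).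
Proof.
move=> Kx [V /aboveP[K' KS KK'] Vy]; exists (K', V) => //; split => //=.
exact: (dsub_subset KK').
Qed.

Lemma slice_rectsU S (x : X1) :
  xsection (rectsU S) x = cubesU v2 [seq p.2 | p <- S & `[< cset v1 p.1 x >]].
Proof.
rewrite eqEsubset; split => y.
  rewrite /xsection /= inE => -[[K V] KS [/= Kx Vy]]; exists V => //.
  by apply/mapP; exists (K, V) => //; rewrite mem_filter KS andbT; exact/asboolP.
move=> [V /mapP[[K V']]]; rewrite mem_filter => /andP[/asboolP Kx KS] /= -> Vy.
by rewrite /xsection /= inE; exists (K, V').
Qed.

(* Weak type (1,1), on each vertical slice, of the dyadic maximal function
   of the grid [v2] acting on the second variable only. *)
Lemma rectsU_weak_type S S' :
  (forall p, p \in S' -> fine (mu2 (cset v2 p.2)) <=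
      2 * fine (mu2 (cset v2 p.2 `&` shadow S p.1))) ->
  fine (mm (rectsU S')) <= 2 * fine (mm (rectsU S)).
Proof.
move=> hS'.
have ms T : measurable_fun setT (fun x => mu2 (xsection (rectsU T) x)).
  exact: (measurable_fun_xsection mu2 (rectsU_meas T)).
rewrite -lee_fin EFinM !fineK ?ge0_fin_numE ?rectsU_lty//.
rewrite /product_measure1 /= -ge0_integralZl//.
apply: ge0_le_integral => //=.
  by apply: emeasurable_funM => //; exact: measurable_cst.
move=> x _; rewrite !slice_rectsU.
set s := [seq p.2 | p <- S' & _]; set t := [seq p.2 | p <- S & _].
have fs := cubesU_lty ud2 v2 s; have ft := cubesU_lty ud2 v2 t.
have mt := cubesU_meas v2 t.
rewrite -[X in (X <= _)%E]fineK ?ge0_fin_numE// -[X in (_ <= _ * X)%E]fineK ?ge0_fin_numE//.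
rewrite -EFinM lee_fin; apply: (weak_type ud2) => // W /mapP[p].
rewrite mem_filter => /andP[/asboolP px pS'] ->.
apply: (le_trans (hS' p pS')); rewrite ler_pM2l//.
have mW := cset_meas v2 p.2; have Wy := cset_lty ud2 v2 p.2.
have fin D : measurable D -> (mu2 (cset v2 p.2 `&` D) < +oo)%E.
  move=> mD; apply: le_lt_trans Wy; apply: le_measure; rewrite ?inE//.
  exact: measurableI.
have msh : measurable (shadow S p.1) := cubesU_meas v2 _.
rewrite -lee_fin !fineK ?ge0_fin_numE ?fin//.
apply: le_measure; rewrite ?inE; [exact: measurableI|exact: measurableI|].
apply: setIS => y sy; have := shadow_section px sy.
by rewrite -/t -slice_rectsU /xsection /= inE.
Qed.

Section Journe.
Variables (S : pairs) (Q : set X1) (rho : R).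
Hypothesis rho01 : 0 <= rho < 1.
Hypothesis Qanc : forall K, exists i, Q `<=` (cset v1 (anc R v1 i K) : set X1).

(** The cube V* of the overview. *)
Definition vtop (p : cube n1 * cube n2) : cube n2 := topmost R v2 (above S p.1) p.2.

(* Journe's lemma, with the enlargement of [K] stopped at the first ancestor
   containing [Q] so that all the cubes involved stay finite in number. *)
Let thin (i : nat) K W : Prop :=
  2 * fine (mu2 (cset v2 W `&` shadow S (anc R v1 i K))) < fine (mu2 (cset v2 W)).
Let stop (i : nat) K W : Prop :=
  thin i.+1 K W \/ Q `<=` (cset v1 (anc R v1 i K) : set X1).

Let stop_min K W : exists i, stop i K W /\ forall j, (j < i)%N -> ~ stop j K W.
Proof.
have ex : exists i, `[< stop i K W >].
  by have [i hi] := Qanc K; exists i; apply/asboolP; right.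
case: (ex_minnP ex) => i /asboolP hi mi; exists i; split => // j ji sj.
by move: ji; rewrite ltnNge mi//; exact/asboolP.
Qed.

Lemma mem_above p : p \in S -> p.2 \in above S p.1.
Proof. by case: p => K V pS; apply/aboveP; exists K => //; exact: dsub_refl. Qed.

(** [lev] is the index at which the enlargement of K stops. For the labels counted, it stops because
    the next slice is thin, so at least half of W lies outside the shadow of the next ancestor. At a
    point x of K times that part of W, no rectangle of S through x has a first side containing the
    next ancestor. Hence [lev] is at least the number of generations from K up to the widest first
    side through x, and these numbers differ for different labels at x: the weights are dominated by
    a geometric series. Before stopping, the slices fill half of W, whence the second claim by the
    weak type bound. *)
Lemma journe : exists lev : cube n1 -> cube n2 -> nat,
  (forall L : pairs, uniq L ->
    (forall q, q \in L -> (exists2 p, p \in S & q = (p.1, vtop p)) /\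
        ~ Q `<=` (cset v1 (anc R v1 (lev q.1 q.2) q.1) : set X1)) ->
    \sum_(q <- L) rho ^+ lev q.1 q.2 * (fine (mu1 (cset v1 q.1)) * fine (mu2 (cset v2 q.2)))
      <= 2 * (1 - rho)^-1 * fine (mm (rectsU S))) /\
  fine (mm (rectsU [seq (anc R v1 (lev p.1 (vtop p)) p.1, vtop p) | p <- S])) <=
    2 * fine (mm (rectsU S)).
Proof.
have [r0 r1] := andP rho01.
have [lev0 hlev] := boolp.choice (fun q : cube n1 * cube n2 => stop_min q.1 q.2).
exists (fun K W => lev0 (K, W)); split; last first.
  apply: rectsU_weak_type => _ /mapP[p pS ->] /=.
  have [_ nstop] := hlev (p.1, vtop p).
  (* At index 0 the shadow contains W, which is listed above K. At index i + 1, not having stopped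
     at i means that the slice over the ancestor i + 1 is not thin. *)
  case E : (lev0 (p.1, vtop p)) nstop => [|i] /= nstop.
    rewrite anc0 setIidl; first by rewrite ler_peMl ?fine_ge0// ler1n.
    by move=> y Wy; exists (vtop p) => //; apply/topmost_in/mem_above.
  rewrite leNgt; apply/negP => lt; apply: (nstop i (ltnSn i)).
  by left.
move=> L uL hL.
pose bad q := cset v2 q.2 `\` shadow S (anc R v1 (lev0 q).+1 q.1).
pose A q : set (X1 * X2) := cset v1 q.1 `*` bad q.
have mbad q : measurable (bad q) by apply: measurableD; [exact: cset_meas|exact: cubesU_meas].
have mA q : measurable (A q) by apply: measurableX => //; exact: cset_meas.
have bady q : (mu2 (bad q) < +oo)%E.
  by apply: le_lt_trans (cset_lty ud2 v2 q.2); apply: le_measure; rewrite ?inE//;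
    [exact: cset_meas|exact: subDsetl].
have AE q : fine (mm (A q)) = fine (mu1 (cset v1 q.1)) * fine (mu2 (bad q)).
  have ly := cset_lty ud1 v1 q.1.
  rewrite product_measure1E//; last exact: cset_meas.
  by rewrite fineM ?ge0_fin_numE.
have Ay q : (mm (A q) < +oo)%E.
  have ly := cset_lty ud1 v1 q.1.
  rewrite product_measure1E//; last exact: cset_meas.
  by rewrite lte_mul_pinfty// ge0_fin_numE.
have half q : q \in L -> fine (mu2 (cset v2 q.2)) <= 2 * fine (mu2 (bad q)).
  move=> /hL[_ nQ]; have [[th|sub] _] := hlev q; last by case: nQ; rewrite -surjective_pairing.
  have Wy := cset_lty ud2 v2 q.2; have mW := cset_meas v2 q.2.
  rewrite /thin in th; set sh := shadow S _ in th.
  have msh : measurable sh by exact: cubesU_meas.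
  have Iy : (mu2 (cset v2 q.2 `&` sh) < +oo)%E.
    by apply: le_lt_trans Wy; apply: le_measure; rewrite ?inE//; exact: measurableI.
  have dec : fine (mu2 (cset v2 q.2)) = fine (mu2 (bad q)) + fine (mu2 (cset v2 q.2 `&` sh)).
    rewrite -fineD ?ge0_fin_numE//; congr fine.
    by exact: measureDI.
  by move: th; rewrite dec; lra.
have key : \sum_(q <- L) rho ^+ lev0 q * fine (mm (A q)) <=
    (1 - rho)^-1 * fine (mm (rectsU S)).
  apply: weighted_measure_le => //; [exact: rectsU_meas|exact: rectsU_lty|].
  move=> x.
  have inS q : q \in L -> A q x -> exists p, [/\ p \in S, dsub R v1 q.1 p.1,
      q.2 \in above S q.1 & rect v1 v2 p x].
    move=> /hL[[p pS qE] _] [/= Kx [Wx _]].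
    have Wab : q.2 \in above S q.1 by rewrite qE /=; apply/topmost_in/mem_above.
    have /aboveP[K' KS KK'] := Wab; exists (K', q.2); split => //.
    by split => //=; exact: (dsub_subset KK').
  case: (indicP R (rectsU S) x) => -[Sx ->]; last first.
    rewrite mulr0 big1_seq// => q /andP[_ qL]; rewrite indicE memNset ?mulr0//.
    by move=> /(inS q qL)[p [pS _ _ px]]; apply: Sx; exists p.
  rewrite mulr1.
  pose Sx' := [seq p <- S | `[< rect v1 v2 p x >]].
  (* Among the rectangles of S through x, choose [pm] with the widest first side; depths are counted
     from it. *)
  have [p0 p0S p0x] := Sx.
  have [pm [pmS pmx pmin]] : exists pm, [/\ pm \in S, rect v1 v2 pm x &
      forall p, p \in S -> rect v1 v2 p x -> gen pm.1 <= gen p.1].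
    have p0' : p0 \in Sx' by rewrite mem_filter p0S andbT; exact/asboolP.
    have : exists2 pm, pm \in Sx' & forall p, p \in Sx' -> gen pm.1 <= gen p.1.
      exact: (seq_argmin (fun p : cube n1 * cube n2 => gen p.1) p0').
    move=> [pm]; rewrite mem_filter => /andP[/asboolP pmx pmS] hm; exists pm; split => // p pS px.
    by apply: hm; rewrite mem_filter pS andbT; exact/asboolP.
  pose dep (q : cube n1 * cube n2) := `|gen q.1 - gen pm.1|%N.
  have gq q : q \in L -> A q x -> gen pm.1 <= gen q.1.
    move=> qL /(inS q qL)[p [pS qp _ px]].
    exact: le_trans (pmin p pS px) (dsub_gen qp).
  apply: (@le_trans _ _ (\sum_(q <- L) rho ^+ dep q * \1_(A q) x)).
    rewrite !big_seq; apply: ler_sum => q qL.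
    case: (indicP R (A q) x) => -[Ax ->]; last by rewrite !mulr0.
    rewrite !mulr1; apply: ler_wiXn2l => //; first exact: ltW.
    rewrite leqNgt; apply/negP => lt; have [Kx [_ nsh]] := Ax; apply: nsh.
    have pmq : dsub R v1 (anc R v1 (lev0 q).+1 q.1) pm.1.
      apply: (@dsubP _ _ _ _ _ x.1).
      - rewrite gen_anc; move: lt; rewrite /dep; have := gq q qL Ax.
        by move: (gen q.1) (gen pm.1) (lev0 q) => a b c; lia.
      - exact: (dsub_subset (dsub_anc v1 _ _) Kx).
      - by case: pmx.
    exists pm.2; last by case: pmx.
    by apply/aboveP; exists pm.1 => //; case: pm pmS {pmx pmin dep gq lt pmq}.
  (* Equal depths give the same K, and then W is the maximal cube through x.2 of one fixed list. *)
  apply: sum_depth_indic_le => // q q' qL q'L Aq Aq'.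
  rewrite /dep => gE.
  have K1 : q.1 = q'.1.
    have [K1x _] := Aq; have [K1x' _] := Aq'.
    apply: (cset_eq _ K1x K1x'); have := gq q qL Aq; have := gq q' q'L Aq'.
    by move: gE; move: (gen q.1) (gen q'.1) (gen pm.1) => a b c; lia.
  have [[p pS qE] _] := hL q qL; have [[p' pS' qE'] _] := hL q' q'L.
  have [_ [Wx _]] := Aq; have [_ [Wx' _]] := Aq'.
  have pp : p.1 = p'.1 by move: K1; rewrite qE qE'.
  have W1 : vtop p = vtop p'.
    move: Wx Wx'; rewrite qE qE' /= /vtop -pp => Wx Wx'.
    by apply: topmost_eq Wx Wx'; [exact: mem_above|rewrite pp; exact: mem_above].
  by rewrite qE qE' W1 pp.
rewrite -mulrA; apply: le_trans (ler_wpM2l (ler0n _ 2) key); rewrite mulr_sumr !big_seq.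
apply: ler_sum => q qL; rewrite AE [leRHS]mulrCA -surjective_pairing.
apply: ler_wpM2l; first exact: exprn_ge0.
rewrite [leRHS]mulrCA; apply: ler_wpM2l; first exact: fine_ge0.
exact: half.
Qed.

End Journe.
End Rectangles.
Arguments above R {n1 n2} v1 S K.
Arguments vtop R {n1 n2} v1 v2 S p.

(** * Exchange of the two factors *)

Section Swap.
Context d1 d2 (T1 : measurableType d1) (T2 : measurableType d2) (R : realType).
Variables (m1 : {sigma_finite_measure set T1 -> \bar R}).
Variables (m2 : {sigma_finite_measure set T2 -> \bar R}).
Local Notation mm := (m1 \x m2)%E.
Local Notation mms := (m2 \x m1)%E.

Definition unswap (A : Type) (F : T1 * T2 -> A) : T2 * T1 -> A := fun y => F (y.2, y.1).

Lemma unswap_measurable (F : T1 * T2 -> R) :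
  measurable_fun setT F -> measurable_fun setT (unswap F).
Proof.
have ms : measurable_fun setT (fun y : T2 * T1 => (y.2, y.1)).
  by apply: measurable_fun_pair; [exact: measurable_snd|exact: measurable_fst].
by move=> mF; exact: (measurableT_comp mF ms).
Qed.

Lemma rint_swap (F : T1 * T2 -> R) : rint mm F -> rint mms (unswap F).
Proof.
move=> iF; have mF := rint_measurable iF.
have mE : measurable_fun setT (EFin \o F) by exact/measurable_EFinP.
have mE' : measurable_fun setT (EFin \o unswap F).
  by apply/measurable_EFinP; exact: (unswap_measurable mF).
exact: ((integrable12ltyP m2 m1 mE').2 ((integrable21ltyP m1 m2 mE).1 iF)).
Qed.

Lemma rintegral_swap (F : T1 * T2 -> R) : rint mm F ->
  \int[mms]_y unswap F y = \int[mm]_x F x.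
Proof. by move=> iF; rewrite (rintegral_fubini (rint_swap iF)) (rintegral_fubini2 iF). Qed.

Lemma sqi_swap (F : T1 * T2 -> R) : sqi mm F -> sqi mms (unswap F).
Proof.
by move=> [mF iF]; split; [exact: unswap_measurable|exact: (rint_swap iF)].
Qed.

Lemma dev_swap (G : T1 * T2 -> R[i]) phi : csqi mm G -> sqi mm phi ->
  dev mms (unswap G) (unswap phi) = dev mm G phi.
Proof.
move=> hG hphi; have [r1 r2] := csqi_rint hG hphi.
by rewrite /dev /bessel_re /bessel_im -(rintegral_swap r1) -(rintegral_swap r2).
Qed.

End Swap.

Lemma rectsU_swap {R : realType} {n1 n2 : nat}
    (mu1 : {sigma_finite_measure set 'rV[R]_n1 -> \bar R})
    (mu2 : {sigma_finite_measure set 'rV[R]_n2 -> \bar R})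
    (lam1 : 'rV[R]_n1 -> R -> R) (lam2 : 'rV[R]_n2 -> R -> R) (C1 C1' C2 C2' : R)
    (v1 : grid n1) (v2 : grid n2) (S : seq (cube n1 * cube n2)) :
  upper_doubling mu1 lam1 C1 C1' -> upper_doubling mu2 lam2 C2 C2' ->
  fine ((mu2 \x mu1)%E (rectsU v2 v1 [seq (p.2, p.1) | p <- S])) =
  fine ((mu1 \x mu2)%E (rectsU v1 v2 S)).
Proof.
move=> ud1 ud2; rewrite -!rintegral_indic; try exact: rectsU_meas.
rewrite -(rintegral_swap (rint_indic (rectsU_meas v1 v2 S) (rectsU_lty ud1 ud2 v1 v2 S))).
apply: rintegral_ext => -[y x]; rewrite /unswap /=.
case: (indicP R (rectsU v1 v2 S) (x, y)) => -[h ->].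
  have [[K V] pS [/= Kx Vy]] := h; rewrite indicE mem_set//.
  by exists (V, K); [apply/mapP; exists (K, V)|].
rewrite indicE memNset// => -[q /mapP[[K V] pS ->] [/= Vy Kx]].
by apply: h; exists (K, V).
Qed.

Lemma sum_fibers (R : realType) (E E' : eqType) (s : seq E) (f : E -> E') (G : E -> R) :
  \sum_(t <- s) G t = \sum_(q <- undup (map f s)) \sum_(t <- s | f t == q) G t.
Proof.
under [RHS]eq_bigr do rewrite big_mkcond.
rewrite exchange_big /= !big_seq; apply: eq_bigr => t ts.
rewrite (bigD1_seq (f t)) ?undup_uniq ?mem_undup ?map_f//= eqxx big1 ?addr0// => q.
by rewrite eq_sym => /negbTE ->.
Qed.

(** * Exhaustion by ancestors in grids without quadrants *)

Section Quadrants.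
Context {R : realType} {n : nat}.
Variable w : grid n.
Hypothesis n_gt0 : (0 < n)%N.
Hypothesis nq : no_quadrants R w.

(** The ancestors of Q increase strictly, hence exhaust the space. One that contains both constant
    vectors -N and N contains the whole box. *)
Lemma anc_box (Q : cube n) (N : R) : exists i,
  [set y : 'rV[R]_n | `|y| <= N] `<=` (cset w (anc R w i Q) : set 'rV[R]_n).
Proof.
have mono i j : (i <= j)%N -> cset w (anc R w i Q) `<=` (cset w (anc R w j Q) : set 'rV[R]_n).
  move=> ij; apply/dsub_subset/anc_dsub; first exact: dsub_anc.
  by rewrite !gen_anc; lia.
have all : \bigcup_i cset w (anc R w i Q) = setT :> set 'rV[R]_n.
  apply: nq => i; split; first exact: mono.
  move=> /(_ _ _) sub.
  pose i0 : 'I_n := Ordinal n_gt0.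
  set P := anc R w i.+1 Q in sub; set P' := anc R w i Q in sub.
  have sPP : side R P = 2 * side R P'.
    rewrite !sideE !gen_anc -[X in X * _]expr1z -expfzDr//; congr (_ ^ _); lia.
  (* The centre of P and its corner differ in each coordinate by exactly the side of P', so the
     half-open cube P' cannot contain both. *)
  pose y : 'rV[R]_n := \row_j (corner w P 0 j + side R P / 2).
  have s0 := side_gt0 (R := R) P.
  have Py : cset w P y.
    move=> j /=; rewrite !mxE; apply/andP; split; lra.
  have /sub h1 := Py; have /sub h2 := cset_corner (R := R) w P.
  have /andP[a1 a2] := h1 i0; have /andP[b1 b2] := h2 i0.
  by move: a1 a2 b1 b2; rewrite /= !mxE; lra.
have at_ (z : 'rV[R]_n) : exists i, cset w (anc R w i Q) z.
  have : (\bigcup_i cset w (anc R w i Q)) z by rewrite all.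
  by move=> [i _]; exists i.
have [i hi] := at_ (const_mx (- N)); have [j hj] := at_ (const_mx N).
exists (maxn i j) => y /= yN.
have := mono i (maxn i j) (leq_maxl i j) _ hi; have := mono j (maxn i j) (leq_maxr i j) _ hj.
move=> h2 h1 k /=; have := h1 k; have := h2 k; rewrite /= !mxE => /andP[_ a2] /andP[b1 _].
have := le_trans (coord_le_norm y k) yN; rewrite ler_norml => /andP[c1 c2].
by rewrite (le_trans b1)//= (le_lt_trans c2).
Qed.

End Quadrants.

(** * The sum of one far part over all rectangles *)

Section OneSided.
Context {R : realType} {n1 n2 : nat}.
Local Notation X1 := 'rV[R]_n1.
Local Notation X2 := 'rV[R]_n2.
Variables (mu1 : {sigma_finite_measure set X1 -> \bar R}).
Variables (mu2 : {sigma_finite_measure set X2 -> \bar R}).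
Variables (lam1 : X1 -> R -> R) (lam2 : X2 -> R -> R) (C1 C1' C2 C2' alpha beta CK : R).
Hypothesis ud1 : upper_doubling mu1 lam1 C1 C1'.
Hypothesis ud2 : upper_doubling mu2 lam2 C2 C2'.
Hypotheses (alpha_gt0 : 0 < alpha) (beta_gt0 : 0 < beta).
Local Notation mm := (mu1 \x mu2)%E.
Variables (T : (X1 * X2 -> R[i]) -> X1 * X2 -> R[i]).
Variable T1 : X1 -> X1 -> (X2 -> R[i]) -> X2 -> R[i].
Hypothesis Tzero : forall phi c, sqi mm phi ->
  part c (pairing mm (T (fun=> 0)) (fun x => (phi x)%:C%C)) = 0.
Hypothesis vcz : vector_CZ mu1 mu2 lam1 lam2 alpha beta CK T T1.
Variables (w1 v1 : grid n1) (w2 v2 : grid n2).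
Variables (h : cube n1 -> X1 -> R) (u : cube n2 -> X2 -> R).
Hypothesis hh : haar_system mu1 w1 h.
Hypothesis hu : haar_system mu2 w2 u.
Variables (E : eqType) (F : seq E) (iI : E -> cube n1) (iJ : E -> cube n2).
Variables (lab : E -> cube n1 * cube n2) (lev : cube n1 -> cube n2 -> nat).
Variables (g : cube n1 * cube n2 -> X1 * X2 -> R[i]) (B N : R).
Hypothesis uF : uniq F.
Hypothesis injF : {in F &, forall t t', iI t = iI t' -> iJ t = iJ t' -> t = t'}.
Let hatK (q : cube n1 * cube n2) := anc R v1 (lev q.1 q.2) q.1.
Hypothesis sepI : forall t, t \in F -> sep R w1 v1 (iI t) (hatK (lab t)).
Hypothesis subI : forall t, t \in F -> gen (lab t).1 <= gen (iI t) /\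
  cset w1 (iI t) `<=` (cset v1 (lab t).1 : set X1).
Hypothesis sepJ : forall t, t \in F -> sep R w2 v2 (iJ t) (lab t).2.
Hypothesis gbox : forall q, bounded_box (g q) B N.
Hypothesis gK : forall t, t \in F -> forall x, cset v1 (hatK (lab t)) x.1 -> g (lab t) x = 0.

(** If the enlarged cube contains the box, the function attached to the label vanishes identically.
    These labels contribute nothing and are the ones left out of the counting in [journe]. *)
Let capped (q : cube n1 * cube n2) : bool :=
  `[< [set y : X1 | `|y| <= N] `<=` (cset v1 (hatK q) : set X1) >].

(** Group the terms by label and then by I, and apply [vector_estimate] to each I. The gap from I to
    the enlarged cube is [lev] plus the gap from I to K: the first stays as the weight for [journe],
    the second is summed over I by [carleson_depth]. *)
Lemma one_sided :
  \sum_(t <- F) dev mm (T (g (lab t))) (fun x => h (iI t) x.1 * u (iJ t) x.2) <=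
  vector_const C1 C1' C2 C2' alpha beta CK * B ^+ 2 * (1 - decay alpha)^-1 *
  \sum_(q <- [seq q <- undup (map lab F) | ~~ capped q])
     decay alpha ^+ lev q.1 q.2 * (fine (mu1 (cset v1 q.1)) * fine (mu2 (cset v2 q.2))).
Proof.
have /andP[d0 d1] := decay_bounds alpha_gt0.
set vc := vector_const _ _ _ _ _ _ _.
rewrite (sum_fibers F lab) big_filter mulr_sumr [leRHS]big_mkcond !big_seq.
apply: ler_sum => q; rewrite mem_undup => /mapP[t0 t0F qE].
case: ifPn => [ncap|/negPn/asboolP cap]; last first.
  rewrite big1_seq// => t /andP[/eqP tq tF].
  have -> : g (lab t) = (fun=> 0).
    apply/funext => x; case: (leP `|x.1| N) => xN.
      by apply: gK => //; rewrite tq; exact: cap.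
    by have [_ _ +] := gbox (lab t); apply; left.
  rewrite dev_pairing big1// => c _; rewrite Tzero ?expr0n//.
  exact: (sqi_prod (hs_sqi hh _) (hs_sqi hu _)).
pose Fq := [seq t <- F | lab t == q].
rewrite -big_filter -/Fq (sum_fibers Fq iI).
have Fq_in t : t \in Fq -> t \in F /\ lab t = q.
  by rewrite mem_filter => /andP[/eqP].
set c := decay alpha ^+ lev q.1 q.2.
have [gBox gB gN] := gbox q.
have vc0 : 0 <= vc * B ^+ 2.
  by rewrite mulr_ge0 ?sqr_ge0//; exact: vector_const_ge0.
apply: (@le_trans _ _ (\sum_(I <- undup (map iI Fq)) vc * B ^+ 2 * (c * fine (mu2 (cset v2 q.2))) *
    (decay alpha ^+ gap I q.1 * fine (mu1 (cset w1 I))))).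
  rewrite !big_seq; apply: ler_sum => I; rewrite mem_undup => /mapP[t tFq IE].
  have [tF tq] := Fq_in t tFq.
  pose s := map iJ [seq t <- Fq | iI t == I].
  have us : uniq s.
    rewrite map_inj_in_uniq ?filter_uniq// => a b.
    rewrite !mem_filter => /andP[/eqP aI /andP[_ aF]] /andP[/eqP bI /andP[_ bF]] ab.
    by apply: injF => //; rewrite aI bI.
  have sJ J : J \in s -> sep R w2 v2 J q.2.
    move=> /mapP[a]; rewrite mem_filter => /andP[/eqP aI /Fq_in[aF aq]] ->.
    by rewrite -aq; exact: sepJ.
  have sI : sep R w1 v1 I (hatK q) by rewrite IE -tq; exact: sepI.
  have gKq x : cset v1 (hatK q) x.1 -> g q x = 0 by rewrite -tq; exact: gK.
  have := vector_estimate ud1 ud2 alpha_gt0 beta_gt0 Tzero vcz hh hu (gbox q) gKq sI us sJ.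
  rewrite big_map big_filter => est; apply: (le_trans (le_trans _ est)).
    rewrite le_eqVlt; apply/orP; left; apply/eqP.
    rewrite [LHS]big_seq_cond [RHS]big_seq_cond; apply: eq_bigr => a /andP[/Fq_in[_ ->] /eqP ->].
    by [].
  rewrite -/vc.
  have -> : gap I (hatK q) = (lev q.1 q.2 + gap I q.1)%N.
    by apply: gap_anc; have [] := subI tF; rewrite tq -IE.
  rewrite exprD -/c le_eqVlt; apply/orP; left; apply/eqP; ring.
rewrite -mulr_sumr.
apply: (@le_trans _ _ (vc * B ^+ 2 * (c * fine (mu2 (cset v2 q.2))) *
    ((1 - decay alpha)^-1 * fine (mu1 (cset v1 q.1))))).
  apply: ler_wpM2l.
    by apply: mulr_ge0 => //; apply: mulr_ge0; [rewrite exprn_ge0// ltW|exact: fine_ge0].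
  apply: (carleson_depth ud1); rewrite ?undup_uniq//; first by rewrite ltW.
  move=> I; rewrite mem_undup => /mapP[t /Fq_in[tF tq] ->].
  by have := subI tF; rewrite tq.
rewrite le_eqVlt; apply/orP; left; apply/eqP.
move: (_^-1) (fine _) (fine _) => a b e; ring.
Qed.

End OneSided.

Lemma swap_op_unswap (A X Y : Type) (T : (X * Y -> A) -> X * Y -> A) (G : X * Y -> A) :
  swap_op T (fun y => G (y.2, y.1)) = (fun y => T G (y.2, y.1)).
Proof.
apply/funext => y; rewrite /swap_op; congr (T _ _).
by apply/funext => -[].
Qed.

Lemma nested_split_le (R : realType) (a b c d e : R) :
  a <= 2 * b + 2 * c -> c <= 2 * d + 2 * e -> a <= 2 * b + 4 * d + 4 * e.
Proof. lra. Qed.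

(** * The square sum over finitely many rectangles *)

Section Core.
Context {R : realType} {n m r : nat}.
Local Notation X1 := 'rV[R]_n.
Local Notation X2 := 'rV[R]_m.
Variables (mun : {sigma_finite_measure set X1 -> \bar R}).
Variables (mum : {sigma_finite_measure set X2 -> \bar R}).
Variables (lamn : X1 -> R -> R) (lamm : X2 -> R -> R).
Variables (Cn Cn' Cm Cm' alpha beta CK A : R).
Hypothesis udn : upper_doubling mun lamn Cn Cn'.
Hypothesis udm : upper_doubling mum lamm Cm Cm'.
Hypotheses (alpha_gt0 : 0 < alpha) (beta_gt0 : 0 < beta).
Hypotheses (n_gt0 : (0 < n)%N) (m_gt0 : (0 < m)%N).
Local Notation mm := (mun \x mum)%E.
Local Notation mms := (mum \x mun)%E.
Variables (T : (X1 * X2 -> R[i]) -> X1 * X2 -> R[i]).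
Hypothesis pcz : product_CZ mun mum lamn lamm alpha beta CK T.
Hypothesis TA : (opnorm mm T < A%:E)%E.
Variables (wn vn : grid n) (wm vm : grid m).
Hypotheses (nqn : no_quadrants R vn) (nqm : no_quadrants R vm).
Variables (h : cube n -> X1 -> R) (u : cube m -> X2 -> R).
Hypothesis hh : haar_system mun wn h.
Hypothesis hu : haar_system mum wm u.
Local Notation pair := (cube n * cube m)%type.
Variable F : seq (pair * pair).
Hypothesis uF : uniq F.
Hypothesis F_gen : forall t, t \in F ->
  gen t.2.1 = gen t.1.1 + r%:Z /\ gen t.2.2 = gen t.1.2 + r%:Z.
Hypothesis F_sub : forall t, t \in F ->
  cset wn t.2.1 `<=` (cset vn t.1.1 : set X1) /\ cset wm t.2.2 `<=` (cset vm t.1.2 : set X2).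
Hypothesis F_goodn : forall t, t \in F -> forall K, gen K + r%:Z <= gen t.2.1 ->
  cset wn t.2.1 `<=` (cset vn K : set X1) -> sep R wn vn t.2.1 K.
Hypothesis F_goodm : forall t, t \in F -> forall V, gen V + r%:Z <= gen t.2.2 ->
  cset wm t.2.2 `<=` (cset vm V : set X2) -> sep R wm vm t.2.2 V.
Variables (f : X1 * X2 -> R[i]) (B N : R).
Hypothesis fbox : bounded_box f B N.

Let T2 : forall f, CL mm 2%:E f -> CL mm 2%:E (T f). Proof. by have [[]] := pcz. Qed.
Let Tlin : linear_on_L2 mm T. Proof. by have [[]] := pcz. Qed.

Let Tzero phi c : sqi mm phi ->
  part c (pairing mm (T (fun=> 0)) (fun x => (phi x)%:C%C)) = 0.
Proof.
by move=> hphi; have [b1 b2] := bessel0 T2 Tlin hphi; rewrite pairing_real; case: c.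
Qed.

Let Tzeros phi c : sqi mms phi ->
  part c (pairing mms (swap_op T (fun=> 0)) (fun x => (phi x)%:C%C)) = 0.
Proof.
move=> hphi; have hs : sqi mm (unswap phi) := sqi_swap hphi.
rewrite -[RHS](Tzero c hs) !pairing_part.
have z0 : csqi mm (fun=> 0 : R[i]) by split; exact: sqi0.
have [r1 r2] := csqi_rint (U_csqi T2 z0) hs.
have ri : rint mm (fun x => part c (T (fun=> 0) x) * unswap phi x) by case: c.
rewrite -(rintegral_swap ri); apply: rintegral_ext => -[y x].
by rewrite /unswap /swap_op.
Qed.

Lemma bounded_box_cres (g : X1 * X2 -> R[i]) (D : set (X1 * X2)) : measurable D ->
  bounded_box g B N -> bounded_box (cres g D) B N.
Proof.
move=> mD [mg gB gN]; split; first exact: cres_measurable.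
- exact: cres_bound.
- by move=> x xN; rewrite /cres gN// mul0r.
Qed.

Lemma bounded_box_unswap (g : X1 * X2 -> R[i]) :
  bounded_box g B N -> bounded_box (unswap g) B N.
Proof.
move=> [[mr mi] gB gN]; split.
- by split; [exact: (unswap_measurable mr)|exact: (unswap_measurable mi)].
- by move=> x; exact: gB.
- by move=> x xN; apply: gN => /=; case: xN; [right|left].
Qed.

Let S1 : seq pair := map fst F.

(** Splitting f into three pieces costs 2, 4 and 4. The first piece adds a 4 for the measure of Om3.
    [journe] adds a 2 to the second and, being applied to a union of measure at most 2 mu(Om1), a 4
    to the third. Of each squared inverse, one factor is a Carleson sum and the other comes from
    [journe]. *)
Definition core_const : R :=
  8 * A ^+ 2
  + 8 * vector_const Cn Cn' Cm Cm' alpha beta CK * (1 - decay alpha)^-1 ^+ 2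
  + 16 * vector_const Cm Cm' Cn Cn' beta alpha CK * (1 - decay beta)^-1 ^+ 2.

Lemma core_const_ge0 : 0 <= core_const.
Proof.
have /andP[_ /ltW da1] := decay_bounds alpha_gt0.
have /andP[_ /ltW db1] := decay_bounds beta_gt0.
have v1 := vector_const_ge0 Cn Cn' Cm Cm' alpha CK beta_gt0.
have v2 := vector_const_ge0 Cm Cm' Cn Cn' beta CK alpha_gt0.
have q1 := sqr_ge0 (1 - decay alpha)^-1; have q2 := sqr_ge0 (1 - decay beta)^-1.
apply: addr_ge0; last by apply: mulr_ge0 => //; exact: mulr_ge0.
apply: addr_ge0; last by apply: mulr_ge0 => //; exact: mulr_ge0.
by apply: mulr_ge0 => //; exact: sqr_ge0.
Qed.

Lemma core_estimate :
  \sum_(t <- F) dev mm (T f) (fun x => h t.2.1 x.1 * u t.2.2 x.2) <=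
  core_const * B ^+ 2 * fine (mm (rectsU vn vm S1)).
Proof.
have [Tb [T1 vcz1] [T2' vcz2]] := pcz.
have /andP[/ltW da0 da1] := decay_bounds alpha_gt0.
have /andP[/ltW db0 db1] := decay_bounds beta_gt0.
have da01 : 0 <= decay alpha < 1 by rewrite da0.
have db01 : 0 <= decay beta < 1 by rewrite db0.
pose Qn : set X1 := [set y | `|y| <= N]; pose Qm : set X2 := [set y | `|y| <= N].
have Qna K : exists i, Qn `<=` (cset vn (anc R vn i K) : set X1) := anc_box n_gt0 nqn K N.
have Qma V : exists i, Qm `<=` (cset vm (anc R vm i V) : set X2) := anc_box m_gt0 nqm V N.
have [lev1 [jsum1 jmeas1]] := journe udn udm vm S1 da01 Qna.
pose W (p : pair) := vtop R vn vm S1 p.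
pose Kh (q : pair) := anc R vn (lev1 q.1 q.2) q.1.
(* The first enlargement, with its factors exchanged, is the input of the second. *)
pose S2s : seq (cube m * cube n) := [seq (W p, Kh (p.1, W p)) | p <- S1].
have [lev2 [jsum2 jmeas2]] := journe udm udn vn S2s db01 Qma.
pose Ks (q : pair) := vtop R vm vn S2s (q.2, Kh q).
pose Vh (q : cube m * cube n) := anc R vm (lev2 q.1 q.2) q.1.
pose Vh1 (q : pair) := Vh (q.2, Ks q).
(* [lab] holds K and V*, [labs] holds V* and K*: the two far parts depend on t only through these
   labels. *)
pose lab (t : pair * pair) : pair := (t.1.1, W t.1).
pose labs (t : pair * pair) : cube m * cube n := (W t.1, Ks (lab t)).
pose S3 : seq pair := [seq (Ks (p.1, W p), Vh1 (p.1, W p)) | p <- S1].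
set Om1 := rectsU vn vm S1.
have m1 : fine (mm (rectsU vn vm S3)) <= 4 * fine (mm Om1).
  have -> : fine (mm (rectsU vn vm S3)) = fine (mms (rectsU vm vn [seq (p.2, p.1) | p <- S3])).
    by rewrite (rectsU_swap vn vm S3 udn udm).
  have e2 : fine (mms (rectsU vm vn S2s)) <= 2 * fine (mm Om1).
    by rewrite -(rectsU_swap vm vn S2s udm udn) -map_comp; exact: jmeas1.
  apply: (@le_trans _ _ (2 * fine (mms (rectsU vm vn S2s)))); last by lra.
  by move: jmeas2; rewrite -!map_comp; apply: le_trans.
pose Om3 : set (X1 * X2) := rectsU vn vm S3.
have mOm3 : measurable Om3 := rectsU_meas vn vm S3.
have Om3y : (mm Om3 < +oo)%E := rectsU_lty udn udm vn vm S3.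
pose g := cres f (~` Om3).
have mstrip V : measurable [set x : X1 * X2 | cset vm V x.2].
  rewrite (_ : [set x | _] = setT `*` cset vm V); last by apply/seteqP; split => x //= [].
  by apply: measurableX => //; exact: cset_meas.
pose gA (q : pair) := cres g [set x | cset vm (Vh1 q) x.2].
pose gB (q : cube m * cube n) := cres g (~` [set x | cset vm (Vh q) x.2]).
have gbox : bounded_box g B N by apply: bounded_box_cres => //; exact: measurableC.
have gAbox q : bounded_box (gA q) B N by exact: bounded_box_cres.
have gBbox q : bounded_box (gB q) B N by apply: bounded_box_cres => //; exact: measurableC.
pose phi (t : pair * pair) (x : X1 * X2) := h t.2.1 x.1 * u t.2.2 x.2.
have sphi t : sqi mm (phi t) by exact: (sqi_prod (hs_sqi hh _) (hs_sqi hu _)).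
pose f1 := cres f Om3.
have f1box : bounded_box f1 B N by exact: bounded_box_cres.
have cs (k : X1 * X2 -> R[i]) : bounded_box k B N -> csqi mm k.
  exact: (bounded_box_csqi udn udm).
have split3 t : dev mm (T f) (phi t) <= 2 * dev mm (T f1) (phi t)
    + 4 * dev mm (T (gA (lab t))) (phi t) + 4 * dev mm (T (gB (labs t))) (phi t).
  have d1 := dev_add T2 Tlin (cs _ f1box) (cs _ gbox) (sphi t).
  have d2 := dev_add T2 Tlin (cs _ (gAbox (lab t))) (cs _ (gBbox (labs t))) (sphi t).
  move: d1 d2; rewrite cres_split.
  have -> : (fun x => gA (lab t) x + gB (labs t) x) = g by exact: cres_split.
  exact: nested_split_le.
have tin t : t \in F -> t.1 \in S1 by move=> tF; exact: map_f.
have subW (t : pair * pair) : dsub R vm t.1.2 (W t.1) by exact: topmost_dsub.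
have subK q : dsub R vn q.1 (Kh q) by exact: dsub_anc.
have subKs q : dsub R vn (Kh q) (Ks q) by exact: topmost_dsub.
have subVh q : dsub R vm q.1 (Vh q) by exact: dsub_anc.
have subWV t : dsub R vm t.1.2 (Vh (labs t)).
  exact: dsub_trans (subW t) (subVh (labs t)).
have inI t K : t \in F -> dsub R vn t.1.1 K ->
    gen K + r%:Z <= gen t.2.1 /\ cset wn t.2.1 `<=` (cset vn K : set X1).
  move=> tF sK; have [gI _] := F_gen tF; have [sI _] := F_sub tF; split.
    by rewrite gI lerD2r; exact: dsub_gen sK.
  by move=> x /sI; exact: (dsub_subset sK).
have inJ t V : t \in F -> dsub R vm t.1.2 V ->
    gen V + r%:Z <= gen t.2.2 /\ cset wm t.2.2 `<=` (cset vm V : set X2).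
  move=> tF sV; have [_ gJ] := F_gen tF; have [_ sJ] := F_sub tF; split.
    by rewrite gJ lerD2r; exact: dsub_gen sV.
  by move=> x /sJ; exact: (dsub_subset sV).
have sI t K : t \in F -> dsub R vn t.1.1 K -> sep R wn vn t.2.1 K.
  by move=> tF sK; have [? ?] := inI t K tF sK; exact: F_goodn.
have sJ t V : t \in F -> dsub R vm t.1.2 V -> sep R wm vm t.2.2 V.
  by move=> tF sV; have [? ?] := inJ t V tF sV; exact: F_goodm.
have leI t K : t \in F -> dsub R vn t.1.1 K -> gen K <= gen t.2.1 by move=> tF /(sI t K tF)[].
have leJ t V : t \in F -> dsub R vm t.1.2 V -> gen V <= gen t.2.2 by move=> tF /(sJ t V tF)[].
(* The generation of S is that of I x J lowered by r, and cubes of one generation are disjoint, so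
   the inner rectangle determines S. *)
have inj t t' : t \in F -> t' \in F -> t.2.1 = t'.2.1 -> t.2.2 = t'.2.2 -> t = t'.
  move=> tF t'F e1 e2.
  have [g1 g2] := F_gen tF; have [g1' g2'] := F_gen t'F.
  have [s1 s2] := F_sub tF; have [s1' s2'] := F_sub t'F.
  have K1 : t.1.1 = t'.1.1.
    apply: (@cset_eq R _ vn _ _ (corner wn t.2.1)).
    - by apply: (addIr r%:Z); rewrite -g1 -g1' e1.
    - exact/s1/cset_corner.
    - by apply: s1'; rewrite e1; exact: cset_corner.
  have V1 : t.1.2 = t'.1.2.
    apply: (@cset_eq R _ vm _ _ (corner wm t.2.2)).
    - by apply: (addIr r%:Z); rewrite -g2 -g2' e2.
    - exact/s2/cset_corner.
    - by apply: s2'; rewrite e2; exact: cset_corner.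
  by move: K1 V1 e1 e2; case: t t' {tF t'F g1 g2 g1' g2' s1 s2 s1' s2'} =>
    -[? ?] [? ?] [[? ?] [? ?]] /= -> -> -> ->.
have b1 : \sum_(t <- F) dev mm (T f1) (phi t) <= A ^+ 2 * (B ^+ 2 * (4 * fine (mm Om1))).
  have [c1 n1] : csqi mm f1 /\ sqn mm f1 <= B ^+ 2 * fine (mm Om3).
    have [mf1 f1B _] := f1box; apply: bounded_csqi => // x nx; exact: cres_out.
  apply: (@le_trans _ _ (sqn mm (T f1))).
    apply: complex_bessel => //; first exact: U_csqi.
    - move=> t; under eq_Rintegral do rewrite /phi exprMn.
      have [_ i1] := hs_sqi hh t.2.1; have [_ i2] := hs_sqi hu t.2.2.
      rewrite (rintegral_prod i1 i2); apply: mulr_ile1.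
      + by apply: Rintegral_ge0 => x _; exact: sqr_ge0.
      + by apply: Rintegral_ge0 => x _; exact: sqr_ge0.
      + exact: hs_norm hh _.
      + exact: hs_norm hu _.
    - move=> t t' tF t'F tt'; under eq_Rintegral do rewrite /phi mulrACA.
      rewrite (rintegral_prod (sqi_mul (hs_sqi hh _) (hs_sqi hh _))
        (sqi_mul (hs_sqi hu _) (hs_sqi hu _))).
      have [e1|n1'] := eqVneq t.2.1 t'.2.1; last by rewrite (hs_orth hh n1') mul0r.
      have [e2|n2'] := eqVneq t.2.2 t'.2.2; last by rewrite (hs_orth hu n2') mulr0.
      by case/eqP: tt'; exact: inj.
  apply: le_trans (opnorm_sqn TA c1 (U_csqi T2 c1)) _.
  apply: ler_wpM2l; first exact: sqr_ge0.
  by apply: (le_trans n1); apply: ler_wpM2l => //; exact: sqr_ge0.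
have b2 : \sum_(t <- F) dev mm (T (gA (lab t))) (phi t) <=
    vector_const Cn Cn' Cm Cm' alpha beta CK * B ^+ 2 * (1 - decay alpha)^-1 *
    (2 * (1 - decay alpha)^-1 * fine (mm Om1)).
  have vc0 : 0 <= vector_const Cn Cn' Cm Cm' alpha beta CK * B ^+ 2 * (1 - decay alpha)^-1.
    rewrite mulr_ge0 ?invr_ge0 ?subr_ge0 ?(ltW da1)// mulr_ge0 ?sqr_ge0//.
    exact: vector_const_ge0.
  apply: le_trans (one_sided (lev := lev1) udn udm alpha_gt0 beta_gt0 Tzero vcz1 hh hu uF
    (fun t t' tF t'F => inj t t' tF t'F) _ _ _ gAbox _) _.
  - by move=> t tF; apply: sI => //; exact: dsub_anc.
  - move=> t tF; split; first by apply: leI => //; exact: dsub_refl.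
    by have [] := F_sub tF.
  - by move=> t tF; exact: sJ.
  (* Where x2 is in V^ and x1 is in K^, hence in K*, the point lies in Om3, on which [g]
     vanishes. *)
  - move=> t tF x Kx; rewrite /gA; case: (pselect (cset vm (Vh1 (lab t)) x.2)) => Vx;
      last by rewrite cres_out.
    rewrite cres_in// /g cres_out// => nO; apply: nO.
    exists (Ks (lab t), Vh1 (lab t)); first by apply/mapP; exists t.1 => //; exact: tin.
    by split => //=; exact: (dsub_subset (subKs (lab t))).
  apply: ler_wpM2l => //; apply: jsum1; first by rewrite filter_uniq// undup_uniq.
  move=> q; rewrite mem_filter mem_undup => /andP[/asboolP ncap /mapP[t tF qE]]; split => //.
  by exists t.1; [exact: tin|].
have b3 : \sum_(t <- F) dev mm (T (gB (labs t))) (phi t) <=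
    vector_const Cm Cm' Cn Cn' beta alpha CK * B ^+ 2 * (1 - decay beta)^-1 *
    (2 * (1 - decay beta)^-1 * (2 * fine (mm Om1))).
  have vc0 : 0 <= vector_const Cm Cm' Cn Cn' beta alpha CK * B ^+ 2 * (1 - decay beta)^-1.
    rewrite mulr_ge0 ?invr_ge0 ?subr_ge0 ?(ltW db1)// mulr_ge0 ?sqr_ge0//.
    exact: vector_const_ge0.
  rewrite (eq_bigr (fun t => dev mms (swap_op T (unswap (gB (labs t))))
      (fun y => u t.2.2 y.1 * h t.2.1 y.2))); last first.
    move=> t _; rewrite -(dev_swap (U_csqi T2 (cs _ (gBbox (labs t)))) (sphi t)).
    rewrite /unswap -swap_op_unswap /phi.
    by under [X in dev _ _ X]eq_fun do rewrite mulrC.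
  apply: le_trans (one_sided (lev := lev2) (v1 := vm) (v2 := vn) (iI := fun t => t.2.2) (iJ := fun t => t.2.1)
    (g := fun q => unswap (gB q)) udm udn beta_gt0 alpha_gt0 Tzeros vcz2 hu hh uF
    _ _ _ _ (fun q => bounded_box_unswap (gBbox q)) _) _.
  - by move=> t t' tF t'F e2 e1; exact: inj.
  - by move=> t tF; apply: sJ => //; exact: subWV.
  - move=> t tF; split; first exact: leJ.
    by have [] := inJ t _ tF (subW t).
  - move=> t tF; apply: sI => //.
    exact: (dsub_trans (subK (lab t)) (subKs (lab t))).
  - by move=> t tF y Vy; rewrite /unswap /gB cres_out// => /(_ Vy).
  apply: ler_wpM2l => //; apply: (@le_trans _ _ (2 * (1 - decay beta)^-1 *
      fine (mms (rectsU vm vn S2s)))).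
    apply: jsum2; first by rewrite filter_uniq// undup_uniq.
    move=> q; rewrite mem_filter mem_undup => /andP[/asboolP ncap /mapP[t tF qE]]; split => //.
    by exists (W t.1, Kh (lab t)) => //; apply/mapP; exists t.1 => //; exact: tin.
  apply: ler_wpM2l; first by rewrite mulr_ge0// invr_ge0 subr_ge0 ltW.
  by rewrite -(rectsU_swap vm vn S2s udm udn) -map_comp; exact: jmeas1.
apply: (@le_trans _ _ (\sum_(t <- F) (2 * dev mm (T f1) (phi t)
    + 4 * dev mm (T (gA (lab t))) (phi t) + 4 * dev mm (T (gB (labs t))) (phi t)))).
  by apply: ler_sum => t _; exact: split3.
rewrite !big_split /= -!mulr_sumr.
apply: (le_trans (lerD (lerD (ler_wpM2l (ler0n _ 2) b1) (ler_wpM2l (ler0n _ 4) b2))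
  (ler_wpM2l (ler0n _ 4) b3))).
rewrite /core_const -/Om1 le_eqVlt; apply/orP; left; apply/eqP.
move: (fine _) (_^-1) (_^-1) => a b c.
move: (vector_const _ _ _ _ _ _ _) (vector_const _ _ _ _ _ _ _) => d e; ring.
Qed.

End Core.

(** * Essential bounds and limits *)

Section AlmostEverywhere.
Context d (T : measurableType d) (R : realType) (mu : {measure set T -> \bar R}).

Lemma ae0_csqi (f : T -> R[i]) : Cmeasurable f -> (\forall x \ae mu, f x = 0) ->
  csqi mu f /\ sqn mu f = 0.
Proof.
move=> [mr mi] f0.
have aux (k : T -> R) : measurable_fun setT k -> (\forall x \ae mu, k x = 0) ->
    rint mu (fun x => k x ^+ 2) /\ \int[mu]_x (k x) ^+ 2 = 0.
  move=> mk k0; have mk2 : measurable_fun setT (fun x => k x ^+ 2) by exact: measurable_funX.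
  have E : (\int[mu]_x (k x ^+ 2)%:E = 0)%E.
    rewrite -[RHS](integral0 mu setT); apply: ae_eq_integral => //=.
      exact/measurable_EFinP.
    by apply: filterS k0 => x -> _; rewrite expr0n.
  split; last by rewrite /Rintegral E.
  by apply: rint_ge0_lty => //; [move=> x; exact: sqr_ge0|rewrite E].
have [r1 r2] := aux _ mr (filterS (fun x (e : f x = 0) => congr1 (@complex.Re R) e) f0).
have [i1 i2] := aux _ mi (filterS (fun x (e : f x = 0) => congr1 (@complex.Im R) e) f0).
by split; [split; split|rewrite /sqn r2 i2 addr0].
Qed.

Lemma ess_bound (b : T -> R[i]) : (0 <= CLnorm mu +oo%E b < +oo)%E ->
  \forall x \ae mu, cmod (b x) <= fine (CLnorm mu +oo%E b).
Proof.
move=> /andP[n0 ny].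
have nE : CLnorm mu +oo%E b = (fine (CLnorm mu +oo%E b))%:E by rewrite fineK// ge0_fin_numE.
move: nE; set B := fine _; rewrite /CLnorm unlock; case: ifPn => [_ E|+ _].
  have := ess_sup_ge mu (abse \o (fun x => (cmod (b x))%:E)).
  by apply: filterS => x /=; rewrite E lee_fin ger0_norm ?cmod_ge0.
(* On a null space the norm is 0 by convention, and every property holds almost everywhere. *)
rewrite -leNgt => le0; exists setT; split => //.
by apply/eqP; rewrite eq_le le0 measure_ge0.
Qed.

End AlmostEverywhere.

(* [limn] of a divergent sequence is 0, so convergence need not be known. *)
Lemma sum_limn_le {R : realType} (I : Type) (s : seq I) (a : I -> nat -> R) (M : R) :
  (forall N, \sum_(t <- s) a t N ^+ 2 <= M) ->
  \sum_(t <- s) limn (a t) ^+ 2 <= M.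
Proof.
move=> le; pose y t N : R := if `[< cvgn (a t) >] then a t N else 0.
have yc t : (y t N : R) @[N --> \oo] --> limn (a t).
  rewrite /y; case: asboolP => [//|/dvgP ->]; exact: cvg_cst.
have sc : (\sum_(t <- s) y t N ^+ 2 : R) @[N --> \oo] --> \sum_(t <- s) limn (a t) ^+ 2.
  elim: s {le} => [|t s IH].
    by rewrite big_nil; under eq_fun do rewrite big_nil; exact: cvg_cst.
  rewrite big_cons; under eq_fun do rewrite big_cons.
  by apply: cvgD => //; under eq_fun do rewrite expr2; rewrite expr2; exact: cvgM.
rewrite -(cvg_lim _ sc)//; apply: limr_le; first by apply/cvg_ex; eexists; exact: sc.
near=> N; apply: le_trans (le N); apply: ler_sum => t _.
by rewrite /y; case: ifP => // _; rewrite expr0n /= sqr_ge0.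
Unshelve. all: by end_near. Qed.

(** * From finite families to the full square sum *)

Section FiniteFamilies.
Context {R : realType} {n m r : nat}.
Local Notation X1 := 'rV[R]_n.
Local Notation X2 := 'rV[R]_m.
Variables (mun : {sigma_finite_measure set X1 -> \bar R}).
Variables (mum : {sigma_finite_measure set X2 -> \bar R}).
Variables (lamn : X1 -> R -> R) (lamm : X2 -> R -> R).
Variables (Cn Cn' Cm Cm' alpha beta CK A : R).
Hypothesis udn : upper_doubling mun lamn Cn Cn'.
Hypothesis udm : upper_doubling mum lamm Cm Cm'.
Hypotheses (alpha_gt0 : 0 < alpha) (beta_gt0 : 0 < beta).
Hypotheses (n_gt0 : (0 < n)%N) (m_gt0 : (0 < m)%N).
Local Notation mm := (mun \x mum)%E.
Variables (T : (X1 * X2 -> R[i]) -> X1 * X2 -> R[i]).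
Hypothesis pcz : product_CZ mun mum lamn lamm alpha beta CK T.
Hypothesis TA : (opnorm mm T < A%:E)%E.
Variable b : X1 * X2 -> R[i].
Hypothesis b_bd : CL mm +oo%E b.
Let B := fine (CLnorm mm +oo%E b).

Let T2 : forall f, CL mm 2%:E f -> CL mm 2%:E (T f). Proof. by have [[]] := pcz. Qed.
Let Tlin : linear_on_L2 mm T. Proof. by have [[]] := pcz. Qed.

Lemma CLnormy_bounds : (0 <= CLnorm mm +oo%E b < +oo)%E.
Proof. by have [_ ->] := b_bd; rewrite andbT; exact: Lnorm_ge0. Qed.

Lemma box_measurable N : measurable (box N : set (X1 * X2)).
Proof.
have -> : (box N : set (X1 * X2)) =
    [set x | `|0 - x| <= N%:R] `*` [set y | `|0 - y| <= N%:R].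
  by apply/seteqP; split => -[x y] /=; rewrite !sub0r !normrN.
by apply: measurableX; apply: closed_meas; exact: closed_ball_closed.
Qed.

(* [b] need only be bounded almost everywhere: [b * 1_box] is replaced by its
   truncation at height [B], which [T] does not distinguish from it in L^2. *)
Lemma truncation N : exists f, bounded_box f B N%:R /\
  forall phi, sqi mm phi -> \int[mm]_x (phi x) ^+ 2 <= 1 ->
    dev mm (T (cres b (box N))) phi = dev mm (T f) phi.
Proof.
have [mb _] := b_bd.
pose D : set (X1 * X2) := [set x | cmod (b x) <= B].
have mD : measurable D.
  rewrite -[D]setTI; have := cmod_measurable mb measurableT (measurable_itv `]-oo, B]).
  by rewrite set_itvE.
pose c := cres b (box N).
have mc : Cmeasurable c by apply: cres_measurable => //; exact: box_measurable.
have B0 : 0 <= B by apply: fine_ge0; have /andP[] := CLnormy_bounds.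
have fbox : bounded_box (cres c D) B N%:R.
  split; first exact: cres_measurable.
  - move=> x; case: (pselect (D x)) => Dx; last first.
      by rewrite cres_out//= expr0n /= addr0 sqrtr0.
    rewrite cres_in// /c; case: (pselect (box N x)) => bx; first by rewrite cres_in.
    by rewrite cres_out//= expr0n /= addr0 sqrtr0.
  - move=> x xN; rewrite /cres /c cres_out ?mul0r// => -[x1 x2].
    by case: xN; rewrite ltNge ?x1 ?x2.
exists (cres c D); split => // phi hphi n1.
have cs := bounded_box_csqi udn udm fbox.
have [ds dn] : csqi mm (cres c (~` D)) /\ sqn mm (cres c (~` D)) = 0.
  apply: ae0_csqi; first by apply: cres_measurable => //; exact: measurableC.
  by have := ess_bound CLnormy_bounds; apply: filterS => x xB; rewrite cres_out// => /(_ xB).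
have [e1 e2] := bessel_add T2 Tlin cs ds hphi.
(* Bessel's inequality for the single function phi bounds the pairing by the L^2 norm of the image
   of a null function, which is 0. *)
have d0 : dev mm (T (cres c (~` D))) phi <= 0.
  have := @complex_bessel _ _ _ mm _ [:: tt] (fun=> phi) (T (cres c (~` D))) erefl
    (U_csqi T2 ds) (fun=> hphi) (fun=> n1) _.
  rewrite big_seq1 => /(_ _)/le_trans; apply; first by move=> [] [].
  by apply: le_trans (opnorm_sqn TA ds (U_csqi T2 ds)) _; rewrite dn mulr0.
have [z1 z2] : bessel_re mm (T (cres c (~` D))) phi = 0 /\
    bessel_im mm (T (cres c (~` D))) phi = 0.
  move: d0; rewrite /dev; move: (bessel_re _ _ _) (bessel_im _ _ _) => x y xy.
  have x2 := sqr_ge0 x; have y2 := sqr_ge0 y.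
  by split; apply/eqP; rewrite -sqrf_eq0; apply/eqP; lra.
by rewrite /dev -/c -[in LHS](cres_split c D) e1 e2 z1 z2 !addr0.
Qed.

Variables (wn vn : grid n) (wm vm : grid m).
Hypotheses (nqn : no_quadrants R vn) (nqm : no_quadrants R vm).
Variables (h : cube n -> X1 -> R) (u : cube m -> X2 -> R).
Hypothesis hh : haar_system mun wn h.
Hypothesis hu : haar_system mum wm u.
Local Notation pair := (cube n * cube m)%type.

Let phi (t : pair * pair) (x : X1 * X2) : R := h t.2.1 x.1 * u t.2.2 x.2.

Lemma rect_subset (p q : pair) : rect wn wm q `<=` (rect vn vm p : set (X1 * X2)) ->
  cset wn q.1 `<=` (cset vn p.1 : set X1) /\ cset wm q.2 `<=` (cset vm p.2 : set X2).
Proof.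
move=> sub; split => x hx.
  by have [] := sub (x, corner wm q.2) (conj hx (cset_corner wm q.2)).
by have [] := sub (corner wn q.1, x) (conj (cset_corner wn q.1) hx).
Qed.

Let K := core_const Cn Cn' Cm Cm' alpha beta CK A.

Lemma finite_estimate (F : seq (pair * pair)) : uniq F ->
  (forall t, t \in F -> inner_rects r (gam alpha Cn) (gam beta Cm) wn vn wm vm t.1 t.2) ->
  \sum_(t <- F) cmod (Tb_pairing mun mum T b (tensor (h t.2.1) (u t.2.2))) ^+ 2 <=
  K * B ^+ 2 * fine (mm (rectsU vn vm (map fst F))).
Proof.
move=> uF hF.
pose a (t : pair * pair) (c : bool) N : R :=
  part c (pairing mm (T (cres b (box N))) (tensor (h t.2.1) (u t.2.2))).
(* [Tb_pairing] takes the limits of the real and imaginary parts separately, so each component gets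
   its own index before the limits are removed. *)
have -> : \sum_(t <- F) cmod (Tb_pairing mun mum T b (tensor (h t.2.1) (u t.2.2))) ^+ 2 =
    \sum_(i <- [seq (t, c) | t <- F, c <- [:: true; false]]) limn (a i.1 i.2) ^+ 2.
  rewrite big_allpairs; apply: eq_bigr => t _.
  by rewrite cmod_sqr !big_cons big_nil /= addr0 addrC.
apply: (sum_limn_le (a := fun i => a i.1 i.2)) => N.
rewrite big_allpairs /=.
have sphi t : sqi mm (phi t) by exact: (sqi_prod (hs_sqi hh _) (hs_sqi hu _)).
have nphi t : \int[mm]_x (phi t x) ^+ 2 <= 1.
  under eq_Rintegral do rewrite /phi exprMn.
  have [_ i1] := hs_sqi hh t.2.1; have [_ i2] := hs_sqi hu t.2.2.
  rewrite (rintegral_prod i1 i2); apply: mulr_ile1.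
  + by apply: Rintegral_ge0 => x _; exact: sqr_ge0.
  + by apply: Rintegral_ge0 => x _; exact: sqr_ge0.
  + exact: hs_norm hh _.
  + exact: hs_norm hu _.
have [f [fbox fE]] := truncation N.
rewrite (eq_bigr (fun t => dev mm (T f) (phi t))); last first.
  by move=> t _; rewrite -fE// dev_pairing big_bool !big_cons big_nil /= addr0.
apply: (core_estimate (r := r) udn udm alpha_gt0 beta_gt0 n_gt0 m_gt0 pcz TA nqn nqm hh hu
  uF _ _ _ _ fbox).
- by move=> t /hF[].
- by move=> t /hF[_ _ sub _ _]; exact: rect_subset.
- move=> t /hF[gd _ _ _ _] P le sub; apply: good_sep gd le sub.
  exact: (gam_bounds udn).
- move=> t /hF[_ gd _ _ _] P le sub; apply: good_sep gd le sub.
  exact: (gam_bounds udm).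
Qed.

(** There are only countably many dyadic rectangles, so any union of them is measurable. *)
Lemma rect_open_measurable (Om : set (X1 * X2)) : rect_open vn vm Om -> measurable Om.
Proof.
move=> ro.
have -> : Om = \bigcup_(p : pair) (if `[< rect vn vm p `<=` Om >] then rect vn vm p else set0).
  apply/seteqP; split => x.
    by move=> /ro[p [px sub]]; exists p => //; case: asboolP.
  by move=> [p _]; case: asboolP => // sub; exact: sub.
apply: countable_bigcupT_measurable; first exact: countableP.
by move=> p; case: ifP => _ //; exact: rect_meas.
Qed.

(** The double sum is a supremum over finite families of pairs, and the outer rectangles of such a
    family have their union inside Omega. *)
Lemma esum_estimate (Om : set (X1 * X2)) : (mm Om < +oo)%E -> rect_open vn vm Om ->
  0 <= K ->
  (\esum_(S in [set S | rect vn vm S `<=` Om])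
    \esum_(Q in inner_rects r (gam alpha Cn) (gam beta Cm) wn vn wm vm S)
      (cmod (Tb_pairing mun mum T b (tensor (h Q.1) (u Q.2))) ^+ 2)%:E <=
   (K * B ^+ 2)%:E * mm Om)%E.
Proof.
move=> Omy ro K0; have mOm := rect_open_measurable ro.
rewrite esum_esum; last by move=> S Q _ _; rewrite lee_fin sqr_ge0.
apply: ub_ereal_sup => _ [F [finF subF] <-].
rewrite fsbig_finite//=.
set s := finmap.enum_fset _.
have us : uniq s by exact: finmap.fset_uniq.
have sF t : t \in s -> F t by rewrite /s in_fset_set// inE.
rewrite sumEFin -[mm Om]fineK ?ge0_fin_numE// -EFinM lee_fin.
apply: le_trans (finite_estimate us _) _.
  by move=> t /sF/subF[].
apply: ler_wpM2l; first by rewrite mulr_ge0 ?sqr_ge0.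
rewrite -lee_fin !fineK ?ge0_fin_numE//; last exact: (rectsU_lty udn udm).
apply: le_measure; rewrite ?inE//; first exact: rectsU_meas.
by move=> x [p /mapP[t /sF/subF[sub _] ->] px]; exact: sub.
Qed.

End FiniteFamilies.

Theorem theorem8p5 (R : realType) (n m r : nat)
    (Cn Cn' Cm Cm' alpha beta CK M : R)
    (r_gt0 : (0 < r)%N) (alpha_gt0 : 0 < alpha) (beta_gt0 : 0 < beta) :
  exists C : R,
  forall (mun : {sigma_finite_measure set 'rV[R]_n -> \bar R})
         (mum : {sigma_finite_measure set 'rV[R]_m -> \bar R})
         (lamn : 'rV[R]_n -> R -> R) (lamm : 'rV[R]_m -> R -> R)
         (cn : grid n -> cube n -> nat -> cube n)
         (cm : grid m -> cube m -> nat -> cube m)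
         (T : ('rV[R]_n * 'rV[R]_m -> R[i]) -> 'rV[R]_n * 'rV[R]_m -> R[i])
         (b : 'rV[R]_n * 'rV[R]_m -> R[i]),
    upper_doubling mun lamn Cn Cn' ->
    upper_doubling mum lamm Cm Cm' ->
    haar_indexing mun cn ->
    haar_indexing mum cm ->
    product_CZ mun mum lamn lamm alpha beta CK T ->
    (opnorm (mun \x mum) T <= M%:E)%E ->
    CL (mun \x mum)%E +oo%E b ->
    (BMOprod_norm mun mum cn cm r (gam alpha Cn) (gam beta Cm)
       (Tb_pairing mun mum T b)
     <= C%:E * CLnorm (mun \x mum)%E +oo%E b)%E.
Proof.
(* The added 1 turns the hypothesis on the operator norm into a strict bound. *)
pose K := core_const Cn Cn' Cm Cm' alpha beta CK (`|M| + 1).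
(* An upper bound for the number of pairs of indices eta, kappa. *)
pose c : R := (2 ^ n * 2 ^ m)%N%:R.
exists (Num.sqrt (c * K)) => mun mum lamn lamm cn cm T b udn udm hcn hcm pcz TM bb.
have TA : (opnorm (mun \x mum) T < (`|M| + 1)%:E)%E.
  by apply: le_lt_trans TM _; rewrite lte_fin (le_lt_trans (ler_norm M))// ltrDl.
have K0 : 0 <= K by exact: core_const_ge0.
have c0 : 0 <= c by exact: ler0n.
have bB := CLnormy_bounds bb.
have bE : CLnorm (mun \x mum)%E +oo%E b = (fine (CLnorm (mun \x mum)%E +oo%E b))%:E.
  by move: bB => /andP[? ?]; rewrite fineK// ge0_fin_numE.
rewrite bE -EFinM; set B := fine _.
have B0 : 0 <= B by move: bB => /andP[? _]; exact: fine_ge0.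
apply: ereal_inf_lbound; exists (Num.sqrt (c * K) * B) => //; split.
  by rewrite mulr_ge0// sqrtr_ge0.
move=> wn wn' wm wm' _ nqn _ nqm Om Omy ro.
pose Y := K * B ^+ 2 * fine ((mun \x mum)%E Om).
have Y0 : 0 <= Y by rewrite !mulr_ge0 ?sqr_ge0// fine_ge0.
set X := (\sum_(1 <= eta < 2 ^ n) _)%E.
have X0 : (0 <= X)%E.
  apply: sume_ge0 => eta _; apply: sume_ge0 => kappa _.
  by apply: esum_ge0 => S _; apply: esum_ge0 => Q _; rewrite lee_fin sqr_ge0.
have XY : (X <= (c * Y)%:E)%E.
  apply: (@le_trans _ _ (\sum_(1 <= eta < 2 ^ n) \sum_(1 <= kappa < 2 ^ m) Y%:E)%E).
    rewrite /X big_nat [leRHS]big_nat; apply: lee_sum => eta he.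
    rewrite big_nat [leRHS]big_nat; apply: lee_sum => kappa hk.
    (* A nonempty range of eta forces n > 0: in dimension 0 there are no Haar functions. *)
    have n0 : (0 < n)%N by move: he; clear; case: n => // /andP[h1 /(leq_trans h1)].
    have m0 : (0 < m)%N by move: hk; clear; case: m => // /andP[h1 /(leq_trans h1)].
    rewrite /Y EFinM fineK ?ge0_fin_numE//.
    exact: (esum_estimate udn udm alpha_gt0 beta_gt0 n0 m0 pcz TA bb nqn nqm
      (haar_is_system udn wn hcn he) (haar_is_system udm wm hcm hk) Omy ro K0).
  under eq_bigr do rewrite sumEFin.
  rewrite sumEFin lee_fin !sumr_const_nat -mulrnA -[leLHS]mulr_natl.
  apply: ler_wpM2r => //; rewrite ler_nat mulnC.
  by apply: leq_mul; exact: leq_subr.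
apply: (@le_trans _ _ ((c * Y)%:E `^ (2^-1))%E).
  apply: gt0_ler_poweR => //.
    by rewrite in_itv/= X0 leey.
  by rewrite in_itv/= leey andbT lee_fin mulr_ge0.
have mE : (mun \x mum)%E Om = (fine ((mun \x mum)%E Om))%:E by rewrite fineK ?ge0_fin_numE.
have m0 : 0 <= fine ((mun \x mum)%E Om) by exact: fine_ge0.
rewrite [X in (_ <= _ * X `^ _)%E]mE !poweR_EFin -EFinM lee_fin.
rewrite !powR12_sqrt ?mulr_ge0//.
have -> : c * Y = (c * K) * (B ^+ 2 * fine ((mun \x mum)%E Om)) by rewrite /Y; ring.
rewrite sqrtrM ?mulr_ge0// (sqrtrM _ (sqr_ge0 B)) sqrtr_sqr ger0_norm//.
by rewrite mulrA.
Qed.
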